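(* Let $\Omega=B_1(0)$ be the unit ball in $\mathbb{R}^n$, $n>2$, $-\infty<a<\frac{n-2}{2}$, $a\le b\le a+1$, $d=1+a-b\in(0,1]$, $q=\frac{2n}{n-2d}$, $0<c\le n-2-2a$ and $0<\lambda<\lambda_1$. Then there exists a nontrivial radial solution $u\in\mathcal{D}_{a,R}^{1,2}(\Omega)$ to the problem $$-\operatorname{div}\left(|x|^{-2a}Du\right)=|x|^{-bq}|u|^{q-2}u+\lambda|x|^{-2(a+1)+c}u\ \text{ in }\Omega,\qquad u=0\ \text{ on }\partial\Omega.$$
   Context: $\mathcal{D}_a^{1,2}(\Omega)$ is the completion of $C_0^\infty(\Omega)$ with respect to the norm $\|u\|=\left(\int_\Omega |x|^{-2a}|Du|^2\,dx\right)^{1/2}$, and $\mathcal{D}_{a,R}^{1,2}(\Omega)$ is its subspace of radial functions. First eigenvalue: $\lambda_1=\inf\left\{\int_\Omega|x|^{-2a}|Du|^2\,dx : u\in\mathcal{D}_a^{1,2}(\Omega),\ \int_\Omega|x|^{-2(a+1)+c}|u|^2\,dx=1\right\}>0$. A solution is understood in the weak sense: $u\in\mathcal{D}_a^{1,2}(\Omega)$ with $$\int_\Omega|x|^{-2a}Du\cdot D\varphi\,dx=\int_\Omega|x|^{-bq}|u|^{q-2}u\varphi\,dx+\lambda\int_\Omega|x|^{-2(a+1)+c}u\varphi\,dx$$ for all $\varphi\in\mathcal{D}_a^{1,2}(\Omega)$; it is nontrivial if $u\neq0$. *)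

(* Defs.v *)
From HB Require Import structures.
From mathcomp Require Import all_boot all_order all_algebra.
From mathcomp Require Import all_classical all_reals all_analysis.

Set Implicit Arguments.
Unset Strict Implicit.
Unset Printing Implicit Defensive.

Import Order.TTheory GRing.Theory Num.Theory.
Import numFieldNormedType.Exports.

Local Open Scope classical_set_scope.
Local Open Scope ring_scope.

(* [R^n] carries the sigma-algebra generated by the coordinates, that is, the
   Borel one. *)
Definition rV_display : measure_display -> measure_display.
Proof. exact. Qed.

Section measurable_rV.
Context {R : realType}.

Let coord n : 'I_n -> 'rV[R]_n -> R := fun i v => v ord0 i.

HB.instance Definition _ n := @isMeasurable.Build
  (rV_display default_measure_display)
  'rV[R]_n (g_sigma_preimage (@coord n))
  (@sigma_algebra0 _ setT _) (@sigma_algebraC _ _)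
  (@sigma_algebra_bigcup _ setT _).

Lemma measurable_coord n (i : 'I_n) :
  measurable_fun [set: 'rV[R]_n] (fun v => v ord0 i).
Proof.
move=> _ Y mY; rewrite setTI; apply: sub_sigma_algebra => /=.
rewrite -bigcup_seq/=; exists i => /=; first by rewrite mem_index_enum.
by exists Y => //; rewrite setTI.
Qed.

Lemma measurable_rV d (T : measurableType d) n (f : T -> 'rV[R]_n) :
  (forall i, measurable_fun [set: T] (fun x => f x ord0 i)) ->
  measurable_fun [set: T] f.
Proof.
move=> mf.
suff : g_sigma_preimage (fun i => coord i \o f) `<=` measurable.
  by rewrite g_sigma_preimage_comp => sub _ A mA; apply: sub; exists A.
apply: smallest_sub; first exact: sigma_algebra_measurable.
case: n => [|n] in f mf *; first by rewrite big_ord0.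
rewrite -bigcup_mkord_ord; apply: bigcup_sub => i Ii.
by move=> A [B mB <-]; exact: mf.
Qed.

(* [measurableTypeR R] is the type [R] itself; the library defines
   [lebesgue_measure] on this copy. *)
Definition rV_cons n (p : measurableTypeR R * 'rV[R]_n) : 'rV[R]_n.+1 :=
  \row_i (if unlift ord0 i is Some j then p.2 ord0 j else p.1).

Definition rV_uncons n (v : 'rV[R]_n.+1) : measurableTypeR R * 'rV[R]_n :=
  (v ord0 ord0, \row_j v ord0 (lift ord0 j)).

Lemma rV_consK n : cancel (@rV_cons n) (@rV_uncons n).
Proof.
move=> [x v]; rewrite /rV_cons /rV_uncons; congr pair => /=.
  by rewrite mxE unlift_none.
by apply/rowP => j; rewrite !mxE liftK.
Qed.

Lemma rV_unconsK n : cancel (@rV_uncons n) (@rV_cons n).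
Proof.
move=> v; apply/rowP => i; rewrite mxE; case: unliftP => [j ->|->] //=.
by rewrite mxE.
Qed.

Lemma measurable_rV_cons n : measurable_fun setT (@rV_cons n).
Proof.
apply: measurable_rV => i.
rewrite (_ : (fun _ => _) = fun p : measurableTypeR R * 'rV[R]_n =>
  if unlift ord0 i is Some j then p.2 ord0 j else p.1); last first.
  by apply/funext => p; rewrite mxE.
case: (unlift ord0 i) => [j|]; last exact: measurable_fst.
apply: (@measurableT_comp _ _ _ _ _ _ (fun v : 'rV[R]_n => v ord0 j)) => //.
exact: measurable_coord.
Qed.

Lemma measurable_rV_uncons n : measurable_fun setT (@rV_uncons n).
Proof.
apply/measurable_fun_pairP; split; first exact: measurable_coord.
apply: measurable_rV => j.
rewrite (_ : (fun _ => _) = fun v : 'rV[R]_n.+1 => v ord0 (lift ord0 j)).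
  exact: measurable_coord.
by apply/funext => v; rewrite /= mxE.
Qed.

End measurable_rV.

Section lebesgue_rV.
Context {R : realType}.

Section step.
Variables (n : nat) (mu : {sigma_finite_measure set 'rV[R]_n -> \bar R}).

Definition lebesgue_cons : set 'rV[R]_n.+1 -> \bar R :=
  pushforward (lebesgue_measure \x mu)%E (@rV_cons R n).

Let cons_measure : {measure set 'rV[R]_n.+1 -> \bar R} :=
  measure_function_pushforward__canonical__measure_function_Measure
    (lebesgue_measure \x mu)%E (@measurable_rV_cons R n).

HB.instance Definition _ := isMeasure.Build _ _ _ lebesgue_cons
  (measure0 cons_measure) (@measure_ge0 _ _ _ cons_measure)
  (@measure_semi_sigma_additive _ _ _ cons_measure).

Let lebesgue_cons_sigma_finite : sigma_finite setT lebesgue_cons.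
Proof.
have /sigma_finiteP[F [TF ndF Foo]] := sigma_finiteT (@lebesgue_measure R).
have /sigma_finiteP[G [TG ndG Goo]] := sigma_finiteT mu.
exists (fun k => @rV_uncons R n @^-1` (F k `*` G k)).
  apply/esym/seteqP; split => // v _.
  have [i _ Fi] : (\bigcup_i F i) (v ord0 ord0) by rewrite -TF.
  have [j _ Gj] : (\bigcup_i G i) (rV_uncons v).2 by rewrite -TG.
  exists (maxn i j) => //; split.
  - by move: Fi; exact/subsetPset/ndF/leq_maxl.
  - by move: Gj; exact/subsetPset/ndG/leq_maxr.
move=> k; have [mF ?] := Foo k; have [mG ?] := Goo k; split.
  rewrite -[X in measurable X]setTI; apply: measurable_rV_uncons => //.
  exact: measurableX.
rewrite /lebesgue_cons /pushforward -comp_preimage.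
rewrite (_ : _ \o _ = id); last by apply/funext => p; exact: rV_consK.
by rewrite product_measure1E// lte_mul_pinfty// ge0_fin_numE.
Qed.

HB.instance Definition _ := Measure_isSigmaFinite.Build _ _ _ lebesgue_cons
  lebesgue_cons_sigma_finite.

End step.

Fixpoint lebesgue_rV n : {sigma_finite_measure set 'rV[R]_n -> \bar R} :=
  match n with
  | 0 => dirac (0 : 'rV[R]_0)
  | m.+1 => lebesgue_cons (lebesgue_rV m)
  end.

Lemma lebesgue_rV_box n (A : 'I_n -> set (measurableTypeR R)) :
  (forall i, measurable (A i)) ->
  lebesgue_rV n [set v | forall i, A i (v ord0 i)] =
  (\prod_(i < n) lebesgue_measure (A i))%E.
Proof.
elim: n A => [|n IHn] A mA.
  by rewrite big_ord0 /= diracE mem_set// => -[].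
rewrite big_ord_recl -IHn//= /lebesgue_cons /pushforward.
rewrite -product_measure1E//; last first.
  rewrite (_ : (fun _ => _) =
      \bigcap_(i in [set: 'I_n]) ((fun v : 'rV[R]_n => v ord0 i) @^-1` A (lift ord0 i))).
    apply: fin_bigcap_measurable => // i _.
    rewrite -[X in measurable X]setTI.
    by apply: measurable_coord; [exact: measurableT|exact: mA].
  by apply/seteqP; split => [v Av i _|v Av i]; exact: Av.
congr (_ _); apply/seteqP; split => [[x v] /= Axv|[x v] /= [Ax Av] i].
  split; first by have := Axv ord0; rewrite mxE unlift_none.
  by move=> i; have := Axv (lift ord0 i); rewrite mxE liftK.
by rewrite mxE; case: unliftP => [j ->|->].
Qed.

End lebesgue_rV.

Section euclidean.
Context {R : realType} {n : nat}.

Definition edot (x y : 'rV[R]_n) : R := \sum_(i < n) x ord0 i * y ord0 i.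

(* The library norm on ['rV[R]_n] is the sup norm, hence this one. *)
Definition enorm (x : 'rV[R]_n) : R := Num.sqrt (edot x x).

Definition unit_ball : set 'rV[R]_n := [set x | enorm x < 1].

Definition partial (i : 'I_n) (f : 'rV[R]_n -> R) : 'rV[R]_n -> R :=
  fun x => 'D_(delta_mx ord0 i) f x.

Definition grad (f : 'rV[R]_n -> R) (x : 'rV[R]_n) : 'rV[R]_n :=
  \row_i partial i f x.

(* Partial derivatives of all orders exist and are continuous. *)
Definition smooth (f : 'rV[R]_n -> R) : Prop :=
  forall s : seq 'I_n,
    continuous (foldr partial f s) /\
    forall i x, derivable (foldr partial f s) x (delta_mx ord0 i).

Definition test_function (Omega : set 'rV[R]_n) (f : 'rV[R]_n -> R) : Prop :=
  let supp := closure [set x | f x != 0] in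
  [/\ smooth f, compact supp & supp `<=` Omega].

End euclidean.

Section weighted_sobolev.
Context {R : realType} {n : nat}.
Variables (a : R) (Omega : set 'rV[R]_n).
Implicit Types (u v : 'rV[R]_n -> R) (G H : 'rV[R]_n -> 'rV[R]_n).

Definition pairing G H : \bar R :=
  \int[lebesgue_rV n]_(x in Omega)
    (enorm x `^ (- (2 * a)) * edot (G x) (H x))%:E.

(* [u] is an element of D_a^{1,2}(Omega) and [G] is its gradient Du.
   An element of the completion of C_0^oo(Omega) is the limit of a sequence
   (phi_k) that is Cauchy for the norm; it is realised here as a function, the
   a.e. limit of such a sequence, and Du is the limit of (D phi_k) in
   L^2(Omega, |x|^(-2a) dx). For a < (n-2)/2 this realisation is faithful: by
   Hardy's inequality every Cauchy sequence converges in
   L^2(Omega, |x|^(-2(a+1)) dx), hence a.e. along a subsequence, and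
   [u] and [G] determine each other up to null sets. The integrals below only
   depend on [u] and [G] on Omega, up to null sets. *)
Definition D12_grad u G : Prop :=
  [/\ measurable_fun Omega u,
      measurable_fun Omega G &
      exists phi : nat -> 'rV[R]_n -> R,
        [/\ forall k, test_function Omega (phi k),
            (let E k x := grad (phi k) x - G x in pairing (E k) (E k))
              @[k --> \oo] --> 0%E &
            {ae lebesgue_rV n, forall x, Omega x ->
              phi k x @[k --> \oo] --> u x}]].

Definition D12 u : Prop := exists G, D12_grad u G.

Definition radial u : Prop :=
  exists v : R -> R,
    {ae lebesgue_rV n, forall x, Omega x -> u x = v (enorm x)}.

Definition D12_radial u : Prop := D12 u /\ radial u.

Definition nontrivial u : Prop :=
  ~ {ae lebesgue_rV n, forall x, Omega x -> u x = 0}.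

Definition lambda1 (c : R) : \bar R :=
  ereal_inf [set pairing p.2 p.2 | p in
    [set p : ('rV[R]_n -> R) * ('rV[R]_n -> 'rV[R]_n) |
      D12_grad p.1 p.2 /\
      (\int[lebesgue_rV n]_(x in Omega)
        (enorm x `^ (- (2 * (a + 1)) + c) * `|p.1 x| ^+ 2)%:E = 1)%E]].

(* Weak solutions of
     - div (|x|^(-2a) Du) = |x|^(-bq) |u|^(q-2) u + lam |x|^(-2(a+1)+c) u
   in Omega, u = 0 on the boundary. The equation holds in [\bar R]; its left
   side is finite by Cauchy-Schwarz and a sum is finite only if both terms are,
   so no integral takes a junk value. *)
Definition weak_solution (b c q lam : R) u : Prop :=
  exists2 G, D12_grad u G &
    forall phi H, D12_grad phi H ->
      (pairing G H =
        \int[lebesgue_rV n]_(x in Omega)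
          (enorm x `^ (- (b * q)) * `|u x| `^ (q - 2) * u x * phi x)%:E
        + lam%:E * \int[lebesgue_rV n]_(x in Omega)
          (enorm x `^ (- (2 * (a + 1)) + c) * u x * phi x)%:E)%E.

End weighted_sobolev.

(* Main.v *)
Require Import Defs.
From mathcomp Require Import all_boot all_order all_algebra.
From mathcomp Require Import all_classical all_reals all_analysis.
From mathcomp Require Import measurable_realfun.
From mathcomp Require Import ring lra.
Set Implicit Arguments.
Unset Strict Implicit.
Unset Printing Implicit Defensive.
Import Order.TTheory GRing.Theory Num.Theory.
Import numFieldNormedType.Exports.
Local Open Scope classical_set_scope.
Local Open Scope ring_scope.

(* Shooting.  For u(x) = A Z(beta ln |x|^2), with beta = (n - 2 - 2a) / 2,
   kap = q / 2 - 1, gam = c / (2 beta) and k = 1 / (4 beta^2), the equation reads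
     Z' = - V,   V' = - V + k (eps e^(kap s) Z^(q-1) + lam e^(gam s) Z),  s <= 0,
   where Z = 1 at -oo (the origin of the ball) and A^(q-2) = eps; the solution
   vanishes on the sphere if Z(0) = 0.  In the variable t = e^(s / N), N large,
   Picard iteration gives Z for every eps >= 0, continuously in eps.

   For eps = 0 there is no zero on ]-oo, 0]: rescaling the first one to the
   sphere would give a function with Rayleigh quotient at most lam < lambda1.
   For large eps there is a zero: otherwise the slope V / Z would come close to 1,
   which contradicts the monotonicity of the energy.  At the infimum of the eps
   for which there is a zero, Z is nonnegative and vanishes at 0.

   The profile is a limit in D_a^{1,2} of smooth radial functions that are
   constant near the origin and vanish near the sphere.  The weak equation holds for test functions
   by the divergence identity; it passes to the completion because the source
   times |phi_k - phi| tends to 0 in L^1, by Young's inequality and Fatou's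
   lemma. *)

(** * Calculus on the line *)

(** The exponent q is critical: the weighted norms of the gradient and of the power term scale alike
    under dilations, so the embedding is not compact and minimisation does not directly yield a
    solution. In the radial equation the same criticality appears as a conservation law: for lam = 0
    the Pohozaev energy is constant, hence 0, whereas at a first zero of Z it would equal e^s V^2 >
    0. Only the lam term, which makes the energy grow, can create a zero. The assumption c <= n - 2
    - 2a reads gam <= 1; it makes this growth outweigh the other terms for large eps. The value of Z
    at the origin is normalised and the amplitude is moved into the coefficient eps, so that a
    solution stays in [0, 1] as long as it is nonnegative; the nonlinearity can then be clipped to a
    globally Lipschitz one without changing it. The variable t turns the singular end -oo into the
    regular point 0 and the half-line into ]0, 1], which makes the dependence on eps uniform in
    s. *)

Section calculus.
Context {R : realType}.
Implicit Types (f g h df dg dh : R -> R) (a b x y : R).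

Lemma is_derive_continuous f x (d : R) : is_derive x 1 f d -> {for x, continuous f}.
Proof. by move=> [e _]; exact/differentiable_continuous/derivable1_diffP. Qed.

Lemma continuous_itvW f a b : (forall x, a <= x <= b -> {for x, continuous f}) ->
  {within `[a, b], continuous f}.
Proof.
move=> cf; apply: continuous_in_subspaceT => x; rewrite inE/= in_itv/=.
exact: cf.
Qed.

Lemma ge0_deriv_le h dh a b : a <= b ->
  (forall x, a < x < b -> is_derive x 1 h (dh x)) ->
  (forall x, a < x < b -> 0 <= dh x) ->
  {within `[a, b], continuous h} -> h a <= h b.
Proof.
rewrite le_eqVlt => /predU1P[->//|ab] dhE dh0 ch.
have dhE' x : x \in `]a, b[ -> is_derive x 1 h (dh x).
  by rewrite in_itv/=; exact: dhE.
have [c + E] := MVT ab dhE' ch.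
by rewrite in_itv/= -subr_ge0 E => cab; rewrite mulr_ge0 ?dh0// subr_ge0 ltW.
Qed.

Lemma deriv_le_within f g df dg a b : a <= b ->
  (forall x, a < x < b -> is_derive x 1 f (df x)) ->
  (forall x, a < x < b -> is_derive x 1 g (dg x)) ->
  (forall x, a < x < b -> df x <= dg x) ->
  {within `[a, b], continuous f} -> {within `[a, b], continuous g} ->
  f b - f a <= g b - g a.
Proof.
move=> ab dfE dgE le cf cg.
suff: (g - f) a <= (g - f) b by rewrite !fctE; lra.
apply: (@ge0_deriv_le (g - f) (dg - df)) => // [x xab|x xab|].
- by have := dfE _ xab; have := dgE _ xab => ? ?; exact: is_deriveB.
- by rewrite fctE subr_ge0 le.
- by move=> x; apply: continuousD _; [exact: cg|exact/continuousN/cf].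
Qed.

Lemma deriv_le f g df dg a b : a <= b ->
  (forall x, a <= x <= b -> is_derive x 1 f (df x)) ->
  (forall x, a <= x <= b -> is_derive x 1 g (dg x)) ->
  (forall x, a < x < b -> df x <= dg x) ->
  f b - f a <= g b - g a.
Proof.
move=> ab dfE dgE le.
apply: (@deriv_le_within f g df dg) => //.
- by move=> x /andP[? ?]; apply: dfE; rewrite !ltW.
- by move=> x /andP[? ?]; apply: dgE; rewrite !ltW.
- by apply: continuous_itvW => x /dfE; exact: is_derive_continuous.
- by apply: continuous_itvW => x /dgE; exact: is_derive_continuous.
Qed.

Lemma deriv_norm_le f g df dg a b : a <= b ->
  (forall x, a <= x <= b -> is_derive x 1 f (df x)) ->
  (forall x, a <= x <= b -> is_derive x 1 g (dg x)) ->
  (forall x, a < x < b -> `|df x| <= dg x) ->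
  `|f b - f a| <= g b - g a.
Proof.
move=> ab dfE dgE le; rewrite ler_norml; apply/andP; split.
  have : (- f) b - (- f) a <= g b - g a.
    apply: (@deriv_le (- f) g (- df) dg) => //.
    - by move=> x /dfE ?; exact: is_deriveN.
    - by move=> x /le; rewrite ler_norml lerNl => /andP[].
  by rewrite !fctE; lra.
apply: (@deriv_le f g df dg) => // x /le; by rewrite ler_norml => /andP[].
Qed.

Lemma deriv_const f a b : a <= b ->
  (forall x, a <= x <= b -> is_derive x 1 f 0) -> f b = f a.
Proof.
move=> ab df; apply/eqP; rewrite -subr_eq0 -normr_le0.
rewrite -[X in _ <= X](subrr ((cst 0 : R -> R) b)).
apply: (@deriv_norm_le f (cst 0) (cst 0) (cst 0) a b ab df) => x _.
by rewrite normr0.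
Qed.

Let mu := @lebesgue_measure R.

(* The primitive vanishing at 0; the lower bound of integration is
   irrelevant as long as it lies to the left of 0 and x. *)
Definition prim f : R -> R := locked (fun x =>
  (\int[mu]_(t in `[(- `|x| - 1)%R, x]) f t)
  - (\int[mu]_(t in `[(- `|x| - 1)%R, 0%R]) f t)).

Lemma continuous_itv_integrable f a b : continuous f ->
  mu.-integrable `[a, b] (EFin \o f).
Proof.
move=> cf; apply: continuous_compact_integrable; first exact: segment_compact.
exact: continuous_subspaceT.
Qed.

(** The bound [- |x| - 1] moves with x, which the fundamental theorem of calculus does not allow;
    additivity of the integral trades it for one bound A that serves a whole neighbourhood of x. *)
Lemma prim_lower f A x : continuous f -> A <= x -> A <= 0 ->
  prim f x = (\int[mu]_(t in `[A, x]) f t) - (\int[mu]_(t in `[A, 0%R]) f t).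
Proof.
move=> cf; rewrite /prim -lock.
have H B C y : B <= C -> C <= y ->
    \int[mu]_(t in `[B, y]) f t = \int[mu]_(t in `[B, C]) f t +
      \int[mu]_(t in `]C, y]) f t.
  move=> BC Cy; apply/eqP; rewrite addrC -subr_eq; apply/eqP.
  apply: Rintegral_itvB; rewrite ?bnd_simp//.
  exact: continuous_itv_integrable.
have H' B C y : B <= C -> C <= y -> C <= 0 ->
    \int[mu]_(t in `[B, y]) f t - \int[mu]_(t in `[B, 0%R]) f t =
    \int[mu]_(t in `[C, y]) f t - \int[mu]_(t in `[C, 0%R]) f t.
  move=> BC Cy C0; rewrite (H B C y)// (H B C 0)//.
  rewrite (H C C y)// (H C C 0)//; lra.
have nx := ler_norm x; have nNx : - x <= `|x| by rewrite -normrN ler_norm.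
have n0 := normr_ge0 x.
move=> Ax A0; have /orP[le|le] := le_total A (- `|x| - 1).
  by apply/esym/H' => //; lra.
by apply: H'.
Qed.

Lemma prim0 f : prim f 0 = 0.
Proof. by rewrite /prim -lock subrr. Qed.

Lemma is_derive_prim f x : continuous f -> is_derive x 1 (prim f) (f x).
Proof.
move=> cf; pose A := - `|x| - 2.
have nx := ler_norm x; have nNx : - x <= `|x| by rewrite -normrN ler_norm.
have n0 := normr_ge0 x.
have Ax : A < x by rewrite /A; lra.
apply: (@near_eq_is_derive _ _ _
  (fun y => (\int[mu]_(t in `[A, y]) f t) - (\int[mu]_(t in `[A, 0%R]) f t))).
  near=> y; rewrite (prim_lower (A := A))//; last by rewrite /A; lra.
  by near: y; exact: lt_le_nbhsr.
have [] := @continuous_FTC1_closed _ f A x (x + 1).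
- lra.
- exact: continuous_itv_integrable.
- by [].
- exact: cf.
move=> d dE; rewrite -[f x]subr0; apply: is_deriveB.
by apply: DeriveDef => //; rewrite -derive1E.
Unshelve. all: by end_near. Qed.

End calculus.

Section pointwise_derivatives.
Context {R : realType}.
Implicit Types (f g : R -> R) (x df dg : R).

Lemma derD f g x df dg : is_derive x 1 f df -> is_derive x 1 g dg ->
  is_derive x 1 (fun t => f t + g t) (df + dg).
Proof. by move=> *; exact: is_deriveD. Qed.

Lemma derN f x df : is_derive x 1 f df -> is_derive x 1 (fun t => - f t) (- df).
Proof. by move=> *; exact: is_deriveN. Qed.

Lemma derM f g x df dg : is_derive x 1 f df -> is_derive x 1 g dg ->
  is_derive x 1 (fun t => f t * g t) (df * g x + f x * dg).
Proof.
move=> dF dG; apply: is_derive_eq (is_deriveM dF dG) _.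
by rewrite addrC /GRing.scale/= mulrC.
Qed.

Lemma derV f x df : f x != 0 -> is_derive x 1 f df ->
  is_derive x 1 (fun t => (f t)^-1) (- df / (f x) ^+ 2).
Proof.
move=> f0 dF; apply: is_derive_eq (is_deriveV f0 dF) _.
by rewrite /GRing.scale/= mulrC mulrN mulNr.
Qed.

Lemma derX f n x df : is_derive x 1 f df ->
  is_derive x 1 (fun t => f t ^+ n.+1) (n.+1%:R * f x ^+ n * df).
Proof.
move=> dF; rewrite (_ : (fun _ => _) = f ^+ n.+1).
  exact: is_deriveX.
by apply/funext => t; rewrite fctE.
Qed.

Lemma der_exp f x df : is_derive x 1 f df ->
  is_derive x 1 (fun t => expR (f t)) (expR (f x) * df).
Proof. by move=> dF; exact: (is_derive1_comp (is_derive_expR _)). Qed.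

Lemma der_ln f x df : 0 < f x -> is_derive x 1 f df ->
  is_derive x 1 (fun t => ln (f t)) (df / f x).
Proof.
move=> f0 dF; rewrite mulrC.
exact: (is_derive1_comp (is_derive1_ln f0)).
Qed.

Lemma der_powR f p x df : 0 < f x -> is_derive x 1 f df ->
  is_derive x 1 (fun t => f t `^ p) (p * f x `^ (p - 1) * df).
Proof.
by move=> f0 dF; exact: (is_derive1_comp (is_derive1_powR p f0)).
Qed.

Lemma der_comp f g x df dg : is_derive (g x) 1 f df -> is_derive x 1 g dg ->
  is_derive x 1 (fun t => f (g t)) (df * dg).
Proof. by move=> *; exact: is_derive1_comp. Qed.

Lemma der_cst (c x : R) : is_derive x 1 (fun=> c) 0.
Proof. exact: is_derive_cst. Qed.

Lemma der_id x : is_derive x 1 (fun t : R => t) 1.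
Proof. exact: is_derive_id. Qed.

End pointwise_derivatives.

(** Differentiates an expression by its syntax and leaves the derivative as an existential variable,
    to be matched with the announced one through [is_derive_eq] and [ring] or [field]. Nonvanishing
    and positivity conditions are left to the caller. *)
Ltac der :=
  lazymatch goal with
  | |- is_derive _ _ (fun _ => ?c) _ => apply: der_cst
  | |- is_derive _ _ (fun t => t) _ => apply: der_id
  | |- is_derive _ _ (fun t => @?f t + @?g t) _ => eapply derD; [der|der]
  | |- is_derive _ _ (fun t => - @?f t) _ => eapply derN; der
  | |- is_derive _ _ (fun t => @?f t * @?g t) _ => eapply derM; [der|der]
  | |- is_derive _ _ (fun t => (@?f t)^-1) _ => eapply derV; [|der]
  | |- is_derive _ _ (fun t => (@?f t) ^+ _.+1) _ => eapply derX; der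
  | |- is_derive _ _ (fun t => expR (@?f t)) _ => eapply der_exp; der
  | |- is_derive _ _ (fun t => ln (@?f t)) _ => eapply der_ln; [|der]
  | |- is_derive _ _ (fun t => (@?f t) `^ _) _ => eapply der_powR; [|der]
  | |- is_derive _ _ (GRing.mul ?c) _ => change (GRing.mul c) with (fun t => c * t); der
  | |- is_derive _ _ (GRing.add ?c) _ => change (GRing.add c) with (fun t => c + t); der
  | |- is_derive _ _ (@GRing.opp ?T) _ => change (@GRing.opp T) with (fun t : T => - t); der
  | |- is_derive _ _ (@GRing.inv ?T) _ => change (@GRing.inv T) with (fun t : T => t^-1); der
  | |- is_derive _ _ (@expR ?T) _ => apply: is_derive_expR
  | |- _ => first [eassumption | apply: is_derive_id]
  end.

(** * Weighted means inverting the radial operator *)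

Section radial_operator.
Context {R : realType} (N : nat).
Implicit Types (h : R -> R) (t s : R).

(** The solution y of (t^(N+1) y)' = t^N h that stays bounded at 0, that is, 1 / (N + 1) times a
    weighted mean of h over [0, t]. The default value 0 on t <= 0 fits continuously when h vanishes
    at 0. *)
Definition avg h : R -> R := locked (fun t =>
  if t <= 0 then 0 else prim (fun s => s ^+ N * h s) t / t ^+ N.+1).

Lemma avg_le0 h t : t <= 0 -> avg h t = 0.
Proof. by rewrite /avg -lock => ->. Qed.

Lemma avg_gt0 h t : 0 < t ->
  avg h t = prim (fun s => s ^+ N * h s) t / t ^+ N.+1.
Proof. by rewrite /avg -lock leNgt => ->. Qed.

Lemma continuous_wt h : continuous h -> continuous (fun s : R => s ^+ N * h s).
Proof.
move=> ch x; apply: cvgM; last exact: ch.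
exact: exprn_continuous.
Qed.

(** The comparison function B s^(N+1) has slope (N + 1) B s^N; the factor N + 1 is given away,
    because the contraction of the Picard map will come from an exponential weight instead. *)
Lemma prim_wt_diff h1 h2 (B : R) t : continuous h1 -> continuous h2 -> 0 <= t ->
  (forall s, 0 <= s <= t -> `|h1 s - h2 s| <= B) ->
  `|prim (fun s => s ^+ N * h1 s) t - prim (fun s => s ^+ N * h2 s) t|
  <= B * t ^+ N.+1.
Proof.
move=> c1 c2 t0 hB.
have B0 : 0 <= B by apply: le_trans (hB 0 _); rewrite // lexx.
have := @deriv_norm_le _ (fun s => prim (fun s => s ^+ N * h1 s) s
   - prim (fun s => s ^+ N * h2 s) s) (fun s => B * s ^+ N.+1)
   (fun s => s ^+ N * h1 s - s ^+ N * h2 s)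
   (fun s => B * (N.+1%:R * s ^+ N)) 0 t t0.
rewrite !prim0 !subr0 expr0n/= mulr0 subr0; apply => x x0t.
- by apply: derD; [|apply: derN]; apply: is_derive_prim; exact: continuous_wt.
- by eapply is_derive_eq; [der|rewrite /=; ring].
- rewrite -mulrBr normrM; case/andP: x0t => x0 xt.
  have xN : 0 <= x ^+ N by rewrite exprn_ge0// ltW.
  rewrite (ger0_norm xN).
  apply: le_trans (ler_wpM2l xN (hB x _)) _; first by rewrite !ltW.
  rewrite mulrC ler_wpM2l//.
  by rewrite ler_peMl// ?exprn_ge0 ?ler1n// ltW.
Qed.

Lemma avg_diff h1 h2 (B : R) t : continuous h1 -> continuous h2 ->
  (forall s, 0 <= s <= t -> `|h1 s - h2 s| <= B) -> 0 <= t ->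
  `|avg h1 t - avg h2 t| <= B.
Proof.
move=> c1 c2 hB; rewrite le_eqVlt => /predU1P[t0|t0].
  rewrite -t0 !avg_le0// subrr normr0.
  by apply: le_trans (hB 0 _); rewrite // -t0 lexx.
rewrite !avg_gt0// -mulrBl normrM normfV (gtr0_norm (exprn_gt0 _ t0)).
rewrite ler_pdivrMr ?exprn_gt0//.
by apply: prim_wt_diff => //; exact: ltW.
Qed.

Lemma avg_norm h (B : R) t : continuous h -> (forall s, 0 <= s <= t -> `|h s| <= B) ->
  0 <= t -> `|avg h t| <= B.
Proof.
move=> ch hB t0.
have avg0 : avg (cst 0) t = 0.
  have [t0'|t0'] := leP t 0; first by rewrite avg_le0.
  rewrite avg_gt0//.
  apply/eqP; rewrite mulf_eq0; apply/orP; left; apply/eqP.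
  rewrite -[RHS](prim0 (fun s => s ^+ N * cst 0 s)).
  apply: (@deriv_const _ _ 0 t) => // x _.
  rewrite [X in is_derive _ _ _ X](_ : 0 = x ^+ N * cst 0 x); last by rewrite mulr0.
  by apply: is_derive_prim; apply: continuous_wt; exact: cst_continuous.
rewrite -[avg h t]subr0 -[X in _ - X]avg0.
apply: avg_diff => //; first exact: cst_continuous.
by move=> s st; rewrite /cst subr0 hB.
Qed.

Lemma is_derive_avg h t : continuous h -> 0 < t ->
  is_derive t 1 (fun s => s ^+ N.+1 * avg h s) (t ^+ N * h t).
Proof.
move=> ch t0; apply: near_eq_is_derive (is_derive_prim t (continuous_wt ch)).
near=> s.
have s0 : 0 < s by near: s; exact: lt_nbhsr.
by rewrite avg_gt0// mulrC divfK// gt_eqF// exprn_gt0.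
Unshelve. all: by end_near. Qed.

(** At 0 the mean is controlled by the supremum of |h| over [0, s], which tends to |h 0| = 0; at
    positive points division by t^(N+1) is harmless. *)
Lemma avg_continuous h : continuous h -> h 0 = 0 -> continuous (avg h).
Proof.
move=> ch h0 t; have [t0|t0|->] := ltgtP t 0.
- rewrite /continuous_at (avg_le0 _ (ltW t0)).
  apply: cvg_near_cst; near=> s; apply: avg_le0.
  by near: s; exact: lt_le_nbhsl.
- have := is_derive_continuous (is_derive_avg ch t0).
  move=> c; have c' := cvgM (cvgV (lt0r_neq0 (exprn_gt0 N.+1 t0)) (@exprn_continuous R N.+1 t)) c.
  rewrite /continuous_at.
  rewrite [X in _ --> X](_ : _ = (t ^+ N.+1)^-1 * (t ^+ N.+1 * avg h t)); last first.
    by rewrite mulKf// gt_eqF// exprn_gt0.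
  apply/(cvg_trans _ (c' _ _))/near_eq_cvg; near=> s.
  have s0 : 0 < s by near: s; exact: lt_nbhsr.
  by rewrite /= mulKf// gt_eqF// exprn_gt0.
- rewrite /continuous_at avg_le0//; apply/cvgrPdist_le => e e0.
  have /cvgrPdist_le/(_ _ e0)[d /= d0 dh] := ch 0.
  near=> s; rewrite sub0r normrN; have [s0|s0] := leP s 0.
    by rewrite avg_le0// normr0 ltW.
  apply: avg_norm => //; last exact: ltW.
  move=> r /andP[r0 rs]; have := dh r; rewrite h0 /= !sub0r !normrN; apply.
  rewrite ger0_norm//; apply: le_lt_trans rs _; near: s.
  exact: lt_nbhsl.
Unshelve. all: by end_near. Qed.

End radial_operator.

(** * Picard iteration *)

Section geometric_increments.
Context {R : realType}.

Lemma geometric_increments (u : nat -> R) (C : R) :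
  (forall k, `|u k.+1 - u k| <= C / 2 ^+ k) ->
  cvgn u /\ forall k, `|limn u - u k| <= 2 * C / 2 ^+ k.
Proof.
move=> uC; have C0 : 0 <= C.
  by have := le_trans (normr_ge0 _) (uC 0%N); rewrite expr0 divr1.
have cu : cvgn u.
  rewrite (_ : u = fun n => u 0%N + series (telescope u) n); last first.
    by apply/funext => n; exact: eq_sum_telescope.
  apply: is_cvgD; first exact: is_cvg_cst.
  apply: normed_cvg; apply: (@series_le_cvg _ _ (geometric C 2^-1)).
  - by move=> n; exact: normr_ge0.
  - by move=> n; rewrite /geometric/= mulr_ge0// exprn_ge0.
  - by move=> n; rewrite /geometric/= exprVn; exact: uC.
  - apply: is_cvg_geometric_series.
    by rewrite ger0_norm; lra.
split=> // k.
(* The exact partial sum of the geometric series, with its factor 1 - 2^-m, makes the induction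
   close; the cruder bound follows from it. *)
have dm m : `|u (k + m)%N - u k| <= 2 * C / 2 ^+ k * (1 - 2^-1 ^+ m).
  elim: m => [|m IH]; first by rewrite addn0 subrr normr0 expr0 subrr mulr0.
  apply: le_trans (ler_distD (u (k + m)%N) _ _) _.
  have := uC (k + m)%N; rewrite -addnS => ukm.
  apply: le_trans (lerD ukm IH) _.
  rewrite exprD !exprVn exprS.
  rewrite le_eqVlt; apply/orP; left; apply/eqP; field.
  by rewrite !expf_neq0.
have d m : `|u (k + m)%N - u k| <= 2 * C / 2 ^+ k.
  apply: le_trans (dm m) _; apply: ler_piMr.
    by rewrite !mulr_ge0// invr_ge0 exprn_ge0.
  by rewrite gerBl exprn_ge0.
apply: (cvgr_to_le (cvg_norm (cvgB cu (cvg_cst (u k))))).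
near=> m; have km : (k <= m)%N by near: m; exact: nbhs_infty_ge.
by rewrite -(subnKC km) /=; exact: d.
Unshelve. all: by end_near. Qed.

End geometric_increments.

Section picard.
Context {R : realType} (N : nat) (L B : R).
Implicit Types (F : R -> R -> R) (z : R -> R) (t s : R).

(** Integral form of (t^(N+1) z')' = - t^N F(t, z) with z(0) = 1: [avg] inverts the outer derivative
    and [prim] the inner one. *)
Definition pic F z : R -> R := locked (fun t =>
  1 - prim (avg N (fun s => F s (z s))) t).

(** Continuity is asked along curves only, the form in which it is used. Vanishing for s <= 0 makes
    [avg] continuous at 0; B bounds the first Picard step, which starts from the constant 1. *)
Definition lipschitz_field (F : R -> R -> R) : Prop :=
  [/\ forall z, continuous z -> continuous (fun s => F s (z s)),
      forall s x y, `|F s x - F s y| <= L * `|x - y|,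
      forall s, `|F s 1| <= B &
      forall s x, s <= 0 -> F s x = 0].

Hypothesis L1 : 1 <= L.

Let L0 : 0 < L. Proof. exact: lt_le_trans L1. Qed.

Lemma field_avg_continuous F z : lipschitz_field F -> continuous z ->
  continuous (avg N (fun s => F s (z s))).
Proof. by move=> [Fc _ _ F0] cz; apply: avg_continuous; [exact: Fc|exact: F0]. Qed.

Lemma is_derive_pic F z t : lipschitz_field F -> continuous z ->
  is_derive t 1 (pic F z) (- avg N (fun s => F s (z s)) t).
Proof.
move=> HF cz; have := is_derive_prim t (field_avg_continuous HF cz) => dp.
by rewrite /pic -lock; apply: is_derive_eq (derD (der_cst 1 t) (derN dp)) _; rewrite add0r.
Qed.

Lemma pic_continuous F z : lipschitz_field F -> continuous z ->
  continuous (pic F z).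
Proof. by move=> HF cz t; exact: is_derive_continuous (is_derive_pic t HF cz). Qed.

Lemma pic0 F z : pic F z 0 = 1.
Proof. by rewrite /pic -lock prim0 subr0. Qed.

Lemma pic_le0 F z t : lipschitz_field F -> continuous z -> t <= 0 -> pic F z t = 1.
Proof.
move=> HF cz t0; rewrite -(pic0 F z); apply: esym.
apply: (@deriv_const _ (pic F z) t 0 t0) => x /andP[_ x0].
by have := is_derive_pic x HF cz; rewrite (avg_le0 _ _ x0) oppr0.
Qed.

(** Bielecki's weight: integrating C e^(2 L s) gains a factor 1 / (2 L), against a Lipschitz
    constant L. The Picard map thus halves weighted distances on the whole half-line, with no
    restriction to short intervals. *)
Lemma pic_diff F1 F2 z1 z2 (C : R) t :
  lipschitz_field F1 -> lipschitz_field F2 -> continuous z1 -> continuous z2 ->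
  0 <= C -> 0 <= t ->
  (forall s, 0 <= s <= t -> `|F1 s (z1 s) - F2 s (z2 s)| <= C * expR (2 * L * s)) ->
  `|pic F1 z1 t - pic F2 z2 t| <= C / (2 * L) * expR (2 * L * t).
Proof.
move=> H1 H2 c1 c2 C0 t0 hC.
have L2 : 0 < 2 * L by rewrite mulr_gt0.
have := @deriv_norm_le _ (fun s => pic F1 z1 s - pic F2 z2 s)
  (fun s => C / (2 * L) * expR (2 * L * s))
  (fun s => - avg N (fun s => F1 s (z1 s)) s - - avg N (fun s => F2 s (z2 s)) s)
  (fun s => C * expR (2 * L * s)) 0 t t0.
rewrite (pic0 F1 z1) (pic0 F2 z2) (subrr 1) (subr0 (pic F1 z1 t - _)) => D.
apply: le_trans (D _ _ _) _.
- move=> x _; apply: derD; first exact: is_derive_pic.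
  by apply: derN; exact: is_derive_pic.
- move=> x _; eapply is_derive_eq; [der|rewrite /=; field].
  by rewrite gt_eqF.
- move=> x /andP[x0 xt]; rewrite -opprD normrN.
  case: H1 H2 => [Fc1 _ _ _] [Fc2 _ _ _].
  apply: avg_diff; [exact: Fc1|exact: Fc2| |exact: ltW].
  move=> s /andP[s0 sx]; apply: le_trans (hC s _) _.
    by rewrite s0 (le_trans sx)// ltW.
  by rewrite ler_wpM2l// ler_expR ler_wpM2l// ltW.
- by rewrite mulr0 expR0 mulr1 gerBl divr_ge0// ltW.
Qed.

Definition picn F k := iter k (pic F) (cst 1).

Lemma picn_continuous F k : lipschitz_field F -> continuous (picn F k).
Proof.
move=> HF; elim: k => [|k IH]; first exact: cst_continuous.
exact: pic_continuous.
Qed.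

Lemma picn_le0 F k t : lipschitz_field F -> t <= 0 -> picn F k t = 1.
Proof.
by move=> HF t0; case: k => //= k; apply: pic_le0 => //; exact: picn_continuous.
Qed.

Lemma picn_step F k t : lipschitz_field F -> 0 <= t ->
  `|picn F k.+1 t - picn F k t| <= B * expR (2 * L * t) / 2 ^+ k.
Proof.
move=> HF; have B0 : 0 <= B by case: HF => _ _ /(_ 0)/(le_trans _)-> //.
have Lp := L0.
elim: k t => [|k IH] t t0.
  rewrite /= expr0 divr1 {1}/cst.
  have c1 : continuous (cst (1 : R) : R -> R) by exact: cst_continuous.
  have := @deriv_norm_le _ (pic F (cst 1)) (fun s => B * s)
    (fun s => - avg N (fun s => F s (cst 1 s)) s) (cst B) 0 t t0.
  rewrite pic0 mulr0 subr0 => D; apply: le_trans (D _ _ _) _.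
  - by move=> x _; exact: is_derive_pic.
  - by move=> x _; eapply is_derive_eq; [der|rewrite /= mul0r add0r mulr1].
  - move=> x /andP[x0 xt]; rewrite normrN; case: HF => Fc _ FB _.
    by apply: avg_norm; [exact: Fc|move=> s _; exact: FB|exact: ltW].
  (* Here 1 <= L enters: t <= L t <= e^(2 L t). *)
  - rewrite ler_wpM2l//; apply: le_trans (expR_ge1Dx _).
    have : L * t >= 1 * t by rewrite ler_wpM2r.
    by rewrite -mulrA; nra.
apply: le_trans (@pic_diff F F (picn F k.+1) (picn F k) (L * B / 2 ^+ k) t
  HF HF (picn_continuous HF) (picn_continuous HF) _ t0 _) _.
- by rewrite !mulr_ge0// ?invr_ge0 ?exprn_ge0// ltW.
- move=> s /andP[s0 st]; case: HF => _ FL _ _; apply: le_trans (FL _ _ _) _.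
  apply: le_trans (ler_wpM2l (ltW L0) (IH _ s0)) _.
  by rewrite le_eqVlt; apply/orP; left; apply/eqP; ring.
- rewrite le_eqVlt; apply/orP; left; apply/eqP; rewrite exprS; field; rewrite expf_neq0 ?gt_eqF//.
Qed.

Definition picl F t := limn (fun k => picn F k t).

Lemma picl_tail F k t : lipschitz_field F -> 0 <= t ->
  (fun k => picn F k t) @ \oo --> picl F t /\
  `|picl F t - picn F k t| <= 2 * (B * expR (2 * L * t)) / 2 ^+ k.
Proof.
move=> HF t0.
by have [c d] := geometric_increments (fun k => picn_step k HF t0).
Qed.

Lemma picl_le0 F t : lipschitz_field F -> t <= 0 -> picl F t = 1.
Proof.
move=> HF t0; rewrite /picl (_ : (fun _ => _) = cst 1) ?lim_cst//.
by apply/funext => k; rewrite picn_le0.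
Qed.

Lemma picl_continuous F : lipschitz_field F -> continuous (picl F).
Proof.
move=> HF t; apply/cvgrPdist_le => e e0.
have B0 : 0 <= B by case: HF => _ _ /(_ 0)/(le_trans _)-> //.
set E := 2 * (B * expR (2 * L * (`|t| + 1))).
have E0 : 0 <= E by rewrite !mulr_ge0// expR_ge0.
have [k kE] : exists k, E / 2 ^+ k <= e / 3.
  have : (fun k => E * 2^-1 ^+ k) @ \oo --> E * 0.
    by apply: cvgMr; apply: cvg_expr; rewrite ger0_norm; lra.
  rewrite mulr0 => /cvgrPdist_le/(_ (e / 3))[|k _ /(_ k)/=]; first lra.
  rewrite leqnn sub0r normrN exprVn => /(_ isT) H; exists k.
  exact: le_trans (ler_norm _) H.
(* One index k serves all s <= |t| + 1, so the limit inherits continuity at t from the iterate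
   [picn F k]. *)
have tail s : s <= `|t| + 1 -> `|picl F s - picn F k s| <= e / 3.
  move=> st; have [s0|s0] := leP s 0.
    by rewrite picl_le0// picn_le0// subrr normr0; lra.
  apply: le_trans (picl_tail k HF (ltW s0)).2 _; apply: le_trans kE.
  rewrite ler_wpM2r ?invr_ge0 ?exprn_ge0// !ler_wpM2l// ler_expR.
  by rewrite ler_wpM2l// mulr_ge0// ltW.
have /cvgrPdist_le/(_ (e / 3))[|d d0 dc] := @picn_continuous F k HF t; first lra.
near=> s.
have s1 : s <= `|t| + 1.
  near: s; apply: lt_le_nbhsl; have := ler_norm t; lra.
have t1 : t <= `|t| + 1 by have := ler_norm t; lra.
have c : `|picn F k t - picn F k s| <= e / 3 by near: s; exists d.
have := tail _ s1; have := tail _ t1; move: c.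
by rewrite !ler_norml => /andP[? ?] /andP[? ?] /andP[? ?]; apply/andP; split; lra.
Unshelve. all: by end_near. Qed.

Lemma picl_fix F : lipschitz_field F -> pic F (picl F) = picl F.
Proof.
move=> HF; apply/funext => t; have [t0|t0] := leP t 0.
  by rewrite picl_le0// pic_le0//; exact: picl_continuous.
have B0 : 0 <= B by case: HF => _ _ /(_ 0)/(le_trans _)-> //.
have Lp := L0; have tz := ltW t0.
have [c _] := picl_tail 0 HF tz.
apply/eqP; rewrite eq_sym -subr_eq0; apply/eqP.
set E := 2 * (B * expR (2 * L * t)).
have c' : (fun k => picn F k.+1 t) @ \oo --> picl F t.
  by move: c; rewrite -cvg_shiftS.
have e0 : (fun k => E * 2^-1 ^+ k) @ \oo --> (0 : R).
  by rewrite -(mulr0 E); apply: cvgMr; apply: cvg_expr; rewrite ger0_norm; lra.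
apply/eqP; rewrite -normr_le0.
apply: (ler_cvg_to (cvg_norm (cvgB c' (cvg_cst (pic F (picl F) t)))) e0).
apply: nearW => k /=.
(* The tail bound 2 B e^(2 L s) / 2^k passes through one Picard step, so the shifted iterates also
   converge to [pic F (picl F)]. *)
apply: le_trans (@pic_diff F F (picn F k) (picl F) (L * (2 * B) / 2 ^+ k) t
  HF HF (picn_continuous HF) (picl_continuous HF) _ tz _) _.
- by rewrite !mulr_ge0// ?invr_ge0 ?exprn_ge0// ltW.
- move=> s /andP[s0 st]; have [_ FL _ _] := HF; apply: le_trans (FL _ _ _) _.
  rewrite distrC; apply: le_trans (ler_wpM2l (ltW L0) (picl_tail k HF s0).2) _.
  by rewrite le_eqVlt; apply/orP; left; apply/eqP; ring.
- rewrite /E exprVn.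
  have -> : L * (2 * B) / 2 ^+ k / (2 * L) * expR (2 * L * t) =
    B * expR (2 * L * t) / 2 ^+ k.
    by field; rewrite expf_neq0 ?gt_eqF//.
  by rewrite ler_wpM2r ?invr_ge0 ?exprn_ge0// ler_peMl ?mulr_ge0 ?expR_ge0 ?ler1n.
Qed.

(** Both Picard sequences start at 1, and D e^(2 L s) reproduces itself under one step because (D +
    L D) / (2 L) <= D for 1 <= L. Continuous dependence on the field follows without Gronwall's
    lemma. *)
Lemma picl_diff F1 F2 (D : R) t : lipschitz_field F1 -> lipschitz_field F2 ->
  0 <= D -> (forall s x, `|F1 s x - F2 s x| <= D) -> 0 <= t ->
  `|picl F1 t - picl F2 t| <= D * expR (2 * L * t).
Proof.
move=> H1 H2 D0 hD t0; have Lp := L0.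
have step k s : 0 <= s -> `|picn F1 k s - picn F2 k s| <= D * expR (2 * L * s).
  elim: k s => [|k IH] s s0.
    by rewrite /= /cst subrr normr0 mulr_ge0// expR_ge0.
  apply: le_trans (@pic_diff F1 F2 (picn F1 k) (picn F2 k) ((1 + L) * D) s
    H1 H2 (picn_continuous H1) (picn_continuous H2) _ s0 _) _.
  - by rewrite mulr_ge0// addr_ge0// ltW.
  - move=> r /andP[r0 rs].
    apply: le_trans (ler_distD (F2 r (picn F1 k r)) _ _) _.
    have [_ FL _ _] := H2.
    apply: le_trans (lerD (hD r _) (FL r _ _)) _.
    have e1 : 1 <= expR (2 * L * r) by rewrite -expR0 ler_expR !mulr_ge0// ltW.
    rewrite (mulrDl 1 L) (mulrDl (1 * D)) mul1r -[L * D * _]mulrA lerD//.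
      by rewrite ler_peMr.
    by rewrite ler_wpM2l ?IH// ltW.
  - rewrite ler_wpM2r ?expR_ge0// ler_pdivrMr ?mulr_gt0// mulrC ler_wpM2l//.
    by rewrite (mulrDl 1 1) mul1r lerD2r.
have [c1 _] := picl_tail 0 H1 t0; have [c2 _] := picl_tail 0 H2 t0.
have c := cvg_norm (cvgB c1 c2); apply: (cvgr_to_le (c _ _)).
by apply: nearW => k; exact: step.
Qed.

End picard.

(** * The Emden-Fowler equation *)

Section clipped_powers.
Context {R : realType}.
Implicit Types x y p : R.

Lemma lipschitz_continuous (f : R -> R) (L : R) :
  (forall x y, `|f x - f y| <= L * `|x - y|) -> continuous f.
Proof.
move=> fL x; apply/cvgrPdist_le => e e0.
have L1 : 0 < `|L| + 1 by have := normr_ge0 L; lra.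
exists (e / (`|L| + 1)) => /=; first by rewrite divr_gt0.
move=> y /= xy; apply: le_trans (fL _ _) _.
have : `|x - y| * (`|L| + 1) < e by rewrite -ltr_pdivlMr.
have := ler_norm L; have := normr_ge0 (x - y); have := normr_ge0 L; nra.
Qed.

(** A real power of a negative number has the default value 1, hence the cut at 0. At the origin, y
    <= e^(1/p) suffices for y^p <= e. *)
Lemma continuous_max0_powR p : 0 < p -> continuous (fun x : R => Num.max 0 x `^ p).
Proof.
move=> p0 x; have [x0|x0|->] := ltgtP x 0.
- rewrite /continuous_at max_l ?ltW//; apply: cvg_near_cst; near=> y.
  by rewrite max_l//; near: y; exact: lt_le_nbhsl.
- rewrite /continuous_at max_r ?(ltW x0)//.
  have c := is_derive_continuous (is_derive1_powR p x0).
  apply/(cvg_trans _ c)/near_eq_cvg; near=> y.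
  by rewrite max_r//; near: y; exact: lt_le_nbhsr.
- rewrite /continuous_at max_l// powR0 ?gt_eqF//.
  apply/cvgrPdist_le => e e0; near=> y; rewrite sub0r normrN ger0_norm ?powR_ge0//.
  have [y0|y0] := leP y 0; first by rewrite powR0 ?gt_eqF// ltW.
  have -> : e = (e `^ p^-1) `^ p by rewrite -powRrM mulVf ?gt_eqF// powRr1 ?ltW.
  rewrite ge0_ler_powR ?nnegrE ?powR_ge0 ?(ltW p0)// ?(ltW y0)//.
  by near: y; apply: lt_le_nbhsl; exact: powR_gt0.
Unshelve. all: by end_near. Qed.

(** Followed by a power of exponent at least 1, it gives a globally Lipschitz function that vanishes
    on negative arguments. It is applied to the nonlinearity in Z, to the coefficients in t, and
    further on to the cut-off of fluxes near the origin. *)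
Definition clip x := Num.max 0 (Num.min x 1).

Lemma clip_ge0 x : 0 <= clip x. Proof. by rewrite le_max lexx. Qed.

Lemma clip_le1 x : clip x <= 1.
Proof. by rewrite ge_max ler01 ge_min lexx orbT. Qed.

Lemma clip_id x : 0 <= x <= 1 -> clip x = x.
Proof. by case/andP=> x0 x1; rewrite /clip min_l// max_r. Qed.

Lemma clip_le0 x : x <= 0 -> clip x = 0.
Proof. by move=> x0; rewrite /clip max_l// ge_min x0. Qed.

Lemma clip_lipschitz x y : `|clip x - clip y| <= `|x - y|.
Proof.
wlog xy : x y / x <= y.
  move=> H; have /orP[/H//|/H] := le_total x y.
  by rewrite distrC (distrC y).
rewrite /clip /Num.max /Num.min.
by repeat case: ifPn; rewrite -?leNgt; move=> *; rewrite ?ler_norml;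
  have := ler_norm (y - x); rewrite distrC; have := normr_ge0 (y - x) ;
  do ?[move=> *; apply/andP; split]; lra.
Qed.

Lemma clip_continuous : continuous clip.
Proof.
by apply: (@lipschitz_continuous _ 1) => x y; rewrite mul1r clip_lipschitz.
Qed.

Definition clip_pow p x := clip x `^ p.

Lemma clip_pow_continuous p : 0 < p -> continuous (clip_pow p).
Proof.
move=> p0 x; rewrite /clip_pow.
have -> : (fun x => clip x `^ p) = (fun x => Num.max 0 x `^ p) \o clip.
  by apply/funext => y /=; rewrite (max_r (clip_ge0 _)).
by apply: continuous_comp; [exact: clip_continuous|exact: continuous_max0_powR].
Qed.

Lemma clip_pow_ge0 p x : 0 <= clip_pow p x. Proof. exact: powR_ge0. Qed.

Lemma clip_pow_le1 p x : 0 <= p -> clip_pow p x <= 1.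
Proof.
move=> p0; have E : 1 `^ p = 1 :> R by rewrite powR1.
rewrite /clip_pow -[X in _ <= X]E ge0_ler_powR//.
- by rewrite nnegrE clip_ge0.
- by rewrite nnegrE.
- exact: clip_le1.
Qed.

Lemma clip_pow_id p x : 0 <= x <= 1 -> clip_pow p x = x `^ p.
Proof. by move=> x01; rewrite /clip_pow clip_id. Qed.

Lemma clip_pow_le0 p x : p != 0 -> x <= 0 -> clip_pow p x = 0.
Proof. by move=> p0 x0; rewrite /clip_pow clip_le0// powR0. Qed.

(** The slope p t^(p-1) is at most p on ]0, 1]. The case x = 0 is separate since the derivative of
    the power is available at positive points only. *)
Lemma powR_diff_le p x y : 1 <= p -> 0 <= x -> x <= y -> y <= 1 ->
  y `^ p - x `^ p <= p * (y - x).
Proof.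
move=> p1; rewrite le_eqVlt => /predU1P[<- y0 y1|x0 xy y1].
  rewrite powR0 ?gt_eqF ?(lt_le_trans _ p1)// !subr0.
  move: y0; rewrite le_eqVlt => /predU1P[<-|y0].
    by rewrite powR0 ?mulr0// gt_eqF ?(lt_le_trans _ p1).
  apply: (@le_trans _ _ y); last by rewrite ler_peMl// ltW.
  by rewrite ge1r_powR// y0.
rewrite mulrBr; apply: (@deriv_le _ (fun t => t `^ p) (fun t => p * t)
  (fun t => p * t `^ (p - 1)) (fun=> p)) => //.
- by move=> z /andP[xz _]; apply: is_derive1_powR; exact: lt_le_trans xz.
- by move=> z _; eapply is_derive_eq; [der|rewrite /=; ring].
- move=> z /andP[xz zy]; rewrite ler_piMr ?(le_trans _ p1)//.
  have E : 1 `^ (p - 1) = 1 :> R by rewrite powR1.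
  rewrite -[X in _ <= X]E ge0_ler_powR ?nnegrE ?subr_ge0//.
  + by rewrite ltW// (lt_trans x0).
  + by rewrite (le_trans (ltW zy)).
Qed.

Lemma clip_pow_lipschitz p x y : 1 <= p ->
  `|clip_pow p x - clip_pow p y| <= p * `|x - y|.
Proof.
move=> p1; have p0 : 0 <= p by exact: le_trans p1.
apply: le_trans (ler_wpM2l p0 (clip_lipschitz x y)).
rewrite /clip_pow; move: (clip_ge0 x) (clip_ge0 y) (clip_le1 x) (clip_le1 y).
move: (clip x) (clip y) => {}x {}y.
wlog xy : x y / x <= y.
  move=> H *; have /orP[?|?] := le_total x y; first exact: H.
  by rewrite distrC (distrC x); exact: H.
move=> x0 y0 x1 y1; rewrite distrC (distrC x) !ger0_norm ?subr_ge0//.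
  exact: powR_diff_le.
by rewrite ge0_ler_powR.
Qed.

End clipped_powers.

Section emden_fowler.
Context {R : realType} (N : nat) (k kap gam lam p : R).
Implicit Types (eps s t z E : R).

Hypotheses (k0 : 0 < k) (lam0 : 0 <= lam) (p1 : 1 <= p).
Hypotheses (Nkap : 1 < N%:R * kap) (Ngam : 1 < N%:R * gam).

Let N0 : 0 < N%:R :> R.
Proof.
by case: N Nkap => [|m _]; [rewrite mul0r ltr10|rewrite ltr0n].
Qed.

Let kap0 : 0 < kap.
Proof. by rewrite -(pmulr_rgt0 _ N0); exact: lt_trans Nkap. Qed.

Let gam0 : 0 < gam.
Proof. by rewrite -(pmulr_rgt0 _ N0); exact: lt_trans Ngam. Qed.

Let p0 : 0 < p. Proof. exact: lt_le_trans p1. Qed.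

(* With t = exp (s / N) the equation
     Z'' + Z' + k (eps e^(kap s) g(Z) + lam e^(gam s) Z) = 0
   becomes (t^(N+1) z')' = - t^N F(t, z), whose coefficients are continuous
   at t = 0 as soon as N kap and N gam exceed 1. *)
Definition ef_field eps t z : R :=
  N%:R ^+ 2 * k * (eps * clip_pow (N%:R * kap - 1) t * clip_pow p z
                   + lam * clip_pow (N%:R * gam - 1) t * z).

(** Constants uniform over 0 <= eps <= E, as needed to compare two parameters. The summand 1 secures
    1 <= L. *)
Definition ef_L E := 1 + N%:R ^+ 2 * k * (E * p + lam).
Definition ef_B E := N%:R ^+ 2 * k * (E + lam).

Let c0 : 0 < N%:R ^+ 2 * k. Proof. by rewrite mulr_gt0// exprn_gt0. Qed.

Let q1 : 0 < N%:R * kap - 1. Proof. by rewrite subr_gt0. Qed.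
Let q2 : 0 < N%:R * gam - 1. Proof. by rewrite subr_gt0. Qed.

Lemma ef_L_ge1 E : 0 <= E -> 1 <= ef_L E.
Proof.
by move=> E0; rewrite /ef_L lerDl mulr_ge0 ?(ltW c0)// addr_ge0// mulr_ge0// ltW.
Qed.

Lemma ef_fieldP E eps : 0 <= eps <= E ->
  lipschitz_field (ef_L E) (ef_B E) (ef_field eps).
Proof.
move=> /andP[e0 eE]; have E0 : 0 <= E by exact: le_trans eE.
split.
- move=> z cz t; apply: cvgM; first exact: cvg_cst.
  apply: cvgD; apply: cvgM.
  + by apply: cvgM; [exact: cvg_cst|exact: clip_pow_continuous].
  + apply: (@continuous_comp _ _ _ z (clip_pow p)); first exact: cz.
    exact: clip_pow_continuous.
  + by apply: cvgM; [exact: cvg_cst|exact: clip_pow_continuous].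
  + exact: cz.
- move=> s x y; rewrite /ef_field -mulrBr normrM (ger0_norm (ltW c0)).
  have -> : eps * clip_pow (N%:R * kap - 1) s * clip_pow p x +
     lam * clip_pow (N%:R * gam - 1) s * x -
     (eps * clip_pow (N%:R * kap - 1) s * clip_pow p y +
      lam * clip_pow (N%:R * gam - 1) s * y) =
     eps * clip_pow (N%:R * kap - 1) s * (clip_pow p x - clip_pow p y) +
     lam * clip_pow (N%:R * gam - 1) s * (x - y) by ring.
  apply: (@le_trans _ _ (N%:R ^+ 2 * k * ((E * p + lam) * `|x - y|))); last first.
    by rewrite mulrA ler_wpM2r// /ef_L lerDr.
  rewrite ler_pM2l//; apply: le_trans (ler_normD _ _) _.
  rewrite !normrM (ger0_norm e0) (ger0_norm lam0) !(ger0_norm (clip_pow_ge0 _ _)).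
  rewrite mulrDl lerD//.
    rewrite -!mulrA ler_pM ?mulr_ge0 ?clip_pow_ge0//.
    apply: le_trans (clip_pow_lipschitz _ _ p1).
    by rewrite ler_piMl// clip_pow_le1 ?ltW.
  by rewrite ler_wpM2r// ler_piMr// clip_pow_le1 ?ltW.
- move=> s; rewrite /ef_field normrM (ger0_norm (ltW c0)) ler_pM2l//.
  rewrite ger0_norm; last first.
    by rewrite addr_ge0// ?mulr_ge0// clip_pow_ge0.
  rewrite mulr1 lerD//; last by rewrite ler_piMr// clip_pow_le1 ?ltW.
  rewrite -mulrA; apply: le_trans eE; rewrite ler_piMr//.
  by rewrite mulr_ile1 ?clip_pow_ge0// clip_pow_le1 ?ltW.
- move=> s x s0; rewrite /ef_field (clip_pow_le0 (lt0r_neq0 q1) s0) (clip_pow_le0 (lt0r_neq0 q2) s0).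
  by rewrite !mulr0 !mul0r addr0 mulr0.
Qed.


Definition ef_sol eps s : R := picl N (ef_field eps) (expR (s / N%:R)).

Definition ef_flux eps s : R :=
  avg N (fun t => ef_field eps t (picl N (ef_field eps) t)) (expR (s / N%:R))
  * expR (s / N%:R) / N%:R.

Let epsP eps : 0 <= eps -> lipschitz_field (ef_L eps) (ef_B eps) (ef_field eps).
Proof. by move=> e0; apply: ef_fieldP; rewrite e0 lexx. Qed.

Let cont_field eps : 0 <= eps -> continuous (fun t =>
  ef_field eps t (picl N (ef_field eps) t)).
Proof.
move=> e0; have H := epsP e0; have [Fc _ _ _] := H.
by apply: Fc; exact: (picl_continuous (ef_L_ge1 e0) H).
Qed.

Lemma is_derive_ef_sol eps s : 0 <= eps ->
  is_derive s 1 (ef_sol eps) (- ef_flux eps s).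
Proof.
move=> e0; have H := epsP e0.
have cz := picl_continuous (N := N) (ef_L_ge1 e0) H.
have := is_derive_pic N (expR (s / N%:R)) H cz.
rewrite (picl_fix _ (ef_L_ge1 e0) H) => D.
have De : is_derive s 1 (fun t : R => expR (t / N%:R)) (expR (s / N%:R) / N%:R).
  eapply is_derive_eq; first der.
  by rewrite /= mulr0 addr0 mul1r.
have D1 := @der_comp R (picl N (ef_field eps)) (fun t => expR (t / N%:R)) s _ _ D De.
apply: is_derive_eq D1 _.
by rewrite /ef_flux mulNr mulrA.
Qed.

Lemma expR_N_pow s m q : m%:R = q * N%:R -> expR (s / N%:R) ^+ m = expR (q * s).
Proof.
move=> mq; rewrite -expRM_natl mq; congr expR; field.
by rewrite gt_eqF.
Qed.

(** For s <= 0 the point x = e^(s/N) lies in ]0, 1], so the coefficients are not clipped: the power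
    of exponent N q - 1 is e^(q s) / x. This is why the equation is claimed only on s <= 0. *)
Lemma is_derive_ef_flux eps s : 0 <= eps -> s <= 0 ->
  is_derive s 1 (ef_flux eps) (- ef_flux eps s +
    k * (eps * expR (kap * s) * clip_pow p (ef_sol eps s)
         + lam * expR (gam * s) * ef_sol eps s)).
Proof.
move=> e0 s0; set x := expR (s / N%:R).
have x0 : 0 < x by exact: expR_gt0.
have Nn0 : N%:R != 0 :> R by rewrite gt_eqF.
have x1 : x <= 1 by rewrite -expR0 ler_expR pmulr_lle0// invr_gt0.
set h := fun t => ef_field eps t (picl N (ef_field eps) t).
have D := is_derive_avg N (cont_field e0) x0.
have De : is_derive s 1 (fun t : R => expR (t / N%:R)) (x / N%:R).
  eapply is_derive_eq; first der.
  by rewrite /= mulr0 addr0 mul1r.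
have D1 := @der_comp R _ (fun t => expR (t / N%:R)) s _ _ D De.
have Den : is_derive s 1 (fun t : R => expR (- t)) (- expR (- s)).
  by eapply is_derive_eq; [der|rewrite /= mulrN mulr1].
have D2 := derM (derM D1 Den) (der_cst N%:R^-1 s).
(* In this form the flux is e^(-t) / N times the quantity differentiated by [is_derive_avg]; the
   factor e^(-t) yields the damping term - V. *)
rewrite (_ : ef_flux eps = fun t => expR (t / N%:R) ^+ N.+1 *
    avg N h (expR (t / N%:R)) * expR (- t) * N%:R^-1); last first.
  apply/funext => t; rewrite /ef_flux -/h exprS.
  rewrite (@expR_N_pow t N 1) ?mul1r// expRN.
  by field; rewrite Nn0 gt_eqF// expR_gt0.
apply: is_derive_eq D2 _; rewrite mulr0 addr0 -/x -/h.
have xN : x ^+ N = expR s by rewrite /x (@expR_N_pow s N 1) ?mul1r.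
have xk q : 0 < N%:R * q - 1 -> clip_pow (N%:R * q - 1) x = expR (q * s) / x.
  move=> q0; rewrite clip_pow_id ?(ltW x0)// /powR gt_eqF// expRK -expRB.
  by congr expR; field.
rewrite exprS xN expRN.
have hE : h x = N%:R ^+ 2 * k * (eps * expR (kap * s) * clip_pow p (ef_sol eps s)
    + lam * expR (gam * s) * ef_sol eps s) / x.
  rewrite /h /ef_field !xk// /ef_sol -/x; field.
  by rewrite gt_eqF.
rewrite /= -[ef_field eps x _]/(h x) hE.
by field; rewrite Nn0 !gt_eqF// expR_gt0.
Qed.

(** The half-line s <= 0 corresponds to t in ]0, 1], where the exponential weight is at most e^(2
    L); hence a Lipschitz constant in eps that does not depend on s. *)
Lemma ef_sol_diff E eps eps' s : 0 <= eps <= E -> 0 <= eps' <= E -> s <= 0 ->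
  `|ef_sol eps s - ef_sol eps' s| <=
  `|eps - eps'| * (N%:R ^+ 2 * k * expR (2 * ef_L E)).
Proof.
move=> eE eE' s0.
have E0 : 0 <= E by case/andP: eE; exact: le_trans.
have x1 : expR (s / N%:R) <= 1 by rewrite -[X in _ <= X]expR0 ler_expR pmulr_lle0// invr_gt0.
apply: le_trans (picl_diff (D := N%:R ^+ 2 * k * `|eps - eps'|) N (ef_L_ge1 E0)
  (ef_fieldP eE) (ef_fieldP eE') _ _ _) _.
- by rewrite mulr_ge0// ltW.
- move=> t z; rewrite /ef_field -mulrBr normrM (ger0_norm (ltW c0)) ler_pM2l//.
  rewrite opprD addrACA subrr addr0 -mulrBl -mulrBl !normrM.
  rewrite !(ger0_norm (clip_pow_ge0 _ _)) -mulrA ler_piMr//.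
  by rewrite mulr_ile1 ?clip_pow_ge0// clip_pow_le1 ?ltW.
- exact: expR_ge0.
- rewrite [X in X * _]mulrC -[X in X <= _]mulrA ler_wpM2l// ler_wpM2l ?(ltW c0)//.
  by rewrite ler_expR ler_piMr// mulr_ge0// (le_trans _ (ef_L_ge1 E0)).
Qed.

Lemma ef_sol_cvg eps : 0 <= eps -> ef_sol eps s @[s --> -oo] --> (1 : R).
Proof.
move=> e0; have H := epsP e0.
have cz := picl_continuous (N := N) (ef_L_ge1 e0) H.
have L0 := ef_L_ge1 e0.
rewrite -(picl_le0 N H (lexx 0)).
apply: (@cvg_comp _ _ _ (fun s : R => expR (s / N%:R)) _ _ (nbhs (0 : R))); last exact: cz.
apply/cvgNy_compNP.
have -> : (fun s : R => expR (s / N%:R)) \o -%R = (fun x => expR (- x)) \o (fun s => s / N%:R).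
  by apply/funext => s /=; rewrite mulNr.
have c : (s : R) / N%:R @[s --> +oo] --> +oo.
  by apply: gt0_cvgMly; [rewrite invr_gt0|exact: cvg_id].
exact: (cvg_comp _ _ c (@cvgr_expR R)).
Qed.

(** Up to a constant the field is at most x^(N mu - 1) on [0, x]; [avg] keeps this bound, and the
    factor x in the flux turns it into x^(N mu) = e^(mu s). *)
Lemma ef_bounds eps mu : 0 <= eps -> mu <= kap -> mu <= gam ->
  exists2 C, 0 <= C & forall s, s <= 0 ->
    `|ef_sol eps s| <= C /\ `|ef_flux eps s| <= C * expR (mu * s).
Proof.
move=> e0 muk mug; have H := epsP e0; have L1 := ef_L_ge1 e0.
have LL : 0 <= 2 * ef_L eps by rewrite mulr_ge0// (le_trans _ L1).
have B0 : 0 <= ef_B eps by rewrite /ef_B mulr_ge0 ?(ltW c0)// addr_ge0.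
set M := 1 + 2 * (ef_B eps * expR (2 * ef_L eps)).
have M1 : 1 <= M.
  by rewrite /M lerDl; apply: mulr_ge0 => //; apply: mulr_ge0 => //; exact: expR_ge0.
have zM t : t <= 1 -> `|picl N (ef_field eps) t| <= M.
  move=> t1; have [t0|t0] := leP t 0; first by rewrite (picl_le0 N H t0) normr1.
  have [_] := picl_tail N L1 0 H (ltW t0).
  rewrite /= /cst expr0 divr1 => d.
  have : 2 * (ef_B eps * expR (2 * ef_L eps * t)) <= 2 * (ef_B eps * expR (2 * ef_L eps)).
    by rewrite !ler_wpM2l// ler_expR ler_piMr.
  move: d; rewrite /M !ler_norml => /andP[? ?] ?; apply/andP; split; lra.
set C := N%:R ^+ 2 * k * (eps + lam * M).
have C0 : 0 <= C.
  by rewrite /C mulr_ge0 ?(ltW c0)// addr_ge0// mulr_ge0// (le_trans _ M1).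
exists (M + C) => [|s s0]; first by rewrite addr_ge0// (le_trans _ M1).
set x := expR (s / N%:R).
have x0 : 0 < x by exact: expR_gt0.
have x1 : x <= 1 by rewrite -expR0 ler_expR pmulr_lle0// invr_gt0.
split; first by apply: le_trans (zM _ x1) _; rewrite lerDl.
have hx r : 0 <= r <= x -> `|ef_field eps r (picl N (ef_field eps) r)| <=
    C * x `^ (N%:R * mu - 1).
  move=> /andP[r0 rx]; have r1 := le_trans rx x1.
  have clip_mono q : 0 < N%:R * q - 1 -> mu <= q ->
      clip_pow (N%:R * q - 1) r <= x `^ (N%:R * mu - 1).
    move=> q0 muq; rewrite clip_pow_id ?r0//.
    apply: (@le_trans _ _ (x `^ (N%:R * q - 1))).
      by rewrite ge0_ler_powR// ?nnegrE ltW.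
    by apply: ger_powR; [rewrite x0|rewrite lerB// ler_wpM2l// ltW].
  rewrite /ef_field normrM (ger0_norm (ltW c0)) /C -[X in _ <= X]mulrA ler_pM2l//.
  apply: le_trans (ler_normD _ _) _; rewrite !normrM (ger0_norm e0) (ger0_norm lam0).
  rewrite !(ger0_norm (clip_pow_ge0 _ _)) mulrDl lerD//.
    rewrite -mulrA ler_wpM2l// -[X in _ <= X]mulr1 ler_pM ?clip_pow_ge0//.
      exact: clip_mono.
    by rewrite clip_pow_le1 ?ltW.
  rewrite -[X in X <= _]mulrA -[X in _ <= X]mulrA.
  apply: ler_wpM2l => //; rewrite [X in X <= _]mulrC.
  apply: ler_pM; [exact: normr_ge0|exact: clip_pow_ge0|exact: zM|].
  exact: clip_mono.
rewrite /ef_flux -/x normrM normfV normrM (gtr0_norm x0) (gtr0_norm N0).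
have := avg_norm N (cont_field e0) hx (ltW x0) => ax.
rewrite ler_pdivrMr//.
apply: (@le_trans _ _ (C * x `^ (N%:R * mu - 1) * x)).
  by rewrite ler_wpM2r// ltW.
rewrite -mulrA [x `^ _ * x]mulrC.
have -> : x * x `^ (N%:R * mu - 1) = expR (mu * s).
  rewrite /powR gt_eqF// expRK {1}/x -expRD; congr expR; field.
  by rewrite gt_eqF.
rewrite [X in _ <= X]mulrAC ler_wpM2r ?expR_ge0//.
have N1 : 1 <= N%:R :> R by rewrite ler1n -(@ltr0n R).
by apply: (@le_trans _ _ (M + C)); [rewrite lerDr (le_trans _ M1)|rewrite ler_peMr// addr_ge0// (le_trans _ M1)].
Qed.

End emden_fowler.

(** * Barriers and comparison with the limit at -oo *)

Section one_sided_comparison.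
Context {R : realType}.
Implicit Types (f df h dh : R -> R) (a b c l s t x : R).

Lemma is_derive_gt0_right h x d : is_derive x 1 h d -> 0 < d ->
  \forall y \near x^'+, h x < h y.
Proof.
move=> [hd <-] d0.
have /cvgr_gt/(_ _ d0) H : (fun u => u^-1 *: (h (u *: 1 + x) - h x)) u
    @[u --> 0^'+] --> 'D_1 h x by exact: cvg_dnbhs_at_right.
apply/nbhs_right0P; near=> e.
have e0 : 0 < e by near: e; exact: nbhs_right_gt.
have : 0 < e^-1 *: (h (e *: 1 + x) - h x) by near: e.
rewrite /GRing.scale/= pmulr_rgt0 ?invr_gt0// subr_gt0.
by rewrite mulr1 addrC.
Unshelve. all: by end_near. Qed.

(** At the last time t where h >= c one has h(t) = c unless t = b; then h increases strictly at t
    and stays above c a little longer, a contradiction. *)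
Lemma barrier h dh a b c : a <= b ->
  (forall x, a <= x <= b -> is_derive x 1 h (dh x)) ->
  (forall x, a <= x <= b -> h x = c -> 0 < dh x) ->
  c <= h a -> c <= h b.
Proof.
move=> ab hd hc ca; rewrite leNgt; apply/negP => hb.
pose S := [set x | a <= x <= b /\ c <= h x].
have Sa : S a by split; rewrite ?lexx.
have ubS : ubound S b by move=> x [/andP[]].
have supS : has_sup S by split; [exists a|exists b].
set t := sup S.
have at_ : a <= t by apply: ub_le_sup => //; exists b.
have tb : t <= b by apply: ge_sup => //; exists a.
have ct : {for t, continuous h} by apply: is_derive_continuous (hd t _); rewrite at_.
have hct : c <= h t.
  rewrite leNgt; apply/negP => ht.
  have H : \forall y \near t, h y < c by exact: cvgr_lt ct _ ht.
  have /nbhs_ballP[e /= e0 he] := H.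
  have [x Sx xt] := sup_adherent e0 supS.
  have xt' : x <= t by apply: ub_le_sup => //; exists b.
  have : h x < c by apply: he; rewrite /ball/= ger0_norm ?subr_ge0//; rewrite -/t in xt; lra.
  by case: Sx => _; rewrite leNgt => /negP.
have ltb : t < b by rewrite lt_neqAle tb andbT; apply: contraTneq hct => ->; rewrite -ltNge.
have htc : h t = c.
  apply/eqP; rewrite eq_le hct andbT; apply: (cvgr_to_le (cvg_at_right_filter ct)).
  near=> y; rewrite leNgt; apply/negP => cy.
  suff : y <= t by apply/negP; rewrite -ltNge; near: y; exact: nbhs_right_gt.
  apply: ub_le_sup; first by exists b.
  split; last exact: ltW.
  apply/andP; split; first by apply: le_trans at_ _; near: y; exact: nbhs_right_ge.
  by near: y; exact: nbhs_right_le.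
have ht := hd t; have at_b : a <= t <= b by rewrite at_.
have := is_derive_gt0_right (ht at_b) (hc t at_b htc) => hr.
near (t^'+) => y.
have ty : t < y by near: y; exact: nbhs_right_gt.
have yb : y <= b by near: y; exact: nbhs_right_le.
have hy : h t < h y by near: y.
have : y <= t.
  apply: ub_le_sup; first by exists b.
  by split; [rewrite yb (le_trans at_)// ltW|rewrite -htc ltW].
by rewrite leNgt ty.
Unshelve. all: by end_near. Qed.

(** Replaces integration from -oo: the limit there acts as an initial value. *)
Lemma deriv_Ny_ge f df b l :
  (forall s, s <= b -> is_derive s 1 f (df s)) ->
  (forall s, s < b -> 0 <= df s) -> f s @[s --> -oo] --> l -> l <= f b.
Proof.
move=> fd df0 fl; apply: (cvgr_to_le fl); near=> s.
have sb : s <= b by near: s; apply: nbhs_ninfty_le; exact: num_real.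
apply: (@ge0_deriv_le _ f df) => //.
- by move=> x /andP[_ xb]; apply: fd; exact: ltW.
- by move=> x /andP[_ xb]; exact: df0.
- apply: continuous_itvW => x /andP[_ xb].
  exact: is_derive_continuous (fd _ xb).
Unshelve. all: by end_near. Qed.

Lemma cvg_expR_Ny (m : R) : 0 < m -> expR (m * s) @[s --> -oo] --> (0 : R).
Proof.
move=> m0; apply/cvgNy_compNP.
have -> : (fun s : R => expR (m * s)) \o -%R = (fun x => expR (- x)) \o (fun s => m * s).
  by apply/funext => s /=; rewrite mulrN.
have c : m * (s : R) @[s --> +oo] --> +oo by apply: gt0_cvgMry => //; exact: cvg_id.
exact: (cvg_comp _ _ c (@cvgr_expR R)).
Qed.

Lemma expR_Ny_le (m e : R) : 0 < m -> 0 < e -> \forall s \near -oo, expR (m * s) <= e.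
Proof.
move=> m0 e0; have /cvgrPdist_le/(_ _ e0) := cvg_expR_Ny m0.
by apply: filterS => s; rewrite sub0r normrN ger0_norm// expR_ge0.
Qed.

Lemma cvg0_expR_bound f C m : 0 < m ->
  (forall s, s <= 0 -> `|f s| <= C * expR (m * s)) -> f s @[s --> -oo] --> (0 : R).
Proof.
move=> m0 fC; apply/cvgrPdist_le => e e0.
have D0 : 0 < `|C| + 1 by have := normr_ge0 C; lra.
near=> s; rewrite sub0r normrN; apply: le_trans (fC s _) _.
  by near: s; apply: nbhs_ninfty_le; exact: num_real.
have : expR (m * s) <= e / (`|C| + 1).
  by near: s; apply: expR_Ny_le => //; rewrite divr_gt0.
rewrite ler_pdivlMr//; have := expR_ge0 (m * s); have := ler_norm C.
by have := normr_ge0 C; nra.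
Unshelve. all: by end_near. Qed.

End one_sided_comparison.

Lemma gt0_powRD (R : realType) (x r s : R) : 0 < x ->
  x `^ (r + s) = x `^ r * x `^ s.
Proof. by move=> x0; rewrite powRD// (gt_eqF x0) implybT. Qed.

(** * Energy and slope *)

Section shooting.
Context {R : realType} (k kap gam lam : R).
Hypotheses (k0 : 0 < k) (kap0 : 0 < kap) (gam0 : 0 < gam) (lam0 : 0 < lam).
Implicit Types (eps s t b x : R) (Z V : R -> R).

(** The decay of V selects the solution that is regular at the origin of the ball. The exponent 2
    kap + 1 is q - 1, and the clipped power is the true one as long as 0 <= Z <= 1. *)
Definition ef_solution eps Z V : Prop :=
  [/\ forall s, s <= 0 -> is_derive s 1 Z (- V s),
      forall s, s <= 0 -> is_derive s 1 V (- V s +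
        k * (eps * expR (kap * s) * clip_pow (2 * kap + 1) (Z s)
             + lam * expR (gam * s) * Z s)),
      exists C mu, [/\ 0 <= C, 0 < mu &
        forall s, s <= 0 -> `|V s| <= C * expR (mu * s)] &
      Z s @[s --> -oo] --> (1 : R)].

Let dexp (m s : R) : is_derive s 1 (fun t => expR (m * t)) (m * expR (m * s)).
Proof. by eapply is_derive_eq; [der|rewrite /=; ring]. Qed.

Let dexp1 (s : R) : is_derive s 1 (fun t => expR t) (expR s).
Proof. by eapply is_derive_eq; [der|rewrite /=; ring]. Qed.

Lemma ef_expV_cvg eps Z V : ef_solution eps Z V ->
  expR s * V s @[s --> -oo] --> (0 : R).
Proof.
move=> [_ _ [C [mu [C0 mu0 Vb]]] _].
apply: (cvg0_expR_bound mu0) => s s0; rewrite normrM ger0_norm ?expR_ge0//.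
apply: le_trans (Vb _ s0); rewrite ler_piMl//.
by rewrite -expR0 ler_expR.
Qed.

Lemma is_derive_expV eps Z V s : ef_solution eps Z V -> s <= 0 ->
  is_derive s 1 (fun t => expR t * V t) (expR s *
    (k * (eps * expR (kap * s) * clip_pow (2 * kap + 1) (Z s)
             + lam * expR (gam * s) * Z s))).
Proof.
move=> [_ dV _ _] s0; apply: is_derive_eq (derM (dexp1 s) (dV _ s0)) _.
by rewrite /=; ring.
Qed.

Lemma ef_source_ge0 eps s z : 0 <= eps -> 0 <= z ->
  0 <= k * (eps * expR (kap * s) * clip_pow (2 * kap + 1) z + lam * expR (gam * s) * z).
Proof.
move=> e0 z0; rewrite mulr_ge0 ?(ltW k0)// addr_ge0// !mulr_ge0 ?expR_ge0 ?clip_pow_ge0//.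
exact: ltW.
Qed.

(** e^s is an integrating factor: e^s V tends to 0 at -oo and its derivative is e^s times the
    source, nonnegative while Z is. *)
Lemma ef_flux_ge0 eps Z V b : 0 <= eps -> b <= 0 -> ef_solution eps Z V ->
  (forall s, s <= b -> 0 <= Z s) -> 0 <= V b.
Proof.
move=> e0 b0 H Z0; rewrite -(pmulr_rge0 _ (expR_gt0 b)).
apply: deriv_Ny_ge (ef_expV_cvg H) => s sb.
  by apply: is_derive_expV H _; exact: le_trans b0.
by rewrite mulr_ge0 ?expR_ge0// ef_source_ge0// Z0 ?ltW.
Qed.

Lemma ef_nonincreasing eps Z V a b : 0 <= eps -> a <= b -> b <= 0 -> ef_solution eps Z V ->
  (forall s, s <= b -> 0 <= Z s) -> Z b <= Z a.
Proof.
move=> e0 ab b0 H Z0; have [dZ _ _ _] := H.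
suff: (- Z) a <= (- Z) b by rewrite !fctE lerN2.
apply: (@ge0_deriv_le _ (- Z) V) => // [x /andP[_ xb]|x /andP[ax xb]|].
- rewrite -[V x]opprK; apply: is_deriveN; apply: dZ; lra.
- apply: (ef_flux_ge0 e0 _ H); first lra.
  by move=> s sx; apply: Z0; lra.
- apply: continuous_itvW => x /andP[_ xb]; apply: continuousN.
  by apply: is_derive_continuous (dZ x _); lra.
Qed.

(** Z decreases from its limit 1 at -oo; with nonnegativity this makes the clipping inactive. *)
Lemma ef_le1 eps Z V b : 0 <= eps -> b <= 0 -> ef_solution eps Z V ->
  (forall s, s <= b -> 0 <= Z s) -> Z b <= 1.
Proof.
move=> e0 b0 H Z0; have [_ _ _ Z1] := H.
apply: (cvgr_to_ge Z1); near=> s.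
have sb : s <= b by near: s; apply: nbhs_ninfty_le; exact: num_real.
exact: (ef_nonincreasing e0 sb b0 H Z0).
Unshelve. all: by end_near. Qed.

Section positive_solution.
Variables (eps : R) (Z V : R -> R).
Hypotheses (eps0 : 0 < eps) (H : ef_solution eps Z V).
Hypothesis Zpos : forall s, s <= 0 -> 0 < Z s.

Let B s := k * lam * expR (gam * s).
(* 2 kap is q - 2. *)
Let y s := k * eps * expR (kap * s) * Z s `^ (2 * kap).

Let dZ s : s <= 0 -> is_derive s 1 Z (- V s).
Proof. by case: H => + _ _ _ => /[apply]. Qed.

Lemma ef_flux_pos s : s <= 0 -> 0 <= V s.
Proof.
move=> s0; apply: (ef_flux_ge0 (ltW eps0) s0 H) => t ts.
by apply/ltW/Zpos; exact: le_trans s0.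
Qed.

Lemma ef_sol_le1 s : s <= 0 -> Z s <= 1.
Proof.
move=> s0; apply: (ef_le1 (ltW eps0) s0 H) => t ts.
by apply/ltW/Zpos; exact: le_trans s0.
Qed.

Let clipZ s : s <= 0 -> clip_pow (2 * kap + 1) (Z s) = Z s `^ (2 * kap) * Z s.
Proof.
move=> s0; have z0 := Zpos s0; rewrite clip_pow_id; last by rewrite ltW ?ef_sol_le1.
by rewrite gt0_powRD// powRr1// ltW.
Qed.

Let dV s : s <= 0 -> is_derive s 1 V (- V s + (y s + B s) * Z s).
Proof.
move=> s0; have [_ dV _ _] := H; apply: is_derive_eq (dV _ s0) _.
by rewrite clipZ// /y /B; ring.
Qed.

Lemma ef_y_pos s : s <= 0 -> 0 < y s.
Proof. by move=> s0; rewrite /y !mulr_gt0 ?expR_gt0// powR_gt0// Zpos. Qed.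

Lemma ef_B_pos s : 0 < B s.
Proof. by rewrite /B !mulr_gt0 ?expR_gt0. Qed.

(** Pohozaev's functional: e^s (V^2 - V Z) plus e^s times twice the primitive in Z of the source.
    The coefficient k eps / (kap + 1) is 2 k eps / q. *)
Definition ef_energy s := expR s * (V s ^+ 2 - V s * Z s +
  k * eps / (kap + 1) * expR (kap * s) * Z s `^ (2 * kap + 2)
  + k * lam * expR (gam * s) * Z s ^+ 2).

Let powZ2 s : s <= 0 -> Z s `^ (2 * kap + 2) = Z s `^ (2 * kap) * Z s ^+ 2.
Proof.
move=> s0; have z0 := Zpos s0.
by rewrite gt0_powRD// powR_mulrn// ltW.
Qed.

Lemma ef_energyE s : s <= 0 -> ef_energy s =
  expR s * (V s ^+ 2 - V s * Z s + (y s / (kap + 1) + B s) * Z s ^+ 2).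
Proof.
move=> s0; rewrite /ef_energy powZ2// /y /B; field.
by rewrite gt_eqF// addr_gt0.
Qed.

(** The power of Z is critical, so the eps terms cancel exactly, as do those in V^2 and V Z; what
    remains comes from the factor e^(gam s) of the linear term and is positive. *)
Lemma is_derive_ef_energy s : s <= 0 ->
  is_derive s 1 ef_energy (gam * B s * expR s * Z s ^+ 2).
Proof.
move=> s0; have z0 := Zpos s0; have := dZ s0; have := dV s0 => HV HZ.
have He := dexp1 s; have Hk := dexp kap s; have Hg := dexp gam s.
rewrite /ef_energy; eapply is_derive_eq; first by der.
rewrite /= !powZ2//.
have -> : Z s `^ (2 * kap + 2 - 1) = Z s `^ (2 * kap) * Z s.
  rewrite (_ : 2 * kap + 2 - 1 = 2 * kap + 1); last by ring.
  by rewrite gt0_powRD// powRr1// ltW.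
rewrite /y /B; field.
by rewrite gt_eqF// addr_gt0.
Qed.

Lemma ef_energy_cvg : ef_energy s @[s --> -oo] --> (0 : R).
Proof.
have [_ _ [C [mu [C0 mu0 Vb]]] _] := H.
apply: (@cvg0_expR_bound _ _ (C ^+ 2 + C + k * eps / (kap + 1) + k * lam) 1) => // s s0.
rewrite /ef_energy normrM ger0_norm ?expR_ge0// mulrC mul1r ler_wpM2r ?expR_ge0//.
have z1 := ef_sol_le1 s0; have z0 := ltW (Zpos s0); have v0 := ef_flux_pos s0.
have e1 m : 0 < m -> expR (m * s) <= 1.
  by move=> m0; rewrite -[X in _ <= X]expR0 ler_expR pmulr_rle0.
have vC : V s <= C.
  by apply: le_trans (ler_norm _) _; apply: le_trans (Vb _ s0) _; rewrite ler_piMr// e1.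
have zq : 0 <= Z s `^ (2 * kap + 2) <= 1.
  rewrite powR_ge0/=.
  have E : 1 `^ (2 * kap + 2) = 1 :> R by rewrite powR1.
  by rewrite -[X in _ <= X]E ge0_ler_powR ?nnegrE// addr_ge0// mulr_ge0// ltW.
have ek := e1 _ kap0; have eg := e1 _ gam0.
have ek0 := expR_ge0 (kap * s); have eg0 := expR_ge0 (gam * s).
have K0 : 0 <= k * eps / (kap + 1).
  by rewrite divr_ge0 ?addr_ge0 ?mulr_ge0 ?ltW.
have L0 : 0 <= k * lam by rewrite mulr_ge0 ?ltW.
case/andP: zq => zq0 zq1.
apply: le_trans (ler_normD _ _) _; apply: lerD; last first.
  rewrite ger0_norm; last by rewrite mulr_ge0 ?exprn_ge0// mulr_ge0.
  by rewrite -mulrA ler_piMr// mulr_ile1 ?exprn_ge0// exprn_ile1.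
apply: le_trans (ler_normD _ _) _; apply: lerD; last first.
  rewrite ger0_norm; last by rewrite mulr_ge0// mulr_ge0.
  by rewrite -mulrA ler_piMr// mulr_ile1.
apply: le_trans (ler_normB _ _) _; rewrite !ger0_norm ?exprn_ge0 ?mulr_ge0//.
by apply: lerD; [rewrite lerXn2r ?nnegrE|rewrite -[X in _ <= X]mulr1 ler_pM].
Qed.

Lemma ef_energy_ge0 s : s <= 0 -> 0 <= ef_energy s.
Proof.
move=> s0; apply: deriv_Ny_ge ef_energy_cvg => t ts.
  by apply: is_derive_ef_energy; exact: le_trans s0.
have := ef_B_pos t => B0.
by rewrite !mulr_ge0 ?expR_ge0 ?exprn_ge0// ltW// Zpos// ltW// (lt_le_trans ts).
Qed.

Let P s := V s / Z s.

(** Riccati's equation of the system Z' = - V, V' = - V + (y + B) Z. *)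
Lemma is_derive_slope s : s <= 0 -> is_derive s 1 P (P s ^+ 2 - P s + y s + B s).
Proof.
move=> s0; have z0 := Zpos s0; have := dZ s0; have := dV s0 => HV HZ.
have zn0 : Z s != 0 by rewrite gt_eqF.
apply: is_derive_eq (derM HV (derV zn0 HZ)) _.
by rewrite /= /P; field.
Qed.

(* Positivity of the energy bounds [y] from below. *)
Lemma ef_slope_growth s : s <= 0 ->
  kap * (P s - P s ^+ 2 - B s) <= P s ^+ 2 - P s + y s + B s.
Proof.
move=> s0; have z0 := Zpos s0; have := ef_energy_ge0 s0.
rewrite ef_energyE// pmulr_rge0 ?expR_gt0// => E0.
have : 0 <= P s ^+ 2 - P s + (y s / (kap + 1) + B s).
  rewrite -(pmulr_lge0 _ (exprn_gt0 2 z0)); apply: le_trans E0 _.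
  rewrite le_eqVlt; apply/orP; left; apply/eqP; rewrite /P; field.
  by rewrite !gt_eqF// addr_gt0.
have k1 : 0 < kap + 1 by rewrite addr_gt0.
rewrite -(pmulr_rge0 _ k1) => E1; rewrite -subr_ge0; apply: le_trans E1 _.
rewrite le_eqVlt; apply/orP; left; apply/eqP; field.
by rewrite gt_eqF.
Qed.

(** Without source, e^t V would be constant from s on, and Z would reach the value Z(s) - V(s) (1 -
    e^s) at time 0. The source only lowers this extrapolated value as s increases, and at s = 0 it
    is Z(0) > 0. *)
Lemma ef_slope_upper s : s <= 0 -> P s * (1 - expR s) <= 1.
Proof.
move=> s0; have z0 := Zpos s0.
rewrite /P mulrAC ler_pdivrMr// mul1r.
pose Q t := - (Z t - V t * (1 - expR t)).
suff : Q s <= Q 0.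
  by rewrite /Q expR0 subrr mulr0 subr0; have := Zpos (lexx 0); lra.
have dQ t : t <= 0 -> is_derive t 1 Q ((1 - expR t) * ((y t + B t) * Z t)).
  move=> t0; have := dZ t0; have := dV t0; have := dexp1 t => He HV HZ.
  apply: is_derive_eq (derN (derD HZ (derN (derM HV (derD (der_cst 1 t) (derN He)))))) _.
  by rewrite /=; ring.
apply: (@ge0_deriv_le _ Q (fun t => (1 - expR t) * ((y t + B t) * Z t))) => //.
- by move=> t /andP[_ t0]; apply: dQ; exact: ltW.
- move=> t /andP[_ /ltW t0]; rewrite mulr_ge0//.
    by rewrite subr_ge0 -[X in _ <= X]expR0 ler_expR.
  by rewrite mulr_ge0 ?addr_ge0// ltW// ?Zpos ?ef_B_pos ?ef_y_pos.
- apply: continuous_itvW => t /andP[_ t0].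
  exact: is_derive_continuous (dQ _ t0).
Qed.

(** The source is at most its value at Z = 1, and e^s V is its integral against e^s from -oo. The
    factors 1 / (kap + 1) and 1 / (gam + 1) of the exact integral are dropped. *)
Lemma ef_flux_upper s : s <= 0 ->
  V s <= k * (eps * expR (kap * s) + lam * expR (gam * s)).
Proof.
move=> s0.
pose T t := k * (eps * expR ((kap + 1) * t) + lam * expR ((gam + 1) * t)) - expR t * V t.
have sumE m t : expR ((m + 1) * t) = expR (m * t) * expR t.
  by rewrite mulrDl mul1r expRD.
suff : 0 <= T s.
  have -> : T s = (k * (eps * expR (kap * s) + lam * expR (gam * s)) - V s) * expR s.
    by rewrite /T !sumE; ring.
  by rewrite pmulr_lge0 ?expR_gt0// subr_ge0.
have cT : T t @[t --> -oo] --> (0 : R).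
  rewrite (_ : 0 = k * (eps * 0 + lam * 0) - 0 :> R); last by ring.
  apply: cvgB; last exact: ef_expV_cvg H.
  by apply: cvgMr; apply: cvgD; apply: cvgMr; apply: cvg_expR_Ny; rewrite addr_gt0.
apply: (deriv_Ny_ge (df := fun t => k * (eps * ((kap + 1) * expR ((kap + 1) * t)) +
    lam * ((gam + 1) * expR ((gam + 1) * t))) -
    expR t * (k * (eps * expR (kap * t) * clip_pow (2 * kap + 1) (Z t)
             + lam * expR (gam * t) * Z t))) _ _ cT) => t ts.
  have t0 := le_trans ts s0.
  apply: is_derive_eq (derD (derM (der_cst k t) (derD (derM (der_cst eps t) (dexp (kap + 1) t))
     (derM (der_cst lam t) (dexp (gam + 1) t)))) (derN (is_derive_expV H t0))) _.
  by rewrite /=; ring.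
have t0 : t <= 0 by rewrite ltW// (lt_le_trans ts).
have z0 := ltW (Zpos t0); have z1 := ef_sol_le1 t0.
have c1 : clip_pow (2 * kap + 1) (Z t) <= 1.
  by rewrite clip_pow_le1// addr_ge0// mulr_ge0// ltW.
have c0 := clip_pow_ge0 (2 * kap + 1) (Z t).
rewrite !sumE subr_ge0 mulrCA ler_pM2l// mulrDr; apply: lerD.
  rewrite [X in _ <= X](_ : _ = (kap + 1) * (eps * expR (kap * t) * expR t)); last by ring.
  rewrite [X in X <= _](_ : _ = clip_pow (2 * kap + 1) (Z t) * (eps * expR (kap * t) * expR t)); last by ring.
  rewrite ler_wpM2r ?mulr_ge0 ?expR_ge0 ?(ltW eps0)//.
  by rewrite (le_trans c1)// lerDr ltW.
rewrite [X in _ <= X](_ : _ = (gam + 1) * (lam * expR (gam * t) * expR t)); last by ring.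
rewrite [X in X <= _](_ : _ = Z t * (lam * expR (gam * t) * expR t)); last by ring.
rewrite ler_wpM2r ?mulr_ge0 ?expR_ge0 ?(ltW lam0)//.
by rewrite (le_trans z1)// lerDr ltW.
Qed.

Lemma ef_sol_lower s : s <= 0 ->
  1 - k * (eps * expR (kap * s) / kap + lam * expR (gam * s) / gam) <= Z s.
Proof.
move=> s0; rewrite lerBlDr.
pose T t := Z t + k * (eps * expR (kap * t) / kap + lam * expR (gam * t) / gam).
rewrite -/(T s).
have cT : T t @[t --> -oo] --> (1 : R).
  rewrite (_ : 1 = 1 + k * (eps * 0 / kap + lam * 0 / gam) :> R); last first.
    by rewrite !mulr0 !mul0r addr0 mulr0 addr0.
  apply: cvgD; first by case: H => _ _ _.
  by apply: cvgMr; apply: cvgD; apply: cvgMl; apply: cvgMr; exact: cvg_expR_Ny.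
apply: (deriv_Ny_ge (df := fun t => - V t + k * (eps * expR (kap * t) + lam * expR (gam * t))) _ _ cT) => t ts.
  have t0 := le_trans ts s0.
  apply: is_derive_eq (derD (dZ t0) (derM (der_cst k t) (derD
     (derM (derM (der_cst eps t) (dexp kap t)) (der_cst _ _))
     (derM (derM (der_cst lam t) (dexp gam t)) (der_cst _ _))))) _.
  by rewrite /=; field; rewrite !gt_eqF.
by rewrite addrC subr_ge0 ef_flux_upper// ltW// (lt_le_trans ts).
Qed.

(** The linear source is dropped and the power term is bounded below by its value at Z = 1/2. *)
Lemma ef_flux_lower s : s <= 0 -> (forall t, t <= s -> 2^-1 <= Z t) ->
  2^-1 `^ (2 * kap + 1) * k * eps * expR (kap * s) / (kap + 1) <= V s.
Proof.
move=> s0 Zh; set g := 2^-1 `^ (2 * kap + 1).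
have g0 : 0 <= g by exact: powR_ge0.
have k1 : 0 < kap + 1 by rewrite addr_gt0.
have sumE t : expR ((kap + 1) * t) = expR (kap * t) * expR t.
  by rewrite mulrDl mul1r expRD.
pose T t := expR t * V t - g * k * eps / (kap + 1) * expR ((kap + 1) * t).
have cT : T t @[t --> -oo] --> (0 : R).
  rewrite (_ : 0 = 0 - g * k * eps / (kap + 1) * 0 :> R); last by ring.
  by apply: cvgB; [exact: ef_expV_cvg H|apply: cvgMr; exact: cvg_expR_Ny].
have : 0 <= T s.
  apply: (deriv_Ny_ge (df := fun t => expR t * (k * (eps * expR (kap * t) * clip_pow (2 * kap + 1) (Z t)
             + lam * expR (gam * t) * Z t)) -
     g * k * eps * expR ((kap + 1) * t)) _ _ cT) => t ts.
    have t0 := le_trans ts s0.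
    apply: is_derive_eq (derD (is_derive_expV H t0) (derN (derM (der_cst _ t) (dexp (kap + 1) t)))) _.
    by rewrite /=; field; rewrite gt_eqF.
  have t0 : t <= 0 by rewrite ltW// (lt_le_trans ts).
  have z0 := ltW (Zpos t0); have z1 := ef_sol_le1 t0.
  have gz : g <= clip_pow (2 * kap + 1) (Z t).
    rewrite clip_pow_id ?z0// ge0_ler_powR ?nnegrE ?invr_ge0//.
      by rewrite addr_ge0// mulr_ge0// ltW.
    by apply: Zh; exact: ltW.
  rewrite sumE subr_ge0.
  rewrite [X in X <= _](_ : _ = expR t * (k * (eps * expR (kap * t) * g))); last by ring.
  rewrite ler_pM2l ?expR_gt0// ler_pM2l// -[X in X <= _]addr0 lerD//.
    by rewrite ler_wpM2l// mulr_ge0 ?expR_ge0// ltW.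
  by rewrite !mulr_ge0 ?expR_ge0// ltW.
rewrite /T sumE subr_ge0 [X in _ <= X]mulrC.
rewrite [X in X <= _](_ : _ = g * k * eps * expR (kap * s) / (kap + 1) * expR s); last by ring.
by rewrite ler_pM2r ?expR_gt0.
Qed.

End positive_solution.
End shooting.

(** If P ended below 1 - del, the barriers at del and 1 - del would keep it in the window where its
    rate is at least w; over a time of at least 1 / w it would gain 1, more than the width of the
    window. *)
Lemma slope_barrier (R : realType) (P dP : R -> R) (a b del w : R) :
  a <= b -> 1 <= w * (b - a) -> 0 < del -> del <= 4^-1 -> 0 < w ->
  (forall x, a <= x <= b -> is_derive x 1 P (dP x)) ->
  (forall x, a <= x <= b -> del <= P x <= 1 - del -> w <= dP x) ->
  del <= P a -> 1 - del <= P b.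
Proof.
move=> ab wab del0 del4 w0 hd hw Pa; rewrite leNgt; apply/negP => Pb.
have PU x : a <= x <= b -> P x < 1 - del.
  move=> /andP[ax xb]; rewrite ltNge; apply/negP => Px.
  have : 1 - del <= P b; last by rewrite leNgt Pb.
  apply: (@barrier _ P dP x b (1 - del) xb) => // t /andP[xt tb].
    by apply: hd; rewrite (le_trans ax).
  move=> Pt; apply: lt_le_trans w0 (hw t _ _); first by rewrite (le_trans ax).
  by rewrite Pt lexx andbT; lra.
have PL x : a <= x <= b -> del <= P x.
  move=> /andP[ax xb]; apply: (@barrier _ P dP a x del ax) => // t /andP[at_ tx].
    by apply: hd; rewrite at_ (le_trans tx).
  move=> Pt; apply: lt_le_trans w0 (hw t _ _); first by rewrite at_ (le_trans tx).
  by rewrite Pt lexx /=; lra.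
have : w * b - w * a <= P b - P a.
  apply: (@deriv_le _ (fun t => w * t) P (fun=> w) dP) => //.
    by move=> x _; eapply is_derive_eq; [der|rewrite /=; ring].
  move=> x /andP[/ltW ax /ltW xb]; apply: hw; first by rewrite ax.
  by rewrite PL ?ax//= ltW// PU ?ax.
by rewrite -mulrBr; lra.
Qed.

(** * Shooting *)

Section large_parameter.
Context {R : realType} (k kap gam lam : R).
Hypotheses (k0 : 0 < k) (kap0 : 0 < kap) (gam0 : 0 < gam) (lam0 : 0 < lam).
Hypothesis gam1 : gam <= 1.
Implicit Types (s t : R) (Z V : R -> R).

Let g := (2^-1 : R) `^ (2 * kap + 1).
(** The bound of [ef_flux_lower] at s0, where k eps e^(kap s0) = kap / 4 by the choice of eps. *)
Let p0 := g * kap / (4 * (kap + 1)).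
(** The first entry keeps the window [del, 1 - del] nonempty, the second lets the slope enter it at
    s0, and the third gives 4 del (5 + k lam) < k lam gam, which refutes the final comparison of
    energies. *)
Let del := Num.min 4^-1 (Num.min p0 (k * lam * gam / (4 * (6 + k * lam)))).

Let kl0 : 0 < k * lam. Proof. exact: mulr_gt0. Qed.

Let del0 : 0 < del.
Proof.
rewrite /del !lt_min invr_gt0 ltr0n/= /p0 /g; apply/andP; split.
  by rewrite divr_gt0 ?mulr_gt0 ?addr_gt0 ?powR_gt0 ?invr_gt0.
by rewrite divr_gt0 ?mulr_gt0 ?addr_gt0.
Qed.

Let del4 : del <= 4^-1. Proof. by rewrite /del ge_min lexx. Qed.
Let delp : del <= p0. Proof. by rewrite /del !ge_min lexx orbT. Qed.

Let delk : (6 + k * lam) * (4 * del) <= k * lam * gam.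
Proof.
have : del <= k * lam * gam / (4 * (6 + k * lam)) by rewrite /del !ge_min lexx !orbT.
by rewrite ler_pdivlMr ?mulr_gt0 ?addr_gt0//; lra.
Qed.

(** In the window P - P^2 >= del (1 - del), and B takes away at most half of that before sT;
    [ef_slope_growth] contributes the factor kap. *)
Let w := kap * (del * (1 - del)) / 2.

Let dd0 : 0 < del * (1 - del).
Proof. by rewrite mulr_gt0 ?del0//; have := del4; lra. Qed.

Let w0 : 0 < w.
Proof. by rewrite /w divr_gt0// mulr_gt0. Qed.

(* If Z had no zero, the slope V / Z would exceed 1 - del on a long interval
   [s1, sT].  There Z decays like e^(-(1 - del) s), so the energy gained on
   [s1, sT] is at least a multiple of Z(sT)^2 / del (this is where gam <= 1 is
   needed), whereas the energy at sT is at most a fixed multiple of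
   Z(sT)^2. *)
Lemma large_parameter_vanishes : exists2 eps, 0 < eps & forall Z V,
  ef_solution k kap gam lam eps Z V -> exists2 s, s <= 0 & Z s <= 0.
Proof.
(* The end sT is fixed independently of eps: up to it B is small compared with del (1 - del), and
   e^sT <= 1/2 will bound the slope at sT by 2. *)
have [sT [sT0 sTg sT1]] : exists sT, [/\ sT <= 0,
    k * lam * expR (gam * sT) <= del * (1 - del) / 2 & expR sT <= 2^-1].
  near (ninfty_nbhs R) => s; exists s; split.
  - by near: s; apply: nbhs_ninfty_le; exact: num_real.
  - have : expR (gam * s) <= del * (1 - del) / 2 / (k * lam).
      near: s; apply: expR_Ny_le => //; rewrite divr_gt0// divr_gt0//; exact: dd0.
    by rewrite ler_pdivlMr// mulrC.
  - have : expR (1 * s) <= 2^-1.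
      by near: s; apply: expR_Ny_le => //; rewrite invr_gt0.
    by rewrite mul1r.
(* The part free of s0 in the exponent that will bound the power term at sT. *)
pose K := kap * sT + 2 * kap * (1 - del) * (w^-1 - sT).
(* The start s0 goes far to the left for four reasons: room for the time 1 / w before sT, a small
   linear loss of Z up to s0, J(s1) <= J(sT) / 2, and a power term at sT below e^(gam sT). *)
have [s0 [s0T c1 c2 c3]] : exists s0, [/\ s0 + w^-1 <= sT,
    k * lam * expR (gam * s0) <= gam / 4,
    expR (2 * del * (s0 + w^-1 - sT)) <= 2^-1 &
    expR (kap * (1 - 2 * del) * s0) * expR K <= expR (gam * sT)].
  near (ninfty_nbhs R) => s; exists s; split.
  - by rewrite -lerBrDr; near: s; apply: nbhs_ninfty_le; exact: num_real.
  - have : expR (gam * s) <= gam / 4 / (k * lam).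
      by near: s; apply: expR_Ny_le => //; rewrite divr_gt0// divr_gt0.
    by rewrite ler_pdivlMr// mulrC.
  - have : expR (2 * del * s) <= 2^-1 / expR (2 * del * (w^-1 - sT)).
      near: s; apply: expR_Ny_le; first by rewrite mulr_gt0 ?del0.
      by rewrite divr_gt0 ?expR_gt0 ?invr_gt0.
    by rewrite ler_pdivlMr ?expR_gt0// -expRD -mulrDr addrA.
  - have : expR (kap * (1 - 2 * del) * s) <= expR (gam * sT) / expR K.
      near: s; apply: expR_Ny_le; last by rewrite divr_gt0 ?expR_gt0.
      by rewrite mulr_gt0//; have := del4; lra.
    by rewrite ler_pdivlMr ?expR_gt0.
(* With k eps e^(kap s0) = kap / 4 the power term costs Z at most 1/4 up to s0; the linear term
   costs at most another 1/4, whence Z >= 1/2 there. *)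
pose eps := kap / (4 * k) * expR (- (kap * s0)).
have eps0 : 0 < eps by rewrite /eps mulr_gt0 ?expR_gt0// divr_gt0 ?mulr_gt0.
exists eps => // Z V H; apply: contrapT => noZ.
have Zpos s : s <= 0 -> 0 < Z s.
  by move=> sle; rewrite ltNge; apply/negP => Zs; apply: noZ; exists s.
have wi0 : 0 < w^-1 by rewrite invr_gt0 w0.
have s00 : s0 <= 0 by lra.
pose s1 := s0 + w^-1.
have s1T : s1 <= sT by [].
have epsE s : k * eps * expR (kap * s) = kap / 4 * expR (kap * (s - s0)).
  rewrite /eps mulrBr expRB expRN; field.
  by rewrite !gt_eqF ?expR_gt0.
have Zhalf t : t <= s0 -> 2^-1 <= Z t.
  move=> ts; have t0 := le_trans ts s00.
  apply: le_trans (ef_nonincreasing k0 lam0 (ltW eps0) ts s00 H _); last first.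
    by move=> r rs; rewrite ltW// Zpos// (le_trans rs).
  apply: le_trans (ef_sol_lower k0 kap0 gam0 lam0 eps0 H Zpos s00).
  have -> : k * (eps * expR (kap * s0) / kap + lam * expR (gam * s0) / gam) =
    k * eps * expR (kap * s0) / kap + k * lam * expR (gam * s0) / gam by ring.
  rewrite epsE subrr mulr0 expR0 mulr1.
  have -> : kap / 4 / kap = 4^-1 by field; rewrite gt_eqF.
  have : k * lam * expR (gam * s0) / gam <= 4^-1.
    by rewrite ler_pdivrMr// [X in _ <= X]mulrC.
  by lra.
pose P s := V s / Z s.
have dP s : s <= 0 -> is_derive s 1 P (P s ^+ 2 - P s +
    k * eps * expR (kap * s) * Z s `^ (2 * kap) + k * lam * expR (gam * s)).
  exact: is_derive_slope H Zpos s.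
have P0 : del <= P s0.
  apply: le_trans delp _; rewrite /P.
  have := ef_flux_lower k0 kap0 lam0 eps0 H Zpos s00 Zhalf.
  rewrite -/g => gV.
  have Z1 := ef_sol_le1 k0 lam0 eps0 H Zpos s00.
  have V0 := ef_flux_pos k0 lam0 eps0 H Zpos s00.
  rewrite ler_pdivlMr ?Zpos//; apply: (@le_trans _ _ p0).
    by rewrite ler_piMr//; apply: le_trans delp; exact: ltW.
  apply: le_trans gV; rewrite le_eqVlt; apply/orP; left; apply/eqP.
  rewrite (_ : g * k * eps * expR (kap * s0) = g * (k * eps * expR (kap * s0))); last by ring.
  rewrite epsE subrr mulr0 expR0 /p0; field.
  by rewrite gt_eqF// addr_gt0.
have Bs s : s <= sT -> k * lam * expR (gam * s) <= del * (1 - del) / 2.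
  move=> ssT; apply: le_trans sTg; rewrite ler_pM2l// ler_expR.
  by rewrite ler_pM2l.
have wP x : x <= sT -> del <= P x <= 1 - del -> w <= P x ^+ 2 - P x +
    k * eps * expR (kap * x) * Z x `^ (2 * kap) + k * lam * expR (gam * x).
  move=> xT /andP[Pl Pu].
  apply: le_trans (ef_slope_growth k0 kap0 gam0 lam0 eps0 H Zpos (le_trans xT sT0)).
  rewrite -/(P x) /w -mulrA ler_pM2l//; have := Bs _ xT.
  by nra.
have PU s : s1 <= s <= sT -> 1 - del <= P s.
  move=> /andP[s1s ssT].
  have s1P : 1 - del <= P s1.
    apply: (slope_barrier (a := s0) (w := w) _ _ del0 del4 w0 _ _ P0).
    - by rewrite lerDl ltW.
    - by rewrite /s1 addrAC subrr add0r divff// gt_eqF// w0.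
    - by move=> x /andP[_ xs]; apply: dP; lra.
    - by move=> x /andP[_ xs]; apply: wP; exact: le_trans s1T.
  apply: (barrier s1s) s1P => x /andP[sx xs]; first by apply: dP; lra.
  move=> Px; apply: lt_le_trans w0 (wP _ (le_trans xs ssT) _).
  by rewrite Px lexx andbT; have := del4; lra.
have dZ s : s <= 0 -> is_derive s 1 Z (- V s) by case: H => + _ _ _ => /[apply].
pose zT := Z sT; have zT0 : 0 < zT by exact: Zpos.
(* A slope V / Z of at least 1 - del means that Z e^((1 - del) s) does not increase. *)
have Zdec a b : s1 <= a -> a <= b -> b <= sT ->
    Z b * expR ((1 - del) * b) <= Z a * expR ((1 - del) * a).
  move=> s1a ab bT; rewrite -lerN2.
  apply: (@ge0_deriv_le _ (fun s => - (Z s * expR ((1 - del) * s)))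
    (fun s => expR ((1 - del) * s) * (V s - (1 - del) * Z s))) => //.
  - move=> x /andP[ax xb]; have x0 : x <= 0 by lra.
    have := dZ x x0 => dZx; eapply is_derive_eq; first by der.
    by rewrite /=; ring.
  - move=> x /andP[ax xb]; have x0 : x <= 0 by lra.
    rewrite mulr_ge0 ?expR_ge0// subr_ge0 -ler_pdivlMr ?Zpos//.
    by apply: PU; apply/andP; split; lra.
  - apply: continuous_itvW => x /andP[_ xb]; have x0 : x <= 0 by lra.
    have := dZ x x0 => dZx.
    have : is_derive x 1 (fun s => - (Z s * expR ((1 - del) * s)))
      (expR ((1 - del) * x) * (V x - (1 - del) * Z x)).
      by eapply is_derive_eq; [der|rewrite /=; ring].
    exact: is_derive_continuous.
have s10 : s1 <= 0 by exact: le_trans sT0.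
have zT1 : zT <= expR ((1 - del) * (s1 - sT)).
  rewrite mulrBr expRB ler_pdivlMr ?expR_gt0//.
  apply: le_trans (Zdec s1 sT (lexx _) s1T (lexx _)) _.
  by rewrite ler_piMl ?expR_ge0// (ef_sol_le1 k0 lam0 eps0 H Zpos).
(* Antiderivative of a lower bound for the rate of the energy on [s1, sT], obtained from Z(x) >=
   Z(sT) e^((1 - del) (sT - x)). The small exponent 2 del is the source of the large factor 1 /
   del. *)
pose J s := k * lam * gam * zT ^+ 2 * expR ((1 - 2 * del + gam) * sT) / (2 * del)
  * expR (2 * del * s).
have EJ : J sT - J s1 <= ef_energy k kap gam lam eps Z V sT - ef_energy k kap gam lam eps Z V s1.
  have dn0 : del != 0 by rewrite gt_eqF// del0.
  apply: (@deriv_le _ J _ (fun s => k * lam * gam * zT ^+ 2 *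
      expR ((1 - 2 * del + gam) * sT) * expR (2 * del * s))
    (fun s => gam * (k * lam * expR (gam * s)) * expR s * Z s ^+ 2)) => //.
  - by move=> x _; rewrite /J; eapply is_derive_eq; [der|rewrite /=; field].
  - move=> x /andP[_ xT].
    apply: (is_derive_ef_energy k0 kap0 lam0 eps0 H Zpos); exact: le_trans sT0.
  - move=> x /andP[/ltW s1x /ltW xT].
    have xZ : zT * expR ((1 - del) * (sT - x)) <= Z x.
      rewrite mulrBr expRB mulrA ler_pdivrMr ?expR_gt0//.
      exact: Zdec s1x xT (lexx _).
    have xZ2 : zT ^+ 2 * expR (2 * (1 - del) * (sT - x)) <= Z x ^+ 2.
      rewrite -mulrA expRM_natl.
      rewrite -exprMn lerXn2r// nnegrE; last by rewrite ltW// Zpos// (le_trans xT).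
      by rewrite mulr_ge0 ?expR_ge0// ltW.
    apply: (@le_trans _ _ (gam * (k * lam * expR (gam * x)) * expR x *
        (zT ^+ 2 * expR (2 * (1 - del) * (sT - x))))); last first.
      by rewrite ler_wpM2l// !mulr_ge0 ?expR_ge0// ltW.
    rewrite [X in X <= _](_ : _ = k * lam * gam * zT ^+ 2 *
      (expR ((1 - 2 * del + gam) * sT) * expR (2 * del * x))); last by ring.
    rewrite [X in _ <= X](_ : _ = k * lam * gam * zT ^+ 2 *
      (expR (gam * x) * expR x * expR (2 * (1 - del) * (sT - x)))); last by ring.
    rewrite -!expRD ler_wpM2l//; first by rewrite !mulr_ge0 ?exprn_ge0// ltW.
    (* The exponents differ by (1 - gam) (sT - x), so gam <= 1 enters here; it enters again below in
       e^sT <= e^(gam sT). *)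
    rewrite ler_expR -subr_ge0.
    rewrite [X in 0 <= X](_ : _ = (1 - gam) * (sT - x)); last by ring.
    by rewrite mulr_ge0// subr_ge0.
have lower : k * lam * gam * zT ^+ 2 * expR ((1 + gam) * sT) / (4 * del) <=
    ef_energy k kap gam lam eps Z V sT.
  have E1 := ef_energy_ge0 k0 kap0 gam0 lam0 eps0 H Zpos s10.
  have : J sT - J s1 <= ef_energy k kap gam lam eps Z V sT by lra.
  apply: le_trans.
  have -> : J s1 = J sT * expR (2 * del * (s1 - sT)).
    by rewrite /J -[RHS]mulrA -expRD; congr (_ * expR _); ring.
  have -> : J sT = k * lam * gam * zT ^+ 2 * expR ((1 + gam) * sT) / (2 * del).
    rewrite /J mulrAC -[_ * expR _ * expR _]mulrA -expRD.
    by congr (_ * expR _ / _); ring.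
  set A := k * lam * gam * zT ^+ 2 * expR ((1 + gam) * sT).
  have A0 : 0 <= A by rewrite /A !mulr_ge0 ?expR_ge0// ltW.
  rewrite -[X in X - _]mulr1 -mulrBr.
  rewrite (_ : A / (4 * del) = A / (2 * del) * 2^-1); last by field; rewrite gt_eqF// del0.
  rewrite ler_wpM2l//; first by rewrite divr_ge0// mulr_ge0// ltW// del0.
  by rewrite -/s1 in c2; lra.
have upper : ef_energy k kap gam lam eps Z V sT <=
    expR sT * (zT ^+ 2 * (expR (gam * sT) * (5 + k * lam))).
  rewrite ef_energyE// -/zT ler_pM2l ?expR_gt0//.
  have -> : V sT ^+ 2 - V sT * zT + (k * eps * expR (kap * sT) * zT `^ (2 * kap) / (kap + 1) +
     k * lam * expR (gam * sT)) * zT ^+ 2 = zT ^+ 2 * (P sT ^+ 2 - P sT +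
     (k * eps * expR (kap * sT) * zT `^ (2 * kap) / (kap + 1) + k * lam * expR (gam * sT))).
    rewrite /P -/zT; field; rewrite !gt_eqF// addr_gt0//.
  rewrite ler_pM2l ?exprn_gt0//.
  have xg : expR sT <= expR (gam * sT).
    rewrite ler_expR; have := sT0; have := gam1; nra.
  (* With e^sT <= 1/2, [ef_slope_upper] gives P <= 2, then P - 1 <= P e^sT <= 2 e^sT: the slope can
     exceed 1 only by a small amount. *)
  have PP : P sT ^+ 2 - P sT <= 4 * expR (gam * sT).
    have := ef_slope_upper k0 lam0 eps0 H Zpos sT0.
    rewrite -/(P sT) => Pu; have x0 := expR_gt0 sT.
    have : P sT ^+ 2 - P sT <= 4 * expR sT.
      have Pl : 0 <= P sT by apply: le_trans (PU sT _); rewrite ?lexx ?andbT//; have := del4; lra.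
      have P2 : P sT <= 2 by nra.
      have : P sT - 1 <= 2 * expR sT by nra.
      by nra.
    by lra.
  (* Z(sT) is at most e^((1 - del) (s1 - sT)), so its power 2 kap beats the growth e^(kap (sT -
     s0)), because 2 (1 - del) > 1. *)
  have yT : k * eps * expR (kap * sT) * zT `^ (2 * kap) / (kap + 1) <= expR (gam * sT).
    have k1 : 0 < kap + 1 by rewrite addr_gt0.
    rewrite epsE ler_pdivrMr//.
    have z2 : zT `^ (2 * kap) <= expR (2 * kap * ((1 - del) * (s1 - sT))).
      rewrite [X in _ <= X](_ : _ = expR ((1 - del) * (s1 - sT)) `^ (2 * kap)); last first.
        by rewrite /powR gt_eqF ?expR_gt0// expRK.
      by rewrite ge0_ler_powR ?nnegrE ?expR_ge0 ?(ltW zT0)// mulr_ge0// ltW.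
    apply: (@le_trans _ _ (kap / 4 * expR (kap * (sT - s0)) *
        expR (2 * kap * ((1 - del) * (s1 - sT))))).
      by rewrite ler_wpM2l// mulr_ge0 ?expR_ge0// divr_ge0// ltW.
    rewrite -mulrA -expRD.
    rewrite (_ : kap * (sT - s0) + _ = kap * (1 - 2 * del) * s0 + K); last first.
      by rewrite /K /s1; ring.
    rewrite expRD mulrC ler_pM ?mulr_ge0 ?expR_ge0// ?divr_ge0 ?(ltW kap0)//.
    by have := kap0; lra.
  have := kl0; have := expR_gt0 (gam * sT); nra.
have := le_trans lower upper.
rewrite ler_pdivrMr; last by rewrite mulr_gt0 ?del0.
rewrite mulrDl mul1r expRD.
have zx0 : 0 < zT ^+ 2 * (expR sT * expR (gam * sT)).
  by rewrite !mulr_gt0 ?expR_gt0.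
rewrite [X in X <= _](_ : _ = zT ^+ 2 * (expR sT * expR (gam * sT)) * (k * lam * gam)); last by ring.
rewrite [X in _ <= X](_ : _ = zT ^+ 2 * (expR sT * expR (gam * sT)) * ((5 + k * lam) * (4 * del))); last by ring.
rewrite ler_pM2l//; have := delk; have := del0; lra.
Unshelve. all: by end_near. Qed.

End large_parameter.

Section shooting_argument.
Context {R : realType} (k kap gam lam : R).
Hypotheses (k0 : 0 < k) (kap0 : 0 < kap) (gam0 : 0 < gam) (lam0 : 0 < lam).
Implicit Types (eps s t : R) (Z V : R -> R).

Lemma ef_family : exists Z V : R -> R -> R,
  (forall eps, 0 <= eps -> ef_solution k kap gam lam eps (Z eps) (V eps)) /\
  forall E, 0 <= E -> exists2 C, 0 <= C & forall eps eps' s,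
    0 <= eps <= E -> 0 <= eps' <= E -> s <= 0 ->
    `|Z eps s - Z eps' s| <= C * `|eps - eps'|.
Proof.
have [N Nm] : exists N : nat, forall m, Num.min kap gam <= m -> 1 < N%:R * m.
  have m0 : 0 < Num.min kap gam by rewrite lt_min kap0.
  exists (Num.trunc (Num.min kap gam)^-1).+1 => m mm.
  rewrite -ltr_pdivrMr ?(lt_le_trans m0)// div1r.
  apply: le_lt_trans (truncnS_gt _); rewrite lef_pV2// posrE ?(lt_le_trans m0)//.
have Nkap : 1 < N%:R * kap by rewrite Nm// ge_min lexx.
have Ngam : 1 < N%:R * gam by rewrite Nm// ge_min lexx orbT.
have p1 : 1 <= 2 * kap + 1 by rewrite lerDr mulr_ge0// ltW.
exists (ef_sol N k kap gam lam (2 * kap + 1)), (ef_flux N k kap gam lam (2 * kap + 1)).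
split=> [eps e0|E E0].
  split.
  - by move=> s s0; exact: (is_derive_ef_sol k0 (ltW lam0) p1 Nkap Ngam).
  - by move=> s s0; exact: (is_derive_ef_flux k0 (ltW lam0) p1 Nkap Ngam).
  - have mk : Num.min kap gam <= kap by rewrite ge_min lexx.
    have mg : Num.min kap gam <= gam by rewrite ge_min lexx orbT.
    have [C C0 Cb] := ef_bounds k0 (ltW lam0) p1 Nkap Ngam e0 mk mg.
    exists C, (Num.min kap gam); split=> //; first by rewrite lt_min kap0.
    by move=> s s0; exact: (Cb s s0).2.
  - exact: (ef_sol_cvg k0 (ltW lam0) p1 Nkap Ngam).
exists (N%:R ^+ 2 * k * expR (2 * ef_L N k lam (2 * kap + 1) E)).
  by rewrite !mulr_ge0 ?expR_ge0 ?exprn_ge0// ltW.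
move=> eps eps' s eE eE' s0; rewrite [X in _ <= X]mulrC.
exact: (ef_sol_diff k0 (ltW lam0) p1 Nkap Ngam eE eE' s0).
Qed.

Lemma shooting : gam <= 1 ->
  (forall Z V, ef_solution k kap gam lam 0 Z V -> forall s, s <= 0 -> 0 < Z s) ->
  exists eps Z V, [/\ 0 < eps, ef_solution k kap gam lam eps Z V,
    forall s, s <= 0 -> 0 <= Z s & Z 0 = 0].
Proof.
move=> gam1 lin; have [Z [V [ZV lipZ]]] := ef_family.
pose A eps := forall s, s <= 0 -> 0 < Z eps s.
pose S := [set eps | 0 <= eps /\ exists2 s, s <= 0 & Z eps s <= 0].
have SA eps : 0 <= eps -> ~ S eps -> A eps.
  move=> e0 nS s s0; rewrite ltNge; apply/negP => Zs; apply: nS.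
  by split=> //; exists s.
have [e1 e10 e1v] := large_parameter_vanishes k0 kap0 gam0 lam0 gam1.
have Se1 : S e1 by split; [exact: ltW|exact: e1v (ZV _ (ltW e10))].
have lbS : lbound S 0 by move=> x [].
have infS : has_inf S by split; [exists e1|exists 0].
set e := inf S.
have e0 : 0 <= e by apply: lb_le_inf; first by exists e1.
have lbe x : S x -> e <= x by apply: ge_inf; exists 0.
(* Positivity is an open condition: [Z e] would have its minimum over s <= 0 at s = 0, with a
   positive value, and the estimate uniform in s would keep Z positive for all parameters just above
   e. *)
have nAe : ~ A e.
  move=> Ae; have m0 := Ae 0 (lexx 0).
  have Zm s : s <= 0 -> Z e 0 <= Z e s.
    move=> s0; apply: (ef_nonincreasing k0 lam0 e0 s0 (lexx 0) (ZV _ e0)).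
    by move=> t t0; exact/ltW/Ae.
  have [C C0 CL] := lipZ (e + 1) ltac:(by rewrite addr_ge0).
  have d0 : 0 < Num.min 1 (Z e 0 / (C + 1)).
    by rewrite lt_min ltr01 divr_gt0// ltr_wpDl.
  have [x [x0 [s s0 Zs]] xe] := inf_adherent d0 infS.
  have ex : e <= x by apply: lbe; split=> //; exists s.
  have : x - e < Num.min 1 (Z e 0 / (C + 1)) by rewrite ltrBlDl.
  rewrite lt_min ltr_pdivlMr ?ltr_wpDl// => /andP[xe1 xeC].
  have := CL x e s _ _ s0; rewrite x0 e0 lerDl ler01 (ltW (_ : x < e + 1)) ?ltrBlDl -?ltrBlDl//.
  move=> /(_ isT isT); rewrite (ger0_norm (_ : 0 <= x - e)) ?subr_ge0//.
  rewrite ler_norml => /andP[+ _]; have := Zm _ s0.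
  have xe0 : 0 <= x - e by rewrite subr_ge0.
  by nra.
have A0 : A 0 by exact: lin (ZV 0 (lexx 0)).
have ep : 0 < e.
  by rewrite lt_neqAle e0 andbT; apply/eqP => e0'; apply: nAe; rewrite -e0'.
(* A negative value at e persists for the parameter x slightly below e (cut at 0), although no
   parameter below e belongs to S. *)
have Zge0 s : s <= 0 -> 0 <= Z e s.
  move=> s0; rewrite leNgt; apply/negP => Zs.
  have [C C0 CL] := lipZ e e0.
  pose x := Num.max 0 (e + Z e s / (C + 1)).
  have C1 : 0 < C + 1 by rewrite ltr_wpDl.
  have ZC : Z e s / (C + 1) < 0 by rewrite pmulr_llt0 ?invr_gt0.
  have xe : x < e by rewrite gt_max ep /= gtrDl.
  have x0 : 0 <= x by rewrite le_max lexx.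
  have Ax : A x by apply: SA => // /lbe; rewrite leNgt xe.
  have := Ax _ s0; have := CL x e s _ _ s0; rewrite x0 e0 lexx (ltW xe) => /(_ isT isT).
  rewrite ler_norml distrC (ger0_norm (_ : 0 <= e - x)) ?subr_ge0 ?(ltW xe)// => /andP[_ d] Zx.
  have : e - x <= - (Z e s / (C + 1)) by rewrite lerBlDr -lerBlDl opprK le_max lexx orbT.
  rewrite -mulNr ler_pdivlMr// => ex.
  have : 0 <= e - x by rewrite subr_ge0 ltW.
  by nra.
exists e, (Z e), (V e); split=> //; first exact: ZV.
apply/eqP; rewrite eq_le Zge0// andbT leNgt; apply/negP => Z0; apply: nAe => s s0.
apply: lt_le_trans Z0 _.
exact: (ef_nonincreasing k0 lam0 e0 s0 (lexx 0) (ZV _ e0)).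
Qed.

End shooting_argument.

(** * Integration on R^n *)

Section borel_rV.
Context {R : realType} {n : nat}.
Implicit Types (x v : 'rV[R]_n) (f : 'rV[R]_n -> R).

Lemma ball_rV_measurable x (r : R) : measurable (ball x r : set 'rV[R]_n).
Proof.
have [r0|r0] := leP r 0.
  rewrite (_ : ball x r = set0)//; apply/seteqP; split=> // y [].
  by rewrite ltNge r0.
rewrite (_ : ball x r = \bigcap_(i in [set: 'I_n])
    ((fun v => v ord0 i) @^-1` ball (x ord0 i) r)); last first.
  apply/seteqP; split=> [y [_ xy] i _|y xy]; first exact: xy.
  by split=> // i j; rewrite !ord1; exact: xy.
apply: fin_bigcap_measurable => // i _.
rewrite -[X in measurable X]setTI; apply: measurable_coord; first exact: measurableT.
by apply: open_measurable; exact: ball_open.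
Qed.

(** The sigma-algebra is generated by the coordinates, so open sets must be shown to belong to it: U
    is a countable union of sup-norm balls with rational centres and radii 1 / (N + 1), each an
    intersection of coordinate conditions. *)
Lemma open_rV_measurable (U : set 'rV[R]_n) : open U -> measurable U.
Proof.
move=> oU; pose q (p : 'rV[rat]_n * nat) := ball (map_mx ratr p.1 : 'rV[R]_n) p.2.+1%:R^-1.
pose D := [set p : 'rV[rat]_n * nat | q p `<=` U].
rewrite (_ : U = \bigcup_(p in D) q p); last first.
  apply/seteqP; split=> [x Ux|x [p Dp qx]]; last exact: Dp.
  have /nbhs_ballP[e /= e0 eU] : nbhs x U by exact: open_nbhs_nbhs.
  have [N Ne] : exists N : nat, N.+1%:R^-1 < e / 2.
    exists (Num.trunc (e / 2)^-1); rewrite invf_plt ?posrE ?divr_gt0//.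
    exact: truncnS_gt.
  have N0 : 0 < N.+1%:R^-1 :> R by rewrite invr_gt0.
  have rx i : {r : rat | x ord0 i - N.+1%:R^-1 < ratr r < x ord0 i + N.+1%:R^-1}.
    apply: cid; have [|r] := @rat_in_itvoo R (x ord0 i - N.+1%:R^-1) (x ord0 i + N.+1%:R^-1).
      by rewrite ltrBlDr -addrA ltrDl addr_gt0.
    by rewrite in_itv/=; exists r.
  exists (\row_i sval (rx i), N); rewrite /D/=; last first.
    split=> // i j; have -> : i = ord0 by rewrite ord1.
    rewrite !mxE /ball/=; case: (rx j) => r /= /andP[rl ru].
    by rewrite ltr_distl rl.
  move=> y [_ qy]; apply: eU; split=> // i j; have := qy i j.
  have -> : i = ord0 by rewrite ord1.
  rewrite !mxE /ball/=; case: (rx j) => r /= rlu qr.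
  apply: le_lt_trans (ler_distD (ratr r) _ _) _; rewrite (splitr e).
  by apply: ltrD; apply: lt_trans Ne; [rewrite distrC ltr_distl|].
rewrite bigcup_mkcond; apply: countable_bigcupT_measurable => [|p]; first exact: countableP.
by case: ifPn => // _; exact: ball_rV_measurable.
Qed.

Lemma continuous_rV_measurable f : continuous f -> measurable_fun setT f.
Proof.
move=> cf; apply: (measurability _ (RGenOpens.measurableE R)).
move=> _ [_ [a [b ->] <-]]; rewrite setTI; apply: open_rV_measurable.
by move/continuousP : cf; apply; exact: interval_open.
Qed.

End borel_rV.

Section directional.
Context {R : realType} {V : normedModType R}.
Implicit Types (F G : V -> R) (x v : V) (d : R).

(** Transfers the differentiation rules proved on the line to directional derivatives. *)
Lemma is_derive_lineP F x v d :
  is_derive x v F d <-> is_derive (0 : R) 1 (fun h : R => F (h *: v + x)) d.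
Proof.
have E : 'D_v F x = 'D_1 (fun h : R => F (h *: v + x)) 0.
  rewrite /derive; set g1 := fun h => h^-1 *: _; set g2 := fun h => h^-1 *: _.
  suff -> : g1 = g2 by [].
  by apply/funext => h; rewrite /g1 /g2 /= addr0 scale0r add0r [_%:A]mulr1.
split=> -[D dE].
  by apply: DeriveDef; [exact: (derivable1P F x v).1|rewrite -E].
by apply: DeriveDef; [exact: (derivable1P F x v).2|rewrite E].
Qed.

Lemma is_derive_comp1 F x v d (g : R -> R) (dg : R) :
  is_derive (F x) 1 g dg -> is_derive x v F d ->
  is_derive x v (fun y => g (F y)) (dg * d).
Proof.
move=> hg /is_derive_lineP hF; apply/is_derive_lineP.
apply: (@der_comp _ g (fun h => F (h *: v + x)) 0 dg d) => //.
by rewrite scale0r add0r.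
Qed.

Lemma is_derive_prod F G x v (dF dG : R) :
  is_derive x v F dF -> is_derive x v G dG ->
  is_derive x v (fun y => F y * G y) (dF * G x + F x * dG).
Proof.
move=> /is_derive_lineP hF /is_derive_lineP hG; apply/is_derive_lineP.
by apply: is_derive_eq (derM hF hG) _; rewrite /= !scale0r !add0r.
Qed.

Lemma is_derive_uniq F x v (d d' : R) :
  is_derive x v F d -> is_derive x v F d' -> d = d'.
Proof. by move=> [_ <-] [_ <-]. Qed.

End directional.

Section box.
Context {R : realType}.
Implicit Types (L : R).

(** Bounded support in coordinatewise form, which slices at a fixed first coordinate inherit in
    Fubini's theorem. *)
Definition supported_in_box n L (F : 'rV[R]_n -> R) :=
  forall (x : 'rV[R]_n) (j : 'I_n), L < `|x ord0 j| -> F x = 0.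

Lemma coord_cvg n (j : 'I_n) : continuous (fun x : 'rV[R]_n => x ord0 j).
Proof. exact: coord_continuous. Qed.

Lemma continuous_box_bounded n L (F : 'rV[R]_n -> R) : continuous F ->
  supported_in_box L F -> exists2 M, 0 <= M & forall x, `|F x| <= M.
Proof.
move=> cF F0; pose K := [set v : 'rV[R]_n | forall i, v ord0 i \in `[- L, L]].
have cK : compact K.
  by apply: (@rV_compact _ _ (fun=> `[- L, L]%classic)) => _; exact: segment_compact.
have [M [_ HM]] : bounded_set (F @` K).
  apply: compact_bounded; apply: continuous_compact => //.
  exact: continuous_subspaceT.
have M1 : M < `|M| + 1 by have := ler_norm M; lra.
exists (`|M| + 1) => [|x]; first by have := normr_ge0 M; lra.
have [Kx|/existsNP[j /negP nj]] := pselect (K x).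
  by apply: HM M1 _ _; exists x.
rewrite (F0 x j) ?normr0; first by have := normr_ge0 M; lra.
by rewrite ltNge; apply: contra nj; rewrite in_itv/= ler_norml.
Qed.

Lemma box_measure n L : 0 <= L ->
  lebesgue_rV n [set v : 'rV[R]_n | forall i, `[- L, L]%classic (v ord0 i)] =
  ((2 * L) ^+ n)%:E.
Proof.
move=> L0; rewrite (@lebesgue_rV_box R n (fun=> `[- L, L]%classic))//.
rewrite (eq_bigr (fun=> (2 * L)%:E)).
  by rewrite prodEFin prodr_const card_ord.
move=> i _; rewrite lebesgue_measure_itv/= lte_fin.
case: ifPn => [_|]; first by rewrite -EFinB; congr EFin; ring.
by rewrite -leNgt => LL; congr EFin; have := L0; lra.
Qed.

Lemma box_measurable n L :
  measurable [set v : 'rV[R]_n | forall i, `[- L, L]%classic (v ord0 i)].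
Proof.
rewrite [X in measurable X](_ : _ = \bigcap_(i in [set: 'I_n])
    ((fun v : 'rV[R]_n => v ord0 i) @^-1` `[- L, L]%classic)); last first.
  by apply/seteqP; split=> [v Lv i _|v Lv i]; exact: Lv.
apply: fin_bigcap_measurable => // i _.
rewrite -[X in measurable X]setTI; apply: measurable_coord; first exact: measurableT.
exact: measurable_itv.
Qed.

Lemma continuous_box_integrable n L (F : 'rV[R]_n -> R) : continuous F ->
  supported_in_box L F -> 0 <= L -> (lebesgue_rV n).-integrable setT (EFin \o F).
Proof.
move=> cF F0 L0; have [M M0 FM] := continuous_box_bounded cF F0.
set K := [set v : 'rV[R]_n | forall i, `[- L, L]%classic (v ord0 i)].
have mK : measurable K by exact: box_measurable.
have iK : (lebesgue_rV n).-integrable setT (EFin \o (fun x => M * \1_K x)).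
  rewrite (_ : _ \o _ = (fun x => M%:E * (\1_K x)%:E)%E); last by apply/funext => x.
  apply: (@integrableZl _ _ _ (lebesgue_rV n) setT measurableT M (fun x => (\1_K x)%:E)).
  apply/integrableP; split; first by apply/measurable_EFinP.
  rewrite (eq_integral (fun x => (\1_K x)%:E)); last first.
    by move=> x _; rewrite gee0_abs// lee_fin.
  rewrite integral_indic// setIT.
  apply: (@le_lt_trans _ _ ((2 * L) ^+ n)%:E); last exact: ltry.
  by rewrite -(box_measure n L0).
apply: le_integrable iK => //.
  by apply/measurable_EFinP; exact: continuous_rV_measurable.
move=> x _ /=; rewrite lee_fin indicE.
have [Kx|nKx] := pselect (K x); first by rewrite mem_set// mulr1 (ger0_norm M0).
rewrite memNset// mulr0 normr0.
have /existsNP[j nj] : ~ forall i, `[- L, L]%classic (x ord0 i) by [].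
rewrite (F0 x j) ?normr0// ltNge; apply/negP => /= xj; apply: nj.
by rewrite /= in_itv/= -ler_norml.
Qed.

Lemma supported_in_box_derive n L (F dF : 'rV[R]_n -> R) (i : 'I_n) :
  (forall x, is_derive x (delta_mx ord0 i) F (dF x)) ->
  supported_in_box L F -> supported_in_box L dF.
Proof.
move=> hF F0 x j xj; apply: (is_derive_uniq (hF x)).
apply: (@near_eq_is_derive _ _ _ (cst 0)).
near=> y; rewrite (F0 y j)//; near: y.
apply: (cvgr_gt _ (cvg_norm (@coord_cvg n j x))).
exact: xj.
Unshelve. all: by end_near. Qed.

Lemma rV_consD n (h t : R) (v : 'rV[R]_n) :
  rV_cons (h + t, v) = h *: delta_mx ord0 ord0 + rV_cons (t, v) :> 'rV[R]_n.+1.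
Proof.
apply/rowP => j; rewrite !mxE eqxx/=; case: unliftP => [j' ->|->].
  by rewrite mulr0 add0r.
by rewrite mulr1.
Qed.

Lemma rV_consZD n (h t : R) (w v : 'rV[R]_n) (i : 'I_n) :
  rV_cons (t, h *: delta_mx ord0 i + v) =
  h *: delta_mx ord0 (lift ord0 i) + rV_cons (t, v) :> 'rV[R]_n.+1.
Proof.
apply/rowP => j; rewrite !mxE; case: unliftP => [j' ->|->].
  by rewrite !mxE/= (inj_eq (@lift_inj _ _)).
by rewrite eqxx /= mulr0 add0r.
Qed.

Lemma rV_cons_continuous_r n (t : R) : continuous (fun v : 'rV[R]_n => rV_cons (t, v)).
Proof.
move=> v; have FF : Filter (nbhs v) by exact: nbhs_filter.
apply/cvg_ballP => e e0; apply: filterS (nbhsx_ballx v e e0) => w [_ vw].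
split=> // i j; rewrite !mxE; case: unliftP => [j' _|_]; last exact: ballxx.
by have := vw ord0 j'.
Qed.

Lemma rV_cons_continuous_l n (v : 'rV[R]_n) : continuous (fun t : R => rV_cons (t, v)).
Proof.
move=> t; have FF : Filter (nbhs t) by exact: nbhs_filter.
apply/cvg_ballP => e e0; apply: filterS (nbhsx_ballx t e e0) => s ts.
by split=> // i j; rewrite !mxE; case: unliftP => [j' _|_] //; exact: ballxx.
Qed.

Lemma integrable_lebesgue_cons n (f : 'rV[R]_n.+1 -> \bar R) :
  (lebesgue_rV n.+1).-integrable setT f ->
  (lebesgue_measure \x lebesgue_rV n)%E.-integrable setT (f \o @rV_cons R n).
Proof.
move=> /integrableP[mf fi]; apply/integrableP; split.
  by apply: measurableT_comp => //; exact: measurable_rV_cons.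
move: fi; rewrite /= /lebesgue_cons ge0_integral_pushforward//.
  exact: measurable_rV_cons.
by apply: measurableT_comp.
Qed.

Lemma integral_lebesgue_cons n (f : 'rV[R]_n.+1 -> \bar R) :
  (lebesgue_rV n.+1).-integrable setT f ->
  (\int[lebesgue_rV n.+1]_x f x =
   \int[lebesgue_measure \x lebesgue_rV n]_p f (rV_cons p))%E.
Proof.
move=> fi; rewrite /= /lebesgue_cons integral_pushforward//.
- exact: measurable_rV_cons.
- exact: measurable_int fi.
- exact: integrable_lebesgue_cons.
Qed.

(** Fubini: if i is the first coordinate, the inner integral is that of the derivative of a
    compactly supported function; otherwise the slices at fixed first coordinate fall under the
    induction on n. *)
Lemma integral_partial_eq0 n L (F dF : 'rV[R]_n -> R) (i : 'I_n) : 0 < L ->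
  (forall x, is_derive x (delta_mx ord0 i) F (dF x)) -> continuous dF ->
  supported_in_box L F ->
  (\int[lebesgue_rV n]_x (dF x)%:E = 0)%E.
Proof.
move=> L0; elim: n F dF i => [F dF []//|n IH F dF i hF cdF F0].
have dF0 := supported_in_box_derive hF F0.
have iF := continuous_box_integrable cdF dF0 (ltW L0).
rewrite integral_lebesgue_cons//.
have iF' := integrable_lebesgue_cons iF.
case: (unliftP ord0 i) => [j ij|i0]; subst i.
  rewrite -(integral12_prod_meas1 iF'); apply: integral0_eq => t _.
  apply: (IH (fun v => F (rV_cons (t, v))) (fun v => dF (rV_cons (t, v))) j).
  - move=> v; apply/is_derive_lineP.
    have := hF (rV_cons (t, v)) => /is_derive_lineP.
    congr is_derive; apply/funext => h; congr F.
    by rewrite rV_consZD.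
  - move=> v; apply: (@continuous_comp _ _ _ (fun v => rV_cons (t, v)) dF).
      exact: rV_cons_continuous_r.
    exact: cdF.
  - move=> v k vk; apply: (F0 _ (lift ord0 k)).
    by rewrite mxE liftK.
rewrite -(integral21_prod_meas1 iF'); apply: integral0_eq => v _.
rewrite /fubini_G/=.
pose G (t : R) := F (rV_cons (t, v)); pose dG (t : R) := dF (rV_cons (t, v)).
have hG (t : R) : is_derive t 1 G (dG t).
  have := hF (rV_cons (t, v)) => /is_derive_lineP H.
  apply/is_derive_lineP; move: H; congr is_derive; apply/funext => h.
  by rewrite /G /GRing.scale/= mulr1 rV_consD.
have cdG : continuous dG.
  move=> t; apply: (@continuous_comp _ _ _ (fun t => rV_cons (t, v)) dF).
    exact: rV_cons_continuous_l.
  exact: cdF.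
have cG : continuous G by move=> t; exact: is_derive_continuous (hG t).
have G0 t : L < `|t| -> G t = 0.
  by move=> tL; apply: (F0 _ ord0); rewrite mxE unlift_none.
have dG0 t : L < `|t| -> dG t = 0.
  by move=> tL; apply: (dF0 _ ord0); rewrite mxE unlift_none.
have LL : - (L + 1) < L + 1 by lra.
transitivity (\int[@lebesgue_measure R]_(t in `[(- (L + 1))%R, (L + 1)%R]) (dG t)%:E)%E.
  rewrite [RHS]integral_mkcond; apply: eq_integral => t _; rewrite patchE.
  case: ifPn => //; rewrite notin_setE /= in_itv/= => tL.
  rewrite -/(dG t) dG0// ltNge; apply/negP; rewrite ler_norml => /andP[t1 t2].
  by apply: tL; apply/andP; split; lra.
rewrite (@continuous_FTC2 _ dG G)//.
- have nL : L < `|L + 1| by rewrite ger0_norm; lra.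
  by rewrite (G0 _ nL) G0 ?subee// normrN.
- exact: continuous_subspaceT.
- split.
  + by move=> t _; case: (hG t).
  + by apply: cvg_at_right_filter; exact: cG.
  + by apply: cvg_at_left_filter; exact: cG.
- by move=> t _; rewrite derive1E; case: (hG t).
Qed.

End box.

Section squared_norm.
Context {R : realType} {n : nat}.
Implicit Types (x v : 'rV[R]_n) (s r : R).

(** Radial functions are written in the variable |x|^2, which is smooth at the origin, unlike
    |x|. *)
Definition sq x := edot x x.

Lemma edot_ge0 x : 0 <= edot x x.
Proof. by apply: sumr_ge0 => i _; rewrite -expr2 sqr_ge0. Qed.

Lemma sq_ge0 x : 0 <= sq x. Proof. exact: edot_ge0. Qed.

Lemma enorm_powR x p : enorm x `^ p = sq x `^ (p / 2).
Proof.
by rewrite /enorm -(powR12_sqrt (edot_ge0 x)) -powRrM mulrC.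
Qed.

Lemma unit_ballE : unit_ball = [set x | sq x < 1].
Proof.
apply/seteqP; split=> x; rewrite /unit_ball /= /enorm -/(sq x).
  rewrite !ltNge; apply: contra => s1.
  by rewrite -[X in X <= _](sqrtr1 R) ler_sqrt// sq_ge0.
by move=> s1; rewrite -[X in _ < X](sqrtr1 R) ltr_sqrt.
Qed.

Lemma edot_continuous : continuous sq.
Proof.
apply: (@continuous_big R 'I_n +%R 0 xpredT _ _ _
  (fun i x => x ord0 i * x ord0 i)); first exact: add_continuous.
move=> i _ x; have FF : Filter (nbhs x) by exact: nbhs_filter.
by apply: cvgM; exact: coord_cvg.
Qed.

Lemma unit_ball_measurable : measurable (@unit_ball R n).
Proof.
rewrite unit_ballE; apply: open_rV_measurable.
rewrite (_ : mkset _ = sq @^-1` [set t | t < 1])//.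
by move/continuousP : edot_continuous; apply; exact: open_lt.
Qed.

Lemma sqr_coord_le x (j : 'I_n) : x ord0 j ^+ 2 <= sq x.
Proof.
rewrite /sq /edot (bigD1 j)//= -expr2 lerDl.
by apply: sumr_ge0 => i _; rewrite -expr2 sqr_ge0.
Qed.

Lemma coord_lt x (j : 'I_n) r : 0 <= r -> sq x < r ^+ 2 -> `|x ord0 j| < r.
Proof.
move=> r0 xr; rewrite -(ltr_pXn2r (n := 2)) ?nnegrE//.
by rewrite real_normK ?num_real// (le_lt_trans (sqr_coord_le x j)).
Qed.

Lemma sq_measurable D : measurable_fun D sq.
Proof.
apply: measurable_funTS; apply: continuous_rV_measurable.
exact: edot_continuous.
Qed.

Lemma is_derive_coord x (i j : 'I_n) :
  is_derive x (delta_mx ord0 i) (fun y : 'rV[R]_n => y ord0 j) (j == i)%:R.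
Proof.
apply/is_derive_lineP.
rewrite (_ : (fun h : R => _) = fun h : R => h * (j == i)%:R + x ord0 j); last first.
  by apply/funext => h; rewrite !mxE eqxx.
by eapply is_derive_eq; [der|rewrite /=; ring].
Qed.

Lemma is_derive_sq x (i : 'I_n) : is_derive x (delta_mx ord0 i) sq (2 * x ord0 i).
Proof.
have H (j : 'I_n) : is_derive x (delta_mx ord0 i)
    (fun y : 'rV[R]_n => y ord0 j * y ord0 j) (2 * x ord0 i * (j == i)%:R).
  apply: is_derive_eq (is_derive_prod (is_derive_coord x i j) (is_derive_coord x i j)) _.
  case: eqVneq => [->|_]; first by rewrite /=; ring.
  by rewrite /=; ring.
rewrite (_ : sq = \sum_(j < n) (fun y : 'rV[R]_n => y ord0 j * y ord0 j)); last first.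
  by apply/funext => y; rewrite fct_sumE.
apply: is_derive_eq (is_derive_sum H) _.
rewrite (bigD1 i)//= eqxx mulr1 big1 ?addr0// => j /negbTE ->.
by rewrite mulr0.
Qed.

End squared_norm.

Lemma unit_ball_lty (R : realType) n : (lebesgue_rV n (@unit_ball R n) < +oo)%E.
Proof.
apply: (@le_lt_trans _ _ (((2 * 1) ^+ n)%:E : \bar R)); last exact: ltry.
rewrite -(box_measure n ler01); apply: le_measure; rewrite ?inE.
- exact: unit_ball_measurable.
- exact: box_measurable.
- rewrite unit_ballE => x /= x1 i.
  by rewrite in_itv/= -ler_norml ltW// coord_lt// expr1n.
Qed.

(** * Integrability of powers of the norm on the ball *)

Section power_integrable.
Context {R : realType} {n : nat}.
Hypothesis n0 : (0 < n)%N.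
Implicit Types (m p : R).

Let mB := @unit_ball_measurable R n.

Let K k : set 'rV[R]_n :=
  [set v | forall i, `[- 2^-1 ^+ k, 2^-1 ^+ k]%classic (v ord0 i)].

(** For x != 0 the index k is that of the annulus 4^-(k+1) <= |x|^2 < 4^-k containing x. At x = 0
    the negative power has the default value 0. *)
Lemma dyadic_cover m (x : 'rV[R]_n) : m < 0 -> unit_ball x ->
  exists k, sq x `^ m <= (4^-1 ^+ k.+1) `^ m * \1_(K k) x.
Proof.
rewrite unit_ballE /= => m0 x1; have := sq_ge0 x; rewrite le_eqVlt => /predU1P[x0|x0].
  by exists 0%N; rewrite -x0 powR0 ?lt_eqF// mulr_ge0 ?powR_ge0// indicE.
have exk : exists k, 4^-1 ^+ k.+1 <= sq x.
  have : (fun k => 4^-1 ^+ k : R) @ \oo --> (0 : R).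
    by apply: cvg_expr; rewrite ger0_norm; lra.
  move=> /cvgrPdist_le/(_ _ x0)[k _ /(_ k.+1 (leqnSn k))].
  rewrite sub0r normrN ger0_norm ?exprn_ge0// => kx.
  by exists k.
case: (ex_minnP exk) => k kx kmin; exists k.
have xk : sq x < 4^-1 ^+ k.
  case: k kx kmin => [_ _|k kx kmin]; first by rewrite expr0.
  by rewrite ltNge; apply/negP => /kmin; rewrite ltnn.
have Kx : K k x.
  move=> i; rewrite /= in_itv/= -ler_norml ltW// coord_lt ?exprn_ge0//.
  by rewrite -exprM mulnC exprM (_ : 2^-1 ^+ 2 = 4^-1 :> R)//; field.
rewrite indicE mem_set// mulr1 -[m]opprK !(powRN _ (- m)).
rewrite lef_pV2 ?posrE ?powR_gt0 ?exprn_gt0 ?invr_gt0//.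
by rewrite ge0_ler_powR ?nnegrE ?exprn_ge0 ?(ltW x0) ?oppr_ge0 ?(ltW m0).
Qed.

Lemma measurable_sq_powR D m : measurable_fun D (fun x : 'rV[R]_n => sq x `^ m).
Proof.
apply: (@measurableT_comp _ _ _ _ _ _ (@powR R ^~ m)).
  exact: measurable_powR.
exact: sq_measurable.
Qed.

(** Replaces polar coordinates: for m < 0 the function is at most a sum of multiples of indicators
    of the cubes [K k], whose measures decay like 2^(- n k). *)
Lemma powR_integrable m : - (n%:R / 2) < m ->
  (lebesgue_rV n).-integrable unit_ball (fun x => (sq x `^ m)%:E).
Proof.
have N0 : 0 < n%:R :> R by rewrite ltr0n.
wlog m0 : m / m < 0.
  move=> H nm; have [|m0] := ltP m 0; first by move=> /H; apply.
  apply: measurable_bounded_integrable => //.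
  - exact: unit_ball_lty.
  - exact: measurable_sq_powR.
  - exists 1; split=> // M M1 x; rewrite unit_ballE /= => x1.
    rewrite ger0_norm ?powR_ge0// (le_trans _ (ltW M1))//.
    have E : 1 `^ m = 1 :> R by rewrite powR1.
    by rewrite -[X in _ <= X]E ge0_ler_powR ?nnegrE ?sq_ge0// ltW.
move=> nm; apply/integrableP; split.
  by apply/measurable_EFinP; exact: measurable_sq_powR.
pose c k := (4^-1 ^+ k.+1) `^ m.
have c0 k : 0 <= c k by exact: powR_ge0.
have mK k : measurable (K k) by exact: box_measurable.
apply: (@le_lt_trans _ _ (\int[lebesgue_rV n]_(x in unit_ball)
    (\sum_(k <oo) (c k * \1_(K k) x)%:E))%E).
  apply: ge0_le_integral => //.
  - by apply: measurableT_comp => //; apply/measurable_EFinP; exact: measurable_sq_powR.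
  - apply: ge0_emeasurable_sum => [k x Bx _|k _].
      by rewrite lee_fin mulr_ge0.
    apply/measurable_EFinP; apply: measurable_funM => //.
  - move=> x Bx; have [k kx] := dyadic_cover m0 Bx.
    rewrite gee0_abs ?lee_fin ?powR_ge0//.
    apply: (@le_trans _ _ (c k * \1_(K k) x)%:E); first by rewrite lee_fin.
    rewrite (@nneseriesD1 _ _ k)//=; last by move=> *; rewrite lee_fin mulr_ge0.
    by rewrite leeDl// nneseries_ge0// => *; rewrite lee_fin mulr_ge0.
rewrite integral_nneseries//; last 2 first.
- by move=> k; apply/measurable_EFinP; apply: measurable_funM.
- by move=> k x _; rewrite lee_fin mulr_ge0.
(* The ratio 2^(- 2 m - n) of the resulting geometric series is less than 1 exactly when m > - n /
   2. *)
pose rho : R := 4^-1 `^ m * 2^-1 ^+ n.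
pose C : R := 4^-1 `^ m * 2 ^+ n.
have C0 : 0 <= C by rewrite mulr_ge0 ?powR_ge0 ?exprn_ge0.
have rho0 : 0 < rho by rewrite mulr_gt0 ?exprn_gt0 ?powR_gt0 ?invr_gt0.
have rho1 : rho < 1.
  rewrite /rho -powR_mulrn ?invr_ge0// (_ : 4^-1 = 2^-1 `^ 2 :> R); last first.
    by rewrite powR_mulrn ?invr_ge0//; field.
  have h0 : (0 : R) < 2^-1 by rewrite invr_gt0.
  rewrite -powRrM -gt0_powRD// /powR gt_eqF// -[X in _ < X]expR0 ltr_expR.
  rewrite nmulr_llt0; first by move: nm; lra.
  by rewrite ln_lt0// h0 /= invf_lt1// ltr1n.
have mu_le k : (\int[lebesgue_rV n]_(x in unit_ball) (c k * \1_(K k) x)%:E <=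
    (C * rho ^+ k)%:E)%E.
  under eq_integral do rewrite EFinM.
  rewrite ge0_integralZl//; [|by apply/measurable_EFinP|by rewrite lee_fin].
  rewrite integral_indic//.
  apply: (@le_trans _ _ ((c k)%:E * ((2 * 2^-1 ^+ k) ^+ n)%:E)%E).
    rewrite lee_wpmul2l ?lee_fin// -(box_measure n (exprn_ge0 k _))//.
    apply: le_measure; [|by rewrite inE; exact: mK|exact: subIsetl].
    by rewrite inE; apply: measurableI.
  rewrite -EFinM lee_fin /c /C /rho le_eqVlt; apply/orP; left; apply/eqP.
  have -> : (4^-1 ^+ k.+1 : R) `^ m = (4^-1 `^ m) ^+ k.+1.
    have q0 : (0 : R) <= 4^-1 by rewrite invr_ge0.
    by rewrite -(powR_mulrn k.+1 q0) -(powR_mulrn k.+1 (powR_ge0 _ _)) powRAC.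
  rewrite !exprMn exprS -!exprM [in (n * k)%N]mulnC; ring.
apply: (@le_lt_trans _ _ (C / (1 - rho))%:E); last exact: ltry.
apply: le_trans (lee_nneseries _ (fun k _ => mu_le k)) _.
  by move=> k _ _; apply: integral_ge0 => x _; rewrite lee_fin mulr_ge0.
apply: lime_le; first by apply: is_cvg_nneseries => k _ _; rewrite lee_fin mulr_ge0// exprn_ge0// ltW.
apply: nearW => N; rewrite sumEFin lee_fin.
have := @geometric_le_lim R N C rho; rewrite seriesEnat /=; apply=> //.
by rewrite ger0_norm// ltW.
Qed.

End power_integrable.

Lemma real_dominated_convergence d (T : measurableType d) (R : realType)
    (mu : {measure set T -> \bar R}) (D : set T) (f_ : nat -> T -> R) (f g : T -> R) :
  measurable D -> (forall k, measurable_fun D (f_ k)) -> measurable_fun D f ->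
  {ae mu, forall x, D x -> f_ k x @[k --> \oo] --> f x} ->
  mu.-integrable D (EFin \o g) ->
  {ae mu, forall x k, D x -> `|f_ k x| <= g x} ->
  [/\ mu.-integrable D (EFin \o f),
      (\int[mu]_(x in D) (`|f_ k x - f x|)%:E)%E @[k --> \oo] --> 0%E &
      (\int[mu]_(x in D) (f_ k x)%:E)%E @[k --> \oo] --> (\int[mu]_(x in D) (f x)%:E)%E].
Proof.
move=> mD mf_ mf cf ig fg.
have [] := @dominated_convergence _ T R mu D mD (fun k x => (f_ k x)%:E) (EFin \o f)
  (EFin \o g) _ _ _ ig _.
- by move=> k; apply/measurable_EFinP.
- by apply/measurable_EFinP.
- apply: filterS cf => x H Dx; apply/fine_cvgP; split; first exact: nearW.
  exact: H.
- by apply: filterS fg => x H k Dx; rewrite lee_fin; exact: H.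
by move=> *; split.
Qed.

Lemma ae_dominated_integrable d (T : measurableType d) (R : realType)
    (mu : {measure set T -> \bar R}) (D : set T) (f g : T -> R) :
  measurable D -> measurable_fun D f -> mu.-integrable D (EFin \o g) ->
  {ae mu, forall x, D x -> `|f x| <= g x} -> mu.-integrable D (EFin \o f).
Proof.
move=> mD mf ig fg; have [] // := @real_dominated_convergence _ T R mu D
  (fun=> f) f g mD (fun=> mf) mf _ ig _.
- by apply: aeW => x _; exact: cvg_cst.
- by apply: filterS fg => x + _; exact.
Qed.

(** * The divergence identity for radial fluxes *)

Section truncation.
Context {R : realType}.
Variable delta : R.
Hypothesis delta0 : 0 < delta.
Implicit Types y : R.

(* The flux m(|x|^2) |x|^-n x may be singular at 0; truncating m where it is
   small makes it vanish near 0. *)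
Definition trunc_slope y := clip (y / delta - 1).

Lemma trunc_slope_continuous : continuous trunc_slope.
Proof.
move=> y; apply: (@continuous_comp _ _ _ (fun y => y / delta - 1) clip).
  by apply: cvgB; [apply: cvgMl; exact: cvg_id|exact: cvg_cst].
exact: clip_continuous.
Qed.

Definition trunc : R -> R := prim trunc_slope.

Lemma is_derive_trunc y : is_derive y 1 trunc (trunc_slope y).
Proof. exact: is_derive_prim trunc_slope_continuous. Qed.

Lemma trunc_small y : 0 <= y -> y <= delta -> trunc y = 0.
Proof.
move=> y0 yd; rewrite -(prim0 trunc_slope).
apply: (@deriv_const _ trunc 0 y y0) => x /andP[x0 xy].
have := is_derive_trunc x; rewrite /trunc_slope clip_le0// subr_le0 ler_pdivrMr//.
by rewrite mul1r (le_trans xy).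
Qed.

Lemma trunc_bounds y : 0 <= y -> 0 <= trunc y <= y.
Proof.
move=> y0; apply/andP; split.
  rewrite -(prim0 trunc_slope); apply: (@ge0_deriv_le _ trunc trunc_slope) => //.
  - by move=> x _; exact: is_derive_trunc.
  - by move=> x _; exact: clip_ge0.
  - by apply: continuous_itvW => x _; exact: is_derive_continuous (is_derive_trunc x).
have := @deriv_le _ trunc (fun t => t) trunc_slope (fun=> 1) 0 y y0.
rewrite /trunc prim0 !subr0; apply.
- by move=> x _; exact: is_derive_trunc.
- by move=> x _; exact: clip_le1.
Qed.

Lemma trunc_slope_large y : 2 * delta <= y -> trunc_slope y = 1.
Proof.
move=> yd; rewrite /trunc_slope /clip min_r ?max_r//.
by rewrite lerBrDr ler_pdivlMr.
Qed.

Lemma trunc_ge y : 0 <= y -> y - 2 * delta <= trunc y.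
Proof.
move=> y0; have [yd|yd] := leP y (2 * delta).
  by have /andP[+ _] := trunc_bounds y0; lra.
have d0 : 0 <= trunc (2 * delta).
  have d2 : 0 <= 2 * delta by rewrite mulr_ge0// ltW.
  by have /andP[] := trunc_bounds d2.
have D : y - 2 * delta <= trunc y - trunc (2 * delta).
  apply: (@deriv_le _ (fun t => t) trunc (fun=> 1) trunc_slope) => //.
  - exact: ltW.
  - by move=> x _; exact: is_derive_trunc.
  - by move=> x /andP[/ltW/trunc_slope_large ->].
by lra.
Qed.

End truncation.

Section punctured.
Context {R : realType} {n : nat}.
Implicit Types (h : R -> R).

(** h may be singular at 0, so it is cut to ]0, 1[ and its single value at 0 is added back. *)
Lemma sq_comp_measurable h : (forall s, 0 < s < 1 -> {for s, continuous h}) ->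
  measurable_fun (@unit_ball R n) (fun x => h (sq x)).
Proof.
move=> ch; pose D := `]0%R, 1%R[%classic : set R.
have mD : measurable D by exact: measurable_itv.
pose pw (s : R) : R := (h \_ D) s + h 0 * (1 - \1_D s).
apply: (@eq_measurable_fun _ _ _ _ _ (fun x => pw (sq x))).
  move=> x; rewrite inE unit_ballE /= => x1; rewrite /pw patchE indicE.
  have := sq_ge0 x; rewrite le_eqVlt => /predU1P[x0|x0].
    by rewrite -x0 memNset ?subr0 ?mulr1 ?add0r// /D /= in_itv/= ltxx.
  by rewrite mem_set ?subrr ?mulr0 ?addr0// /D /= in_itv/= x0.
apply: (@measurableT_comp _ _ _ _ _ _ pw); last exact: sq_measurable.
apply: measurable_funD.
  apply/(measurable_restrictT _ mD).
  apply: open_continuous_measurable_fun; first exact: interval_open.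
  by move=> s; rewrite inE /D /= in_itv/=; exact: ch.
by apply: measurable_funM => //; apply: measurable_funB.
Qed.

Lemma origin_negligible : (0 < n)%N ->
  {ae lebesgue_rV n, forall x : 'rV[R]_n, 0 < sq x}.
Proof.
move=> n0; pose A := [set v : 'rV[R]_n | forall i, `[- 0, 0]%classic (v ord0 i)].
exists A; split; first exact: box_measurable.
  by have := @box_measure R n 0 (lexx 0); rewrite mulr0 expr0n gtn_eqF.
move=> x /= /negP; rewrite -leNgt => x0 i; rewrite /= in_itv/= -ler_norml.
rewrite -(ler_pXn2r (n := 2)) ?nnegrE//.
by rewrite real_normK ?num_real// expr0n/= (le_trans (sqr_coord_le x i)).
Qed.

End punctured.

(** Wider than [test_function]: it also accommodates smoothed absolute values, with their
    derivatives given explicitly. *)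
Definition C1_ball (R : realType) n (z : 'rV[R]_n -> R) (dz : 'I_n -> 'rV[R]_n -> R) :=
  [/\ continuous z, forall i, continuous (dz i),
      forall i x, is_derive x (delta_mx ord0 i) z (dz i x) &
      exists2 r : R, r < 1 & forall x, r <= sq x -> z x = 0].

Section flux_identity.
Context {R : realType} {n : nat} (m f : R -> R) (C eta : R).
Hypotheses (n0 : (0 < n)%N) (C0 : 0 <= C) (eta0 : 0 < eta).
Hypothesis dm : forall s : R, 0 < s < 1 -> is_derive s 1 m (2^-1 * s `^ (n%:R / 2 - 1) * f s).
Hypothesis fc : forall s : R, 0 < s < 1 -> {for s, continuous f}.
Hypothesis m_bound : forall s : R, 0 < s < 1 -> 0 < m s <= C * s `^ eta.
Hypothesis f_bound : forall s : R, 0 < s < 1 -> `|f s| <= C * s `^ (eta - n%:R / 2).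
Variables (z : 'rV[R]_n -> R) (dz : 'I_n -> 'rV[R]_n -> R).
Hypothesis z1 : C1_ball z dz.

Let N2 := n%:R / 2 : R.

Section fixed_delta.
Variable delta : R.
Hypothesis delta0 : 0 < delta.

(** The jump at s = 1 is invisible in what follows because z vanishes before the sphere is
    reached. *)
Let g (s : R) : R := if 0 < s < 1 then trunc delta (m s) * s `^ (- N2) else 0.
Let dg (s : R) : R := if 0 < s < 1 then
  trunc_slope delta (m s) * (2^-1 * s `^ (N2 - 1) * f s) * s `^ (- N2)
  - N2 * trunc delta (m s) * s `^ (- N2 - 1) else 0.

(** By [m_bound], m <= delta / 2 close to 0, so the truncated flux vanishes identically around the
    origin. *)
Let s0 : exists2 s0 : R, 0 < s0 & forall s : R, s < s0 -> g s = 0 /\ dg s = 0.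
Proof.
have C1 : 0 < C + 1 by rewrite ltr_wpDl.
exists (Num.min 1 ((delta / 2 / (C + 1)) `^ eta^-1)) => [|s].
  by rewrite lt_min ltr01 powR_gt0// !divr_gt0.
rewrite lt_min => /andP[s1 sd]; rewrite /g /dg; case: ifPn => // /andP[s_gt0 _].
have s01 : 0 < s < 1 by rewrite s_gt0.
have /andP[/ltW m0 mb] := m_bound s01.
have ms : m s <= delta / 2.
  apply: (le_trans mb).
  have : s `^ eta <= delta / 2 / (C + 1).
    rewrite [X in _ <= X](_ : _ = ((delta / 2 / (C + 1)) `^ eta^-1) `^ eta); last first.
      by rewrite -powRrM mulVf ?gt_eqF// powRr1// !divr_ge0// ltW.
    by rewrite ge0_ler_powR ?nnegrE ?powR_ge0 ?(ltW s_gt0) ?(ltW eta0) ?(ltW sd).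
  rewrite ler_pdivlMr// => H; apply: le_trans H; rewrite mulrDr mulr1 mulrC lerDl.
  exact: powR_ge0.
rewrite trunc_small//; last by lra.
rewrite /trunc_slope clip_le0; first by rewrite !mul0r mulr0 mul0r subrr.
by rewrite subr_le0 ler_pdivrMr// mul1r; lra.
Qed.

Let dgP (s : R) : s < 1 -> is_derive s 1 g (dg s).
Proof.
move=> s1; have [e e0 he] := s0.
have [se|se] := ltP s e.
  rewrite (he _ se).2; apply: (@near_eq_is_derive _ _ _ (cst 0)).
  by near=> t; rewrite (he t _).1//; near: t; exact: lt_nbhsl.
have sp : 0 < s by exact: lt_le_trans se.
have s01 : 0 < s < 1 by rewrite sp.
apply: (@near_eq_is_derive _ _ _ (fun t => trunc delta (m t) * t `^ (- N2))).
  near=> t; rewrite /g ifT//; apply/andP; split; near: t.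
    exact: lt_nbhsr.
  exact: lt_nbhsl.
have D1 := der_comp (is_derive_trunc delta (m s)) (dm s01).
have D2 := is_derive1_powR (- N2) sp.
apply: is_derive_eq (derM D1 D2) _.
by rewrite /dg s01 /N2; ring.
Unshelve. all: by end_near. Qed.

Let dg_continuous (s : R) : s < 1 -> {for s, continuous dg}.
Proof.
move=> s1; have [e e0 he] := s0.
have [se|se] := ltP s e.
  suff : dg t @[t --> s] --> dg s by [].
  rewrite (he _ se).2; apply: cvg_near_cst.
  by near=> t; rewrite (he t _).2//; near: t; exact: lt_nbhsl.
have sp : 0 < s by exact: lt_le_trans se.
have s01 : 0 < s < 1 by rewrite sp.
have cm : {for s, continuous m} := is_derive_continuous (dm s01).
have cp q : {for s, continuous (fun t : R => t `^ q)}.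
  exact: is_derive_continuous (is_derive1_powR q sp).
have ct : {for s, continuous (fun t => trunc delta (m t))}.
  apply: (@continuous_comp _ _ _ m (trunc delta)); first exact: cm.
  exact: is_derive_continuous (is_derive_trunc delta (m s)).
have cs : {for s, continuous (fun t => trunc_slope delta (m t))}.
  apply: (@continuous_comp _ _ _ m (trunc_slope delta)); first exact: cm.
  exact: trunc_slope_continuous.
have c : {for s, continuous (fun s => trunc_slope delta (m s) * (2^-1 * s `^ (N2 - 1) * f s) * s `^ (- N2)
  - N2 * trunc delta (m s) * s `^ (- N2 - 1))}.
  apply: cvgB; apply: cvgM; [|exact: cp| |exact: cp].
    apply: cvgM; first exact: cs.
    by apply: cvgM; [apply: cvgMr; exact: cp|exact: fc].
  by apply: cvgMr; exact: ct.
suff : dg t @[t --> s] --> dg s by [].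
rewrite [X in _ --> X](_ : _ = trunc_slope delta (m s) * (2^-1 * s `^ (N2 - 1) * f s) *
  s `^ (- N2) - N2 * trunc delta (m s) * s `^ (- N2 - 1)); last by rewrite /dg s01.
apply/(cvg_trans _ c)/near_eq_cvg; near=> t.
rewrite /dg ifT//; apply/andP; split; near: t.
  exact: lt_nbhsr.
exact: lt_nbhsl.
Unshelve. all: by end_near. Qed.

Let F (i : 'I_n) (x : 'rV[R]_n) : R := g (sq x) * x ord0 i * z x.
Let dF (i : 'I_n) (x : 'rV[R]_n) : R :=
  (2 * dg (sq x) * x ord0 i ^+ 2 + g (sq x)) * z x + g (sq x) * x ord0 i * dz i x.

Let dz0 i : exists2 r : R, r < 1 & forall x, r < sq x -> z x = 0 /\ dz i x = 0.
Proof.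
have [_ _ hz [r r1 zr]] := z1; exists r => // x rx; split; first by apply: zr; exact: ltW.
apply: (is_derive_uniq (hz i x)).
apply: (@near_eq_is_derive _ _ _ (cst 0)); near=> y; rewrite zr// ltW//.
by near: y; exact: (cvgr_gt _ (@edot_continuous R n x) _ rx).
Unshelve. all: by end_near. Qed.

Let hF i x : is_derive x (delta_mx ord0 i) (F i) (dF i x).
Proof.
have [_ _ hz _] := z1; have [r r1 zr] := dz0 i.
have [rx|xr] := ltP r (sq x).
  rewrite /dF (zr _ rx).1 (zr _ rx).2 !mulr0 addr0.
  apply: (@near_eq_is_derive _ _ _ (cst 0)); near=> y; rewrite /F (zr _ _).1 ?mulr0//.
  by near: y; exact: (cvgr_gt _ (@edot_continuous R n x) _ rx).
have x1 : sq x < 1 by exact: le_lt_trans r1.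
have D1 := is_derive_comp1 (dgP x1) (is_derive_sq x i).
apply: is_derive_eq (is_derive_prod (is_derive_prod D1 (is_derive_coord x i i)) (hz i x)) _.
by rewrite /dF eqxx /=; ring.
Unshelve. all: by end_near. Qed.

Let cdF i : continuous (dF i).
Proof.
move=> x; have FF : Filter (nbhs x) by exact: nbhs_filter.
have [cz cdz _ _] := z1; have [r r1 zr] := dz0 i.
have [rx|xr] := ltP r (sq x).
  suff : dF i y @[y --> x] --> dF i x by [].
  rewrite [X in _ --> X](_ : _ = 0); last by rewrite /dF (zr _ rx).1 (zr _ rx).2 !mulr0 addr0.
  apply: cvg_near_cst; near=> y; rewrite /dF (zr _ _).1 ?(zr _ _).2 ?mulr0 ?addr0//;
    near: y; exact: (cvgr_gt _ (@edot_continuous R n x) _ rx).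
have x1 : sq x < 1 by exact: le_lt_trans r1.
have cg : {for x, continuous (fun y => g (sq y))}.
  apply: (@continuous_comp _ _ _ sq g); first exact: edot_continuous.
  exact: is_derive_continuous (dgP x1).
have cdg : {for x, continuous (fun y => dg (sq y))}.
  apply: (@continuous_comp _ _ _ sq dg); first exact: edot_continuous.
  exact: dg_continuous.
have cx := @coord_cvg R n i x.
apply: cvgD; apply: cvgM; [|exact: cz| |exact: cdz].
  apply: cvgD; last exact: cg.
  by apply: cvgM; [apply: cvgMr; exact: cdg|apply: cvgM; exact: cx].
by apply: cvgM; [exact: cg|exact: cx].
Unshelve. all: by end_near. Qed.

Let F0 i : supported_in_box 1 (F i).
Proof.
move=> x j xj; rewrite /F /g ifF ?mul0r//; apply/negbTE.
rewrite negb_and -!leNgt; apply/orP; right.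
apply: le_trans (sqr_coord_le x j); rewrite -real_normK ?num_real//.
by rewrite expr_ge1// ltW.
Qed.

(** Off the origin the integrand is the divergence of the C^1 field g(|x|^2) z x, whose components
    are [F i]. Since |x|^-n x is divergence free there, only the derivative of the truncated m
    survives next to the gradient of z. *)
Lemma truncated_flux_identity :
  (\int[lebesgue_rV n]_(x in @unit_ball R n) ((trunc_slope delta (m (sq x)) * f (sq x) * z x
    + trunc delta (m (sq x)) * sq x `^ (- N2) * \sum_(i < n) x ord0 i * dz i x))%:E = 0)%E.
Proof.
have I i := continuous_box_integrable (@cdF i) (supported_in_box_derive (@hF i) (@F0 i)) ler01.
have S0 : (\int[lebesgue_rV n]_x (\sum_(i < n) (dF i x)%:E) = 0)%E.
  rewrite integral_sum//.
  by apply: big1 => i _; exact: (integral_partial_eq0 ltr01 (@hF i) (@cdF i) (@F0 i)).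
rewrite -[RHS]S0.
transitivity (\int[lebesgue_rV n]_(x in unit_ball) (\sum_(i < n) (dF i x)%:E))%E.
  apply: ae_eq_integral => //.
  - exact: unit_ball_measurable.
  - apply/measurable_EFinP; apply: measurable_funD; apply: measurable_funM.
    + apply: (@sq_comp_measurable R n (fun s => trunc_slope delta (m s) * f s)) => s s01.
      apply: cvgM; last exact: fc.
      apply: (@continuous_comp _ _ _ m (trunc_slope delta)).
        exact: is_derive_continuous (dm s01).
      exact: trunc_slope_continuous.
    + by apply: measurable_funTS; apply: continuous_rV_measurable; case: z1.
    + apply: (@sq_comp_measurable R n (fun s => trunc delta (m s) * s `^ (- N2))) => s s01.
      apply: cvgM; last first.
        by case/andP: s01 => sp _; exact: is_derive_continuous (is_derive1_powR (- N2) sp).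
      apply: (@continuous_comp _ _ _ m (trunc delta)).
        exact: is_derive_continuous (dm s01).
      exact: is_derive_continuous (is_derive_trunc delta (m s)).
    + apply: measurable_sum => i; apply: measurable_funM; apply: measurable_funTS.
        exact: measurable_coord.
      by apply: continuous_rV_measurable; case: z1.
  - apply: measurable_funTS; apply: emeasurable_sum => i; apply/measurable_EFinP.
    by apply: continuous_rV_measurable; exact: cdF.
  - apply: filterS (@origin_negligible R n n0) => x x0; rewrite unit_ballE /= => x1.
    rewrite sumEFin; congr EFin; rewrite /dF big_split/= -mulr_suml big_split/=.
    rewrite -mulr_sumr sumr_const card_ord.
    rewrite [X in _ = _ + X](_ : _ = g (sq x) * \sum_(i < n) x ord0 i * dz i x); last first.
      by rewrite mulr_sumr; apply: eq_bigr => i _; rewrite mulrA.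
    have s01 : 0 < sq x < 1 by rewrite x0.
    have -> : \sum_(i < n) x ord0 i ^+ 2 = sq x.
      by rewrite /sq /edot; apply: eq_bigr => i _; rewrite expr2.
    rewrite /g /dg s01; congr (_ * _ + _).
    have pE : 2^-1 * sq x `^ (N2 - 1) * f (sq x) * sq x `^ (- N2) * sq x = 2^-1 * f (sq x).
      rewrite !gt0_powRD// powR_inv1 ?ltW// powRN.
      by field; rewrite !gt_eqF// powR_gt0.
    have p1 : sq x `^ (- N2 - 1) * sq x = sq x `^ (- N2).
      by rewrite gt0_powRD// powR_inv1 ?(ltW x0)// divfK// gt_eqF.
    rewrite -[X in _ = _ + X]mulr_natr.
    transitivity (2 * (trunc_slope delta (m (sq x)) *
        (2^-1 * sq x `^ (N2 - 1) * f (sq x) * sq x `^ (- N2) * sq x)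
        - N2 * trunc delta (m (sq x)) * (sq x `^ (- N2 - 1) * sq x))
      + trunc delta (m (sq x)) * sq x `^ (- N2) * n%:R).
      by rewrite pE p1 /N2; field.
    by ring.
rewrite [LHS]integral_mkcond; apply: eq_integral => x _; rewrite patchE.
case: ifPn => //; rewrite notin_setE unit_ballE /= => /negP; rewrite -leNgt => x1.
rewrite sumEFin; congr EFin; apply/esym/big1 => i _.
have gx : g (sq x) = 0 by rewrite /g (ltNge (sq x)) x1 andbF.
have dgx : dg (sq x) = 0 by rewrite /dg (ltNge (sq x)) x1 andbF.
by rewrite /dF gx dgx; ring.
Qed.

End fixed_delta.

Let mB := @unit_ball_measurable R n.

Let etaN : - N2 < eta - N2. Proof. by rewrite ltrDr. Qed.

Let zM : exists2 M, 0 <= M & forall x, `|z x| <= M /\ forall i, `|dz i x| <= M.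
Proof.
have [cz cdz hz [r r1 zr]] := z1.
have z0 : supported_in_box 1 z.
  move=> x j xj; apply: zr; apply: (le_trans (ltW r1)).
  apply: le_trans (sqr_coord_le x j); rewrite -real_normK ?num_real//.
  by rewrite expr_ge1// ltW.
have [M M0 hM] := continuous_box_bounded cz z0.
have dM i := continuous_box_bounded (cdz i) (supported_in_box_derive (hz i) z0).
have /choice[D hD] : forall i, exists D : R, 0 <= D /\ forall x, `|dz i x| <= D.
  by move=> i; have [D] := dM i; exists D.
have S0 : 0 <= \sum_(i < n) D i by apply: sumr_ge0 => i _; case: (hD i).
exists (M + \sum_(i < n) D i) => [|x]; first exact: addr_ge0.
split=> [|i]; first by rewrite (le_trans (hM x))// lerDl.
apply: le_trans ((hD i).2 x) _; rewrite (bigD1 i)//= addrCA lerDl addr_ge0//.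
by apply: sumr_ge0 => j _; case: (hD j).
Qed.

Let fz_measurable : measurable_fun unit_ball (fun x : 'rV[R]_n => f (sq x) * z x).
Proof.
apply: measurable_funM; first exact: sq_comp_measurable.
by apply: measurable_funTS; apply: continuous_rV_measurable; case: z1.
Qed.

Let sum_measurable : measurable_fun unit_ball
  (fun x : 'rV[R]_n => \sum_(i < n) x ord0 i * dz i x).
Proof.
apply: measurable_sum => i; apply: measurable_funM; apply: measurable_funTS.
  exact: measurable_coord.
by apply: continuous_rV_measurable; case: z1.
Qed.

Let my_measurable : measurable_fun unit_ball (fun x : 'rV[R]_n =>
  m (sq x) * sq x `^ (- N2) * \sum_(i < n) x ord0 i * dz i x).
Proof.
apply: measurable_funM sum_measurable.
apply: (@sq_comp_measurable R n (fun s => m s * s `^ (- N2))) => s s01.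
apply: cvgM; first exact: is_derive_continuous (dm s01).
by case/andP: s01 => sp _; exact: is_derive_continuous (is_derive1_powR (- N2) sp).
Qed.

(** Stated for every t in [0, m], so that one bound serves both the truncated and the full flux. *)
Let part_bounds : exists2 M, 0 <= M & forall x : 'rV[R]_n, 0 < sq x < 1 ->
  forall t, 0 <= t <= m (sq x) ->
  `|f (sq x) * z x| <= M * sq x `^ (eta - N2) /\
  `|t * sq x `^ (- N2) * \sum_(i < n) x ord0 i * dz i x| <= M * sq x `^ (eta - N2).
Proof.
have [M M0 hM] := zM; exists (C * M * (n%:R + 1)).
  by rewrite !mulr_ge0// addr_ge0.
move=> x x01 t /andP[t0 tm]; have /andP[x0 x1] := x01.
have P0 : 0 <= sq x `^ (eta - N2) by exact: powR_ge0.
have CM : 0 <= C * M * sq x `^ (eta - N2) by rewrite !mulr_ge0.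
have nR : 0 <= n%:R :> R by [].
split.
  rewrite normrM; apply: le_trans (ler_pM (normr_ge0 _) (normr_ge0 _) (f_bound x01) (hM x).1) _.
  rewrite [X in X <= _](_ : _ = C * M * sq x `^ (eta - N2)); last by ring.
  rewrite [X in _ <= X](_ : _ = C * M * sq x `^ (eta - N2) * (n%:R + 1)); last by ring.
  by rewrite ler_peMr// lerDr.
rewrite normrM.
have S : `|\sum_(i < n) x ord0 i * dz i x| <= n%:R * M.
  apply: le_trans (ler_norm_sum _ _ _) _.
  rewrite -[n in n%:R]card_ord mulr_natl -sumr_const; apply: ler_sum => i _.
  rewrite normrM -[M]mul1r; apply: ler_pM => //; last exact: (hM x).2.
  by rewrite ltW// coord_lt// expr1n.
have T : `|t * sq x `^ (- N2)| <= C * sq x `^ (eta - N2).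
  rewrite ger0_norm ?mulr_ge0 ?powR_ge0// gt0_powRD// mulrA ler_wpM2r ?powR_ge0//.
  by apply: le_trans tm _; case/andP: (m_bound x01).
apply: le_trans (ler_pM (normr_ge0 _) (normr_ge0 _) T S) _.
rewrite [X in X <= _](_ : _ = C * M * sq x `^ (eta - N2) * n%:R); last by ring.
rewrite [X in _ <= X](_ : _ = C * M * sq x `^ (eta - N2) * (n%:R + 1)); last by ring.
by rewrite ler_wpM2l// lerDl.
Qed.

(** Green's formula for the field m(|x|^2) |x|^-n x, whose divergence is f(|x|^2). The truncation is
    removed by dominated convergence: both terms are at most a multiple of |x|^(2 eta - n),
    integrable because eta > 0. *)
Lemma flux_identity :
  [/\ (lebesgue_rV n).-integrable unit_ball (fun x : 'rV[R]_n => (f (sq x) * z x)%:E),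
      (lebesgue_rV n).-integrable unit_ball (fun x : 'rV[R]_n =>
        (m (sq x) * sq x `^ (- N2) * \sum_(i < n) x ord0 i * dz i x)%:E) &
  (\int[lebesgue_rV n]_(x in unit_ball)
     (m (sq x) * sq x `^ (- N2) * \sum_(i < n) x ord0 i * dz i x)%:E =
   - \int[lebesgue_rV n]_(x in unit_ball) (f (sq x) * z x)%:E)%E].
Proof.
have [M M0 hM] := part_bounds.
have ae01 : {ae lebesgue_rV n, forall x : 'rV[R]_n, unit_ball x -> 0 < sq x < 1}.
  apply: filterS (@origin_negligible R n n0) => x x0; rewrite unit_ballE /= => x1.
  by rewrite x0.
pose d (k : nat) : R := k.+1%:R^-1.
have d0 k : 0 < d k by rewrite invr_gt0.
pose h k (x : 'rV[R]_n) := trunc_slope (d k) (m (sq x)) * f (sq x) * z x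
    + trunc (d k) (m (sq x)) * sq x `^ (- N2) * \sum_(i < n) x ord0 i * dz i x.
pose h0 (x : 'rV[R]_n) := f (sq x) * z x
    + m (sq x) * sq x `^ (- N2) * \sum_(i < n) x ord0 i * dz i x.
have iP : (lebesgue_rV n).-integrable unit_ball
    (fun x : 'rV[R]_n => (2 * M * sq x `^ (eta - N2))%:E).
  under eq_fun do rewrite EFinM.
  by apply: integrableZl => //; exact: powR_integrable.
have d_cvg : d k @[k --> \oo] --> (0 : R) by exact: cvg_harmonic.
have [] := @real_dominated_convergence _ _ R (lebesgue_rV n) unit_ball h h0
  (fun x => 2 * M * sq x `^ (eta - N2)) mB _ _ _ iP _.
- move=> k; apply: measurable_funD.
    apply: measurable_funM.
      apply: (@sq_comp_measurable R n (fun s => trunc_slope (d k) (m s) * f s)) => s s01.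
      apply: cvgM; last exact: fc.
      apply: (@continuous_comp _ _ _ m (trunc_slope (d k))).
        exact: is_derive_continuous (dm s01).
      exact: trunc_slope_continuous.
    by apply: measurable_funTS; apply: continuous_rV_measurable; case: z1.
  apply: measurable_funM sum_measurable.
  apply: (@sq_comp_measurable R n (fun s => trunc (d k) (m s) * s `^ (- N2))) => s s01.
  apply: cvgM; last first.
    by case/andP: s01 => sp _; exact: is_derive_continuous (is_derive1_powR (- N2) sp).
  apply: (@continuous_comp _ _ _ m (trunc (d k))).
    exact: is_derive_continuous (dm s01).
  exact: is_derive_continuous (is_derive_trunc (d k) (m s)).
- exact: measurable_funD.
- apply: filterS ae01 => x x01 /x01 {}x01.
  have /andP[mx _] := m_bound x01.
  have m2 : \forall k \near \oo, 2 * d k <= m (sq x).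
    have : \forall k \near \oo, `|0 - d k| <= m (sq x) / 2.
      by apply: (cvgrPdist_le _ _).1 d_cvg _ _; rewrite divr_gt0.
    by apply: filterS => k; rewrite sub0r normrN ger0_norm ?(ltW (d0 k))// ler_pdivlMr// mulrC.
  apply: cvgD.
    apply: cvgM; last exact: cvg_cst.
    apply: cvg_near_cst; apply: filterS m2 => k mk.
    by rewrite trunc_slope_large// mul1r.
  apply: cvgM; last exact: cvg_cst.
  apply: cvgM; last exact: cvg_cst.
  apply/cvgrPdist_le => e e0.
  have : \forall k \near \oo, `|0 - d k| <= e / 2.
    by apply: (cvgrPdist_le _ _).1 d_cvg _ _; rewrite divr_gt0.
  apply: filterS => k; rewrite sub0r normrN ger0_norm ?(ltW (d0 k))// => dk.
  have /andP[t0 t1] := trunc_bounds (d k) (ltW mx).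
  by have := trunc_ge (d0 k) (ltW mx); rewrite ger0_norm ?subr_ge0//; lra.
- apply: filterS ae01 => x x01 k /x01 {}x01.
  have /andP[/ltW mx _] := m_bound x01.
  have [b1 b2] := hM x x01 _ (trunc_bounds (d k) mx).
  rewrite -[2 * M * _]mulrA mulr_natl mulr2n; apply: le_trans (ler_normD _ _) _.
  apply: lerD => //; apply: le_trans b1; rewrite -mulrA normrM ler_piMl//.
  by rewrite ger0_norm ?clip_ge0// clip_le1.
move=> ih _ hcvg.
have bound x : unit_ball x -> 0 < sq x < 1 ->
    `|f (sq x) * z x| <= 2 * M * sq x `^ (eta - N2) /\
    `|m (sq x) * sq x `^ (- N2) * \sum_(i < n) x ord0 i * dz i x|
      <= 2 * M * sq x `^ (eta - N2).
  move=> _ x01; have /andP[/ltW mx _] := m_bound x01.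
  have [b1 b2] := hM x x01 (m (sq x)) (introT andP (conj mx (lexx _))).
  have p0 : 0 <= M * sq x `^ (eta - N2) by rewrite mulr_ge0// powR_ge0.
  rewrite (_ : 2 * M * sq x `^ (eta - N2) = M * sq x `^ (eta - N2) + M * sq x `^ (eta - N2)); last by ring.
  by split; [apply: le_trans b1 _|apply: le_trans b2 _]; rewrite lerDl.
have i1 : (lebesgue_rV n).-integrable unit_ball (fun x : 'rV[R]_n => (f (sq x) * z x)%:E).
  apply: (ae_dominated_integrable mB fz_measurable iP).
  by apply: filterS ae01 => x x01 Bx; exact: (bound x Bx (x01 Bx)).1.
have i2 : (lebesgue_rV n).-integrable unit_ball (fun x : 'rV[R]_n =>
        (m (sq x) * sq x `^ (- N2) * \sum_(i < n) x ord0 i * dz i x)%:E).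
  apply: (ae_dominated_integrable mB my_measurable iP).
  by apply: filterS ae01 => x x01 Bx; exact: (bound x Bx (x01 Bx)).2.
split=> //.
have E0 : (\int[lebesgue_rV n]_(x in unit_ball) (h0 x)%:E = 0)%E.
  apply/esym/(cvg_unique _ _ hcvg) => //.
  rewrite (_ : (fun k => _) = cst 0%E); first exact: cvg_cst.
  by apply/funext => k; exact: (truncated_flux_identity (d0 k)).
move: E0; rewrite /h0; under eq_integral do rewrite EFinD.
rewrite integralD//= => E0.
have f1 := integrable_fin_num mB i1; have f2 := integrable_fin_num mB i2.
move: E0 f1 f2; case: integral => [r| |] //; case: integral => [r'| |] //= + _ _.
by move=> [] rr; congr EFin; apply/eqP; rewrite -addr_eq0 addrC rr.
Qed.

End flux_identity.

(** * Smooth approximation of radial profiles *)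

Section smooth_functions_R.
Context {R : realType}.
Implicit Types (f g : R -> R) (k : nat) (x : R).

Fixpoint Cn k f : Prop :=
  if k is k'.+1 then exists2 f', forall x, is_derive x 1 f (f' x) & Cn k' f'
  else continuous f.

Lemma Cn_continuous k f : Cn k f -> continuous f.
Proof.
case: k => [//|k] [f' df _] x; exact: is_derive_continuous (df x).
Qed.

Lemma CnW k f : Cn k.+1 f -> Cn k f.
Proof.
elim: k f => [f /Cn_continuous //|k IH f [f' df /IH cf']].
by exists f'.
Qed.

Lemma Cn_cst k (c : R) : Cn k (fun=> c).
Proof.
elim: k c => [|k IH] c /=; first by move=> x; exact: cvg_cst.
by exists (fun=> 0) => [x|]; [exact: der_cst|exact: IH].
Qed.

Lemma CnD k f g : Cn k f -> Cn k g -> Cn k (fun x => f x + g x).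
Proof.
elim: k f g => [f g cf cg x|k IH f g [f' df cf] [g' dg cg]].
  by apply: cvgD; [exact: cf|exact: cg].
by exists (fun x => f' x + g' x) => [x|]; [exact: derD|exact: IH].
Qed.

Lemma CnM k f g : Cn k f -> Cn k g -> Cn k (fun x => f x * g x).
Proof.
elim: k f g => [f g cf cg x|k IH f g Hf Hg].
  by apply: cvgM; [exact: cf|exact: cg].
have := CnW Hf; have := CnW Hg; case: Hf Hg => [f' df cf'] [g' dg cg'] cg cf.
exists (fun x => f' x * g x + f x * g' x) => [x|]; first exact: derM.
by apply: CnD; exact: IH.
Qed.

Lemma Cn_affine k (a b : R) : Cn k (fun x => a * x + b).
Proof.
case: k => [x|k].
  by apply: cvgD; [apply: cvgMr; exact: cvg_id|exact: cvg_cst].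
exists (fun=> a) => [x|]; last exact: Cn_cst.
by eapply is_derive_eq; [der|rewrite /=; ring].
Qed.

Lemma Cn_comp k f g : Cn k f -> Cn k g -> Cn k (fun x => f (g x)).
Proof.
elim: k f g => [f g cf cg x|k IH f g Hf Hg].
  by apply: (@continuous_comp _ _ _ g f); [exact: cg|exact: cf].
have := CnW Hg; case: Hf Hg => [f' df cf'] [g' dg cg'] cg.
exists (fun x => f' (g x) * g' x) => [x|]; first exact: der_comp.
by apply: CnM => //; exact: IH.
Qed.

Lemma Cn_prim k f : Cn k f -> Cn k (prim f).
Proof.
move=> cf; have c := Cn_continuous cf; apply: CnW.
by exists f => // x; exact: is_derive_prim.
Qed.

Lemma Cn_sum k (I : Type) (r : seq I) (F : I -> R -> R) :
  (forall i, Cn k (F i)) -> Cn k (fun x => \sum_(i <- r) F i x).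
Proof.
move=> cF; elim: r => [|i r IH].
  by rewrite (_ : (fun _ => _) = fun=> 0); [exact: Cn_cst|apply/funext => x; rewrite big_nil].
rewrite (_ : (fun _ => _) = fun x => F i x + \sum_(j <- r) F j x).
  exact: CnD.
by apply/funext => x; rewrite big_cons.
Qed.

(* x^-j exp(-1/x), extended by 0: its derivative is a combination of the
   functions of the same family with exponents j + 1 and j + 2. *)
Definition flat j x : R := if 0 < x then x^-1 ^+ j * expR (- x^-1) else 0.

(** From e^y >= y^(j+2) / (j+2)! at y = 1 / x. A quadratic bound forces the derivative at the origin
    to be 0, for every j. *)
Lemma flat_bound j x : `|flat j x| <= (j.+2)`!%:R * x ^+ 2.
Proof.
rewrite /flat; case: ifPn => [x0|_]; last first.
  by rewrite normr0 mulr_ge0// sqr_ge0.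
have y0 : 0 < x^-1 by rewrite invr_gt0.
rewrite ger0_norm ?mulr_ge0 ?expR_ge0 ?exprn_ge0 ?(ltW y0)//.
rewrite expRN ler_pdivrMr ?expR_gt0//.
have := @expR_ge1Dxn R x^-1 j.+1 (ltW y0).
set F := (j.+2)`!%:R : R; have F0 : 0 < F by rewrite ltr0n fact_gt0.
move=> /(le_trans _)-/(_ (x^-1 ^+ j.+2 / F)); rewrite lerDr ler01 => /(_ isT).
rewrite ler_pdivrMr// => H.
have -> : x^-1 ^+ j = x ^+ 2 * x^-1 ^+ j.+2.
  by rewrite !exprS expr0; field; rewrite gt_eqF.
rewrite (_ : _ * expR _ = x ^+ 2 * (expR x^-1 * F)); last by ring.
by rewrite ler_wpM2l// sqr_ge0.
Qed.

Lemma is_derive_flat0 f (K : R) : 0 <= K -> (forall x, `|f x| <= K * x ^+ 2) ->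
  is_derive (0 : R) 1 f 0.
Proof.
move=> K0 fK.
have f0 : f 0 = 0.
  by apply/eqP; rewrite -normr_le0; have := fK 0; rewrite expr0n/= mulr0.
suff c : (fun h => h^-1 *: (f (h *: 1 + 0) - f 0)) h @[h --> 0^'] --> (0 : R).
  by apply: DeriveDef; [apply/cvg_ex; exists 0|exact: cvg_lim c].
apply/cvgrPdist_le => e e0.
have K1 : 0 < K + 1 by rewrite ltr_wpDl.
near=> h; rewrite f0 subr0 addr0 sub0r normrN /GRing.scale/= mulr1 normrM normfV.
have h0 : h != 0 by near: h; exact: nbhs_dnbhs_neq.
have nh : 0 < `|h| by rewrite normr_gt0.
rewrite mulrC ler_pdivrMr//; apply: le_trans (fK h) _.
have he : `|h| <= e / (K + 1).
  by near: h; apply: dnbhs0_le; rewrite divr_gt0.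
rewrite -real_normK ?num_real// expr2 mulrA ler_wpM2r//.
move: he; rewrite ler_pdivlMr//; have := ltW nh; nra.
Unshelve. all: by end_near. Qed.

Lemma is_derive_flat j x :
  is_derive x 1 (flat j) (- j%:R * flat j.+1 x + flat j.+2 x).
Proof.
have [x0|x0|->] := ltgtP x 0.
- rewrite {2 3}/flat !ltNge !(ltW x0)/= mulr0 addr0.
  apply: (@near_eq_is_derive _ _ _ (cst 0)); near=> y.
  by rewrite /flat ltNge ifF//; apply/negbF; near: y; exact: lt_le_nbhsl.
- apply: (@near_eq_is_derive _ _ _ (fun y : R => y^-1 ^+ j * expR (- y^-1))).
    by near=> y; rewrite /flat ifT//; near: y; exact: lt_nbhsr.
  rewrite /flat x0; have xn0 : x != 0 by rewrite gt_eqF.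
  case: j => [|j].
    rewrite (_ : (fun _ => _) = fun y : R => expR (- y^-1)); last first.
      by apply/funext => y; rewrite expr0 mul1r.
    eapply is_derive_eq; [der; exact: xn0|].
    by rewrite /= expr1 !exprS expr0; field.
  eapply is_derive_eq; [der; exact: xn0|].
  by rewrite /= !exprS; field.
- rewrite /flat ltxx mulr0 addr0 -/(flat j).
  by apply: (is_derive_flat0 _ (flat_bound j)).
Unshelve. all: by end_near. Qed.

Lemma Cn_flat k j : Cn k (flat j).
Proof.
elim: k j => [j x|k IH j]; first exact: is_derive_continuous (is_derive_flat j x).
exists (fun x => - j%:R * flat j.+1 x + flat j.+2 x) => [x|]; first exact: is_derive_flat.
by apply: CnD => //; apply: CnM => //; exact: Cn_cst.
Qed.

Let bump x := flat 0 x * flat 0 (- 1 * x + 1).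

Let Cn_bump k : Cn k bump.
Proof. by apply: CnM; [exact: Cn_flat|apply: Cn_comp; [exact: Cn_flat|exact: Cn_affine]]. Qed.

Let bump_ge0 x : 0 <= bump x.
Proof.
by rewrite /bump /flat; do 2 case: ifP => _; rewrite ?(mul0r, mulr0)// !expr0 !mul1r mulr_ge0// expR_ge0.
Qed.

Let dbump x : is_derive x 1 (prim bump) (bump x).
Proof. by apply: is_derive_prim; exact: (Cn_continuous (Cn_bump 0)). Qed.

Let bump1 : 0 < prim bump 1.
Proof.
have [|c] := @MVT _ (prim bump) bump 0 1 ltr01 (fun x _ => dbump x).
  by apply: continuous_itvW => x _; exact: is_derive_continuous (dbump x).
rewrite in_itv/= => /andP[c0 c1]; rewrite prim0 !subr0 mulr1 => ->.
rewrite /bump /flat c0 ifT; last by lra.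
by rewrite !expr0 !mul1r mulr_gt0// expR_gt0.
Qed.

(** H is the normalised primitive of a bump that vanishes outside ]0, 1[. *)
Lemma smooth_step : exists H : R -> R, [/\ forall k, Cn k H,
  forall x, x <= 0 -> H x = 0, forall x, 1 <= x -> H x = 1 &
  forall x, 0 <= H x <= 1].
Proof.
have H0 x : x <= 0 -> prim bump x = 0.
  move=> x0; rewrite -(prim0 bump); apply/esym.
  apply: (@deriv_const _ (prim bump) x 0 x0) => y /andP[_ y0].
  by have := dbump y; rewrite {2}/bump {1}/flat ltNge y0 mul0r.
have H1 x : 1 <= x -> prim bump x = prim bump 1.
  move=> x1; apply: (@deriv_const _ (prim bump) 1 x x1) => y /andP[y1 _].
  have := dbump y; rewrite {2}/bump {2}/flat ltNge.
  by rewrite (_ : - 1 * y + 1 <= 0) ?mulr0//; lra.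
have Hm x y : x <= y -> prim bump x <= prim bump y.
  move=> xy; apply: (@ge0_deriv_le _ (prim bump) bump) => //.
  by apply: continuous_itvW => z _; exact: is_derive_continuous (dbump z).
exists (fun x => prim bump x * (prim bump 1)^-1); split=> [k|x x0|x x1|x].
- by apply: CnM; [apply: Cn_prim; exact: Cn_bump|exact: Cn_cst].
- by rewrite H0// mul0r.
- by rewrite H1// divff// gt_eqF.
- rewrite -/(_ / _) ler_pdivrMr// mul1r; apply/andP; split.
    rewrite divr_ge0 ?(ltW bump1)//; have [x0|/ltW x0] := leP x 0; first by rewrite H0.
    by rewrite -(prim0 bump); exact: Hm.
  have [x1|/ltW x1] := leP x 1; first exact: Hm.
  by rewrite H1.
Qed.

End smooth_functions_R.

Section smooth_truncation.
Context {R : realType}.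
Implicit Types (D : R -> R) (s : R).

Lemma powR_le_scale (p r x : R) : p <= 0 -> 0 < r -> r <= x -> x `^ p <= r `^ p.
Proof.
move=> p0 r0 rx; have x0 : 0 < x by exact: lt_le_trans rx.
rewrite -(opprK p) !(powRN _ (- p)) lef_pV2 ?posrE ?powR_gt0//.
by apply: ge0_ler_powR; rewrite ?nnegrE ?(ltW r0) ?(ltW x0)// oppr_ge0.
Qed.

Variables (H : R -> R).
Hypothesis (CH : forall k, Cn k H) (H_le0 : forall x, x <= 0 -> H x = 0)
  (H_ge1 : forall x, 1 <= x -> H x = 1) (H01 : forall x, 0 <= H x <= 1).

(* A staircase interpolating D at the points j / K, with smooth risers, which
   is 0 near both ends of [0, 1]. *)
Let knot D K j : R := if (1 < j)%N && (j.+1 < K)%N then D (j%:R / K%:R) else 0.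

Let stair D K s : R :=
  \sum_(i <- index_iota 0 K) (knot D K i.+1 - knot D K i) * H (K%:R * s + - i%:R).

Let stair_Cn D K j : Cn j (stair D K).
Proof.
apply: Cn_sum => i; apply: CnM; first exact: Cn_cst.
by apply: Cn_comp => //; exact: Cn_affine.
Qed.

(** On the j-th cell the risers before j are complete and telescope to the j-th knot, those after j
    have not started, and only the j-th is under way. *)
Let stairE D K s j : (j < K)%N -> j%:R <= K%:R * s <= j.+1%:R ->
  stair D K s = knot D K j + (knot D K j.+1 - knot D K j) * H (K%:R * s + - j%:R).
Proof.
move=> jK /andP[js sj]; rewrite /stair.
rewrite (@big_cat_nat _ _ _ j 0 K) ?(ltnW jK)//= (@big_ltn _ _ _ j K)// [X in _ + (_ + X)]big_nat_cond.
rewrite [X in _ + (_ + X)]big1 ?addr0 => [|i]; last first.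
  rewrite andbT => /andP[ji iK]; rewrite H_le0 ?mulr0// subr_le0.
  by apply: le_trans sj _; rewrite ler_nat.
congr (_ + _); rewrite big_nat_cond (eq_bigr (fun i => knot D K i.+1 - knot D K i)).
  by rewrite -big_nat_cond telescope_sumr//{2}/knot subr0.
move=> i; rewrite andbT => /= ij; rewrite H_ge1 ?mulr1//.
by rewrite lerBrDl natr1; apply: le_trans js; rewrite ler_nat.
Qed.

Let cell K s : (0 < K)%N -> 0 < s -> s < 1 ->
  exists2 j, (j < K)%N & j%:R <= K%:R * s <= j.+1%:R.
Proof.
move=> K0 s0 s1; have Ks0 : 0 <= K%:R * s by rewrite mulr_ge0 ?(ltW s0).
have /andP[tl /ltW tr] := truncn_itv Ks0.
exists (Num.trunc (K%:R * s)); last by rewrite tl tr.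
rewrite -(@ltr_nat R); apply: le_lt_trans tl _.
by rewrite gtr_pMr ?ltr0n.
Qed.

Let convex_norm_le (x y t M : R) : `|x| <= M -> `|y| <= M -> 0 <= t <= 1 ->
  `|x + (y - x) * t| <= M.
Proof.
rewrite !ler_norml => /andP[? ?] /andP[? ?] /andP[? ?]; apply/andP; split; nra.
Qed.

(** On each cell the staircase is a convex combination of neighbouring knots, so that bounds and
    pointwise convergence pass from D to it; the vanishing knots provide the flat ends. *)
Lemma smooth_truncation D (C e : R) : e <= 1 ->
  (forall s, 0 < s < 1 -> {for s, continuous D}) ->
  (forall s, 0 < s < 1 -> `|D s| <= C * s `^ (e - 1)) ->
  exists theta : nat -> R -> R,
    [/\ forall k j, Cn j (theta k),
        forall k, exists2 r, 0 < r & forall s, s <= r -> theta k s = 0,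
        forall k, exists2 r, r < 1 & forall s, r <= s -> theta k s = 0,
        forall k s, 0 < s < 1 -> `|theta k s| <= C * 2^-1 `^ (e - 1) * s `^ (e - 1) &
        forall s, 0 < s < 1 -> theta k s @[k --> \oo] --> D s].
Proof.
move=> e1 cD bD; exists (fun k => stair D k.+1).
have knot0 K : knot D K 0 = 0 by [].
have knot1 K : knot D K 1 = 0 by [].
have knotK K : knot D K K = 0 by rewrite /knot [X in _ && X]ltnNge leqnSn andbF.
have knotK1 K : knot D K.+1 K = 0 by rewrite /knot ltnn andbF.
split=> [k j|k|k|k s /andP[s0 s1]|s /andP[s0 s1]].
- exact: stair_Cn.
- have k0 : 0 < k.+1%:R :> R by rewrite ltr0n.
  exists (k.+1%:R)^-1 => [|s sk]; first by rewrite invr_gt0.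
  have {}sk : k.+1%:R * s <= 1 by rewrite mulrC -ler_pdivlMr// div1r.
  rewrite /stair big_ltn// knot0 knot1 subrr mul0r add0r big_nat_cond big1// => i.
  rewrite andbT => /andP[i0 _]; rewrite H_le0 ?mulr0// subr_le0.
  by apply: le_trans sk _; rewrite ler1n.
- have k0 : 0 < k.+1%:R :> R by rewrite ltr0n.
  exists (k%:R / k.+1%:R) => [|s]; first by rewrite ltr_pdivrMr// mul1r ltr_nat.
  rewrite ler_pdivrMr// mulrC => ks.
  rewrite /stair big_nat_recr//= knotK knotK1 subrr mul0r addr0 big_nat_cond.
  rewrite (eq_bigr (fun i => knot D k.+1 i.+1 - knot D k.+1 i)).
    by rewrite -big_nat_cond telescope_sumr// knotK1 knot0 subr0.
  move=> i; rewrite andbT => /= ik; rewrite H_ge1 ?mulr1// lerBrDl natr1.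
  by apply: le_trans ks; rewrite ler_nat.
- have k0 : 0 < k.+1%:R :> R by rewrite ltr0n.
  have [j jk /andP[js sj]] := cell (ltn0Sn k) s0 s1.
  rewrite (stairE _ jk) ?js//.
  have C0 : 0 <= C.
    by have := bD _ (_ : 0 < s < 1); rewrite s0 s1 => /(_ isT)/(le_trans (normr_ge0 _)); rewrite pmulr_lge0 ?powR_gt0.
  (* A nonzero knot i that matters for s satisfies i / (k + 1) >= s / 2, and the exponent e - 1 is
     nonpositive: hence the factor (1/2)^(e-1). *)
  have knot_le i : (1 < i)%N -> j.+1%:R <= 2 * i%:R :> R ->
      `|knot D k.+1 i| <= C * 2^-1 `^ (e - 1) * s `^ (e - 1).
    move=> i1 ji; rewrite /knot i1/=; case: ifPn => ik; last first.
      by rewrite normr0 !mulr_ge0 ?powR_ge0.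
    have i0 : 0 < i%:R :> R by rewrite ltr0n (ltn_trans _ i1).
    apply: le_trans (bD _ _) _.
      by rewrite divr_gt0//= ltr_pdivrMr// mul1r ltr_nat ltnW.
    rewrite -mulrA -powRM ?invr_ge0// ?(ltW s0)// ler_wpM2l//.
    apply: powR_le_scale; [by rewrite subr_le0|by rewrite mulr_gt0// invr_gt0|].
    rewrite ler_pdivlMr//; lra.
  apply: convex_norm_le => //.
    case: j jk js sj knot_le => [|[|j]] jk js sj knot_le.
    + by rewrite knot0 normr0 !mulr_ge0 ?powR_ge0.
    + by rewrite knot1 normr0 !mulr_ge0 ?powR_ge0.
    + by apply: knot_le => //; rewrite -natrM ler_nat ltn_Pmull.
  case: j jk js sj knot_le => [|j] jk js sj knot_le.
  + by rewrite knot1 normr0 !mulr_ge0 ?powR_ge0.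
  + by apply: knot_le => //; rewrite -natrM ler_nat mul2n -addnn leq_addr.
- apply/cvgrPdist_le => eps eps0.
  have := cD s; rewrite s0 s1 => /(_ isT) /cvgrPdist_le /(_ _ eps0).
  rewrite near_simpl => /nbhs_ballP[del /= del0 Dd].
  have m0 : 0 < Num.min del (Num.min (s / 3) ((1 - s) / 3)).
    by rewrite !lt_min del0 !divr_gt0// subr_gt0.
  near=> k.
  have : k.+1%:R^-1 < Num.min del (Num.min (s / 3) ((1 - s) / 3)).
    by near: k; exact: (near_infty_natSinv_lt (PosNum m0)).
  have k0 : 0 < k.+1%:R :> R by rewrite ltr0n.
  have up (x : R) : k.+1%:R^-1 < x -> 1 < x * k.+1%:R.
    by move=> kx; rewrite -[X in X < _](mulVf (lt0r_neq0 k0)) ltr_pM2r.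
  rewrite !lt_min => /and3P[/up kd /up ks /up ks'].
  have [j jk /andP[js sj]] := cell (ltn0Sn k) s0 s1.
  rewrite (stairE _ jk) ?js//.
  set K := k.+1%:R : R in k0 kd ks ks' js sj *.
  have j2 : (1 < j)%N by rewrite -(@ltr_nat R); move: sj; rewrite -natr1; lra.
  have jk2 : (j.+3 <= k.+1)%N.
    by rewrite -(@ler_nat R) -/K; move: js; rewrite -!natr1; lra.
  have -> : knot D k.+1 j = D (j%:R / K) by rewrite /knot j2 ltnW.
  have -> : knot D k.+1 j.+1 = D (j.+1%:R / K) by rewrite /knot jk2 ltnW.
  have near_knot i : (`|K * s - i%:R| <= 1) -> `|D s - D (i%:R / K)| <= eps.
    move=> Ki; apply: Dd; rewrite /ball /= -(@ltr_pM2l _ K)// -[X in X * `|_|]ger0_norm ?(ltW k0)//.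
    rewrite -normrM mulrBr (_ : K * (i%:R / K) = i%:R); last first.
      by rewrite mulrC divfK// gt_eqF.
    by apply: le_lt_trans Ki _; rewrite mulrC.
  (* The error is a convex combination of the errors at the two neighbouring knots. *)
  rewrite (_ : D s - _ = (D s - D (j%:R / K)) +
    ((D s - D (j.+1%:R / K)) - (D s - D (j%:R / K))) * H (K * s + - j%:R)); last by ring.
  by apply: convex_norm_le => //; apply: near_knot; rewrite ler_norml; move: js sj;
    rewrite -natr1 => *; apply/andP; split; lra.
Unshelve. all: by end_near. Qed.

End smooth_truncation.

Section smooth_functions_rV.
Context {R : realType} {n : nat}.
Implicit Types (F G : 'rV[R]_n -> R) (k : nat) (x : 'rV[R]_n).

Let continuous_rVD F G : continuous F -> continuous G ->
  continuous (fun x => F x + G x).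
Proof.
move=> cF cG x; have FF : Filter (nbhs x) by exact: nbhs_filter.
by apply: cvgD; [exact: cF|exact: cG].
Qed.

Let continuous_rVM F G : continuous F -> continuous G ->
  continuous (fun x => F x * G x).
Proof.
move=> cF cG x; have FF : Filter (nbhs x) by exact: nbhs_filter.
by apply: cvgM; [exact: cF|exact: cG].
Qed.

Fixpoint CN k F : Prop := continuous F /\
  if k is k'.+1 then forall i, exists2 F',
    forall x, is_derive x (delta_mx ord0 i) F (F' x) & CN k' F'
  else True.

Lemma CN_continuous k F : CN k F -> continuous F.
Proof. by case: k => [|k] []. Qed.

Lemma CNW k F : CN k.+1 F -> CN k F.
Proof.
elim: k F => [F [cF _]//|k IH F [cF dF]]; split=> // i.
by have [F' dF' /IH] := dF i; exists F'.
Qed.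

Lemma CN_cst k (c : R) : CN k (fun=> c).
Proof.
elim: k c => [|k IH] c; split=> //; try exact: cst_continuous.
by move=> i; exists (fun=> 0) => // x; exact: is_derive_cst.
Qed.

Lemma CN_coord k (j : 'I_n) : CN k (fun x => x ord0 j).
Proof.
case: k => [|k]; split=> //; try exact: coord_cvg.
move=> i; exists (fun=> (j == i)%:R) => [x|]; last exact: CN_cst.
exact: is_derive_coord.
Qed.

Lemma CND k F G : CN k F -> CN k G -> CN k (fun x => F x + G x).
Proof.
elim: k F G => [|k IH] F G [cF dF] [cG dG]; split=> //;
  try exact: continuous_rVD.
move=> i; have [F' dF' cF'] := dF i; have [G' dG' cG'] := dG i.
by exists (fun x => F' x + G' x) => [x|]; [exact: is_deriveD|exact: IH].
Qed.

Lemma CNM k F G : CN k F -> CN k G -> CN k (fun x => F x * G x).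
Proof.
elim: k F G => [|k IH] F G HF HG; (split;
  first by apply: continuous_rVM; [exact: (CN_continuous HF)|exact: (CN_continuous HG)]) => //.
move=> i; have [_ /(_ i)[F' dF' cF']] := HF; have [_ /(_ i)[G' dG' cG']] := HG.
exists (fun x => F' x * G x + F x * G' x) => [x|]; first exact: is_derive_prod.
by apply: CND; apply: IH => //; exact: CNW.
Qed.

Lemma CN_sq k (g : R -> R) : Cn k g -> CN k (fun x => g (sq x)).
Proof.
elim: k g => [|k IH] g cg; (split;
  first by move=> x; apply: (@continuous_comp _ _ _ sq g);
    [exact: edot_continuous|exact: (Cn_continuous cg)]) => //.
move=> i; case: cg => g' dg cg'.
exists (fun x => g' (sq x) * (2 * x ord0 i)) => [x|].
  by apply: is_derive_comp1 => //; exact: is_derive_sq.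
apply: CNM; first exact: IH.
by apply: CNM; [exact: CN_cst|exact: CN_coord].
Qed.

Lemma partialE (i : 'I_n) F dF : (forall x, is_derive x (delta_mx ord0 i) F (dF x)) ->
  partial i F = dF.
Proof. by move=> dFP; apply/funext => x; rewrite /partial; have [_ ->] := dFP x. Qed.

Lemma CN_smooth F : (forall k, CN k F) -> smooth F.
Proof.
move=> cF s; have /(_ 1%N) : forall k, CN k (foldr partial F s).
  elim: s => [|i s IH] k //=.
  by have [_ /(_ i)[F' dF' cF']] := IH k.+1; rewrite (partialE dF').
case=> cF1 dF1; split=> // i x.
by have [F' /(_ x)[]] := dF1 i.
Qed.

Lemma smooth_is_derive F i x : smooth F ->
  is_derive x (delta_mx ord0 i) F (partial i F x).
Proof. by move=> /(_ [::])[_ /(_ i x) dF]; exact: DeriveDef. Qed.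

Lemma radial_test_function (g : R -> R) : (forall k, Cn k g) ->
  (exists2 r, r < 1 & forall s, r <= s -> g s = 0) ->
  test_function unit_ball (fun x => g (sq x)).
Proof.
move=> cg [r r1 g0].
have sub : closure [set x : 'rV[R]_n | g (sq x) != 0] `<=` [set x | sq x <= r].
  have cA : closed [set x : 'rV[R]_n | sq x <= r].
    apply: (closed_comp (f := sq) (D := [set s : R | s <= r])) => [x _|].
      exact: edot_continuous.
    exact: closed_le.
  rewrite [X in _ `<=` X]((closure_id _).1 cA).
  apply: closure_subset => x /=; apply: contraNT; rewrite -ltNge => /ltW /g0 ->.
  by rewrite eqxx.
split; first by apply: CN_smooth => k; exact: CN_sq.
  apply: bounded_closed_compact; last exact: closed_closure.
  exists 1; split; first exact: num_real.
  move=> M M1 x /sub /= xr; apply/ltW/(le_lt_trans _ M1).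
  rewrite [leLHS]mx_normrE; apply: bigmax_le => // -[i j] _ /=.
  rewrite ord1; apply/ltW/coord_lt => //; rewrite expr1n.
  exact: le_lt_trans xr r1.
by rewrite unit_ballE => x /sub /= xr; exact: le_lt_trans xr r1.
Qed.

(** |x|^2 has a maximum r < 1 on the compact support. The radius (r + 1) / 2 leaves a margin, since
    [C1_ball] asks for vanishing already at the radius itself. *)
Lemma test_function_C1 F : test_function unit_ball F ->
  C1_ball F (fun i => partial i F).
Proof.
case=> sF; set K := closure _ => cK KB.
have [r r1 Kr] : exists2 r : R, r < 1 & forall x, K x -> sq x <= r.
  have [K0|/set0P K0] := eqVneq K set0.
    by exists 0 => // x; rewrite K0.
  have [|x0 Kx0 x0P] := @compact_EVT_max _ _ (@sq R n) K K0 cK.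
    by apply: continuous_subspaceT; exact: edot_continuous.
  exists (sq x0); last by move=> x Kx; apply: x0P; rewrite inE.
  by have := KB x0; rewrite unit_ballE => /=; apply; move: Kx0; rewrite inE.
have cF : continuous F by have [] := sF [::].
split=> // [i|i x|].
- by have [] := sF [:: i].
- exact: smooth_is_derive.
- exists ((r + 1) / 2) => [|x rx]; first by lra.
  apply/eqP; apply: contraT => Fx.
  have : sq x <= r by apply: Kr; exact: subset_closure.
  by move: rx r1; lra.
Qed.

End smooth_functions_rV.

Lemma measurable_fun_rV (R : realType) d (T : measurableType d) n (D : set T)
    (f : T -> 'rV[R]_n) : measurable D ->
  (forall i, measurable_fun D (fun x => f x ord0 i)) -> measurable_fun D f.
Proof.
move=> mD mf; pose g x : 'rV[R]_n := \row_i ((fun x => f x ord0 i) \_ D) x.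
have mg : measurable_fun setT g.
  apply: measurable_rV => i.
  rewrite (_ : (fun _ => _) = (fun x => f x ord0 i) \_ D).
    by apply/(measurable_restrictT _ mD).
  by apply/funext => x; rewrite mxE.
apply: eq_measurable_fun (measurable_funTS mg) => x Dx.
by apply/rowP => i; rewrite mxE patchE Dx.
Qed.

(** * Radial profiles as elements of the completion *)

Section radial_profile_line.
Context {R : realType}.
Implicit Types (f F U D : R -> R).

Lemma integral_derive f F (s t : R) : s < t ->
  (forall x : R, s <= x <= t -> is_derive x 1 F (f x)) ->
  (forall x, s <= x <= t -> {for x, continuous f}) ->
  (\int[lebesgue_measure]_(x in `[s, t]) (f x)%:E = (F t - F s)%:E)%E.
Proof.
move=> st dF cf; rewrite (@continuous_FTC2 _ f F s t)//.
- by apply: continuous_itvW => x; exact: cf.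
- have cF (x : R) : s <= x <= t -> {for x, continuous F}.
    by move=> xst; exact: is_derive_continuous (dF x xst).
  split=> [x||].
  + by rewrite in_itv/= => /andP[sx xt]; have [] := dF x; rewrite ?(ltW sx) ?(ltW xt).
  + by apply: cvg_at_right_filter; apply: cF; rewrite lexx ltW.
  + by apply: cvg_at_left_filter; apply: cF; rewrite lexx ltW.
- move=> x; rewrite in_itv/= => /andP[sx xt]; rewrite derive1E.
  by have [] := dF x; rewrite ?(ltW sx) ?(ltW xt).
Qed.

(** The two sides are minus the integrals over [s, 1] of [theta k] and of D; there the bound M x^p
    is at most the constant M s^p, which dominates. *)
Lemma primitive_cvg U D (theta : nat -> R -> R) (M p : R) : p <= 0 ->
  (forall s : R, 0 < s <= 1 -> is_derive s 1 U (D s)) ->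
  (forall s, 0 < s <= 1 -> {for s, continuous D}) ->
  (forall k, continuous (theta k)) ->
  (forall k s, 0 < s < 1 -> `|theta k s| <= M * s `^ p) ->
  (forall s, 0 < s < 1 -> theta k s @[k --> \oo] --> D s) ->
  forall s, 0 < s < 1 ->
    prim (theta k) s - prim (theta k) 1 @[k --> \oo] --> U s - U 1.
Proof.
move=> p0 dU cD ct bt ct' s /andP[s0 s1].
have M0 : 0 <= M.
  have := bt 0%N s; rewrite s0 s1 => /(_ isT)/(le_trans (normr_ge0 _)).
  by rewrite pmulr_lge0 ?powR_gt0.
have s01 x : s <= x <= 1 -> 0 < x <= 1.
  by move=> /andP[sx ->]; rewrite (lt_le_trans s0 sx).
have ae1 : {ae (@lebesgue_measure R), forall x, x != 1}.
  exists [set 1]; split; [exact: measurable_set1|exact: lebesgue_measure_set1|].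
  by move=> x /= /negP; rewrite negbK => /eqP.
have FM : Filter (nbhs (almost_everywhere (@lebesgue_measure R))).
  exact: ae_filter_ringOfSetsType.
have [||||||_ _ cvI] := @real_dominated_convergence _ _ R lebesgue_measure `[s, 1]%classic
  theta D (fun=> M * s `^ p).
- by [].
- by move=> k; apply: measurable_funTS; exact: continuous_measurable_fun.
- apply: subspace_continuous_measurable_fun => //.
  by apply: continuous_itvW => x /s01; exact: cD.
- apply: filterS ae1 => x x1; rewrite /= in_itv/= => /andP[sx x1'].
  by apply: ct'; rewrite (lt_le_trans s0 sx) lt_neqAle x1.
- by apply: continuous_itv_integrable; exact: cst_continuous.
- apply: filterS ae1 => x x1 k; rewrite /= in_itv/= => /andP[sx x1'].
  apply: le_trans (bt _ _ _) _.
    by rewrite (lt_le_trans s0 sx) lt_neqAle x1.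
  by rewrite ler_wpM2l// powR_le_scale.
have IU : (\int[lebesgue_measure]_(x in `[s, 1%R]) (D x)%:E = (U 1 - U s)%:E)%E.
  by apply: integral_derive => // x /s01; [exact: dU|exact: cD].
move: cvI; rewrite IU.
rewrite (_ : (fun k => _) = fun k => (prim (theta k) 1 - prim (theta k) s)%:E).
  move=> /fine_cvgP[_ cv].
  rewrite -[U s - U 1]opprB; under eq_cvg do rewrite -opprB.
  exact: cvgN cv.
apply/funext => k; apply: integral_derive => // x _; last exact: ct.
exact: is_derive_prim.
Unshelve. all: by end_near. Qed.

End radial_profile_line.

Section radial_profile.
Context {R : realType} {n : nat}.
Variables (a C e : R) (U D : R -> R).
Hypotheses (n0 : (0 < n)%N) (e1 : e <= 1) (ea : - (n%:R / 2) < 2 * e - 1 - a).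
Hypothesis dU : forall s : R, 0 < s <= 1 -> is_derive s 1 U (D s).
Hypothesis cD : forall s : R, 0 < s <= 1 -> {for s, continuous D}.
Hypothesis bD : forall s : R, 0 < s <= 1 -> `|D s| <= C * s `^ (e - 1).
Hypothesis U1 : U 1 = 0.

Definition radial_grad (x : 'rV[R]_n) : 'rV[R]_n := (2 * D (sq x)) *: x.

Let mB := @unit_ball_measurable R n.

Let lt01 (s : R) : 0 < s < 1 -> 0 < s <= 1.
Proof. by move=> /andP[-> /ltW ->]. Qed.

Let coord_measurable i A : measurable_fun A (fun x : 'rV[R]_n => x ord0 i).
Proof. by apply: measurable_funTS; exact: measurable_coord. Qed.

Lemma radial_grad_measurable : measurable_fun unit_ball radial_grad.
Proof.
apply: measurable_fun_rV => // i.
rewrite (_ : (fun _ => _) = fun x : 'rV[R]_n => (2 * D (sq x)) * x ord0 i); last first.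
  by apply/funext => x; rewrite mxE.
apply: measurable_funM => //; apply: measurable_funM => //.
by apply: (@sq_comp_measurable _ _ D) => s /lt01; exact: cD.
Qed.

Lemma edotZ (t u : R) (x y : 'rV[R]_n) : edot (t *: x) (u *: y) = t * u * edot x y.
Proof. by rewrite /edot mulr_sumr; apply: eq_bigr => i _; rewrite !mxE; ring. Qed.

(** The approximants are the primitives, vanishing near the sphere, of the smooth truncations of D.
    The weighted squared gradient error is dominated by a multiple of (|x|^2)^(2 e - 1 - a),
    integrable by [ea]. *)
Lemma radial_profile_D12_grad : D12_grad a unit_ball (fun x => U (sq x)) radial_grad.
Proof.
split=> //; first by apply: (@sq_comp_measurable _ _ U) => s /lt01/dU; exact: is_derive_continuous.
  exact: radial_grad_measurable.
have [H [CH H0 H1 H01]] := @smooth_step R.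
have [theta [Ct t0 t1 bt ct]] := @smooth_truncation _ H CH H0 H1 H01 D C e e1
  (fun s s01 => cD (lt01 s01)) (fun s s01 => bD (lt01 s01)).
set C2 := C * 2^-1 `^ (e - 1) in bt.
pose psi k s := prim (theta k) s - prim (theta k) 1.
have dpsi k (s : R) : is_derive s 1 (psi k) (theta k s).
  eapply is_derive_eq.
    apply: is_deriveB; apply: is_derive_prim; exact: (Cn_continuous (Ct k 0%N)).
  by rewrite subr0.
have Cpsi k j : Cn j (psi k) by apply: CnW; exists (theta k).
have psi1 k : exists2 r, r < 1 & forall s, r <= s -> psi k s = 0.
  have [r r1 tr] := t1 k; exists r => // s rs; rewrite /psi.
  have H' (u v : R) : r <= u -> u <= v -> prim (theta k) v = prim (theta k) u.
    move=> ru uv; apply: deriv_const => // x /andP[ux _].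
    rewrite -(tr x (le_trans ru ux)); apply: is_derive_prim; exact: (Cn_continuous (Ct k 0%N)).
  have [s1|/ltW s1] := leP s 1; first by rewrite (H' s 1)// subrr.
  by rewrite (H' 1 s) ?subrr// ltW.
have test k : test_function unit_ball (fun x : 'rV[R]_n => psi k (sq x)).
  exact: radial_test_function.
exists (fun k x => psi k (sq x)); split=> //; last first.
  apply: filterS (@origin_negligible R n n0) => x x0; rewrite unit_ballE /= => x1.
  rewrite -[U _]subr0 -U1; apply: (@primitive_cvg _ U D theta C2 (e - 1)); rewrite ?x0//.
  - by rewrite subr_le0.
  - by move=> k; exact: (Cn_continuous (Ct k 0%N)).
have gradE k x : grad (fun x : 'rV[R]_n => psi k (sq x)) x = (2 * theta k (sq x)) *: x.
  apply/rowP => i; rewrite !mxE.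
  have -> : partial i (fun x : 'rV[R]_n => psi k (sq x)) =
      (fun x : 'rV[R]_n => theta k (sq x) * (2 * x ord0 i)).
    by apply: partialE => y; apply: is_derive_comp1 => //; exact: is_derive_sq.
  by ring.
pose I k (x : 'rV[R]_n) := 4 * (theta k (sq x) - D (sq x)) ^+ 2 * (sq x `^ (- a) * sq x).
have -> : (fun k => let E x := grad (fun x : 'rV[R]_n => psi k (sq x)) x - radial_grad x in
    pairing a unit_ball E E) = (fun k => \int[lebesgue_rV n]_(x in unit_ball) (I k x)%:E)%E.
  apply/funext => k /=; apply: eq_integral => x _; congr EFin.
  rewrite gradE /radial_grad -scalerBl edotZ enorm_powR /I -/(sq x).
  by rewrite (_ : - (2 * a) / 2 = - a); [ring|field].
have iP : (lebesgue_rV n).-integrable unit_ball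
    (fun x : 'rV[R]_n => (4 * (C2 + C) ^+ 2 * sq x `^ (2 * e - 1 - a))%:E).
  under eq_fun do rewrite EFinM.
  by apply: integrableZl => //; exact: powR_integrable.
have [||||||_ _ ] := @real_dominated_convergence _ _ R (lebesgue_rV n) unit_ball
  I (cst 0) (fun x => 4 * (C2 + C) ^+ 2 * sq x `^ (2 * e - 1 - a)) => //.
- move=> k; apply: measurable_funM; last first.
    apply: measurable_funM; [exact: measurable_sq_powR|exact: sq_measurable].
  apply: measurable_funM => //; apply: measurable_funX.
  apply: (@sq_comp_measurable _ _ (fun s => theta k s - D s)) => s s01.
  by apply: cvgB; [exact: (Cn_continuous (Ct k 0%N))|exact: (cD (lt01 s01))].
- apply: filterS (@origin_negligible R n n0) => x x0; rewrite unit_ballE /= => x1.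
  have cI : I k x @[k --> \oo] -->
      4 * (D (sq x) - D (sq x)) ^+ 2 * (sq x `^ (- a) * sq x).
    apply: cvgMl; apply: cvgMr; apply: cvgM;
    by apply: cvgB; [apply: ct; rewrite x0|exact: cvg_cst].
  by move: cI; rewrite subrr expr0n mulr0 mul0r.
- apply: filterS (@origin_negligible R n n0) => x x0 k; rewrite unit_ballE /= => x1.
  have x01 : 0 < sq x < 1 by rewrite x0.
  rewrite /I ger0_norm; last first.
    apply: mulr_ge0; first by apply: mulr_ge0 => //; exact: sqr_ge0.
    by rewrite mulr_ge0 ?powR_ge0 ?(ltW x0).
  have b : `|theta k (sq x) - D (sq x)| <= (C2 + C) * sq x `^ (e - 1).
    by rewrite mulrDl; apply: le_trans (ler_normB _ _) _; apply: lerD;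
      [exact: bt|apply: bD; exact: lt01].
  have sE : sq x `^ (2 * e - 1 - a) = (sq x `^ (e - 1)) ^+ 2 * (sq x `^ (- a) * sq x).
    rewrite -[X in _ * (_ * X)](powRr1 (ltW x0)) expr2 -!gt0_powRD//.
    by congr (_ `^ _); ring.
  rewrite sE (_ : 4 * (C2 + C) ^+ 2 * _ =
    4 * ((C2 + C) * sq x `^ (e - 1)) ^+ 2 * (sq x `^ (- a) * sq x)); last by ring.
  rewrite ler_wpM2r ?mulr_ge0 ?powR_ge0 ?(ltW x0)// ler_wpM2l//.
  rewrite -real_normK ?num_real// lerXn2r ?nnegrE//.
  exact: le_trans (normr_ge0 _) b.
- by rewrite (_ : (\int[lebesgue_rV n]_(x in unit_ball) (cst 0 x)%:E = 0)%E)//; exact: integral0_eq.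
Qed.

End radial_profile.

(** * The weak formulation *)

Section integration.
Context d (T : measurableType d) (R : realType) (mu : {measure set T -> \bar R}).
Variables (D : set T) (mD : measurable D).
Implicit Types (h : T -> R).

Lemma ge0_lty_integrable h : measurable_fun D h -> (forall x, D x -> 0 <= h x) ->
  (\int[mu]_(x in D) (h x)%:E < +oo)%E -> mu.-integrable D (EFin \o h).
Proof.
move=> mh h0 hoo; apply/integrableP; split; first exact/measurable_EFinP.
rewrite (eq_integral (fun x => (h x)%:E)) => [//|x]; rewrite inE => Dx /=.
by rewrite ger0_norm ?h0.
Qed.

Lemma fatou_le (h_ : nat -> T -> R) h (M : R) :
  (forall k, measurable_fun D (h_ k)) -> measurable_fun D h ->
  (forall k x, D x -> 0 <= h_ k x) -> (forall x, D x -> 0 <= h x) ->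
  {ae mu, forall x, D x -> h_ k x @[k --> \oo] --> h x} ->
  (forall k, \int[mu]_(x in D) (h_ k x)%:E <= M%:E)%E ->
  (\int[mu]_(x in D) (h x)%:E <= M%:E)%E.
Proof.
move=> mh_ mh h_0 h0 cvh hM.
have mE k : measurable_fun D (fun x => (h_ k x)%:E) by exact/measurable_EFinP.
have := @fatou _ T R mu D mD (fun k x => (h_ k x)%:E) mE _.
move=> /(_ (fun k x Dx => h_0 k x Dx)) F.
have -> : (\int[mu]_(x in D) (h x)%:E =
    \int[mu]_(x in D) limn_einf (fun k => (h_ k x)%:E))%E.
  apply: ae_eq_integral => //; first exact/measurable_EFinP.
    apply: (measurableT_comp (@oppe_measurable R setT)).
    by apply: measurable_fun_limn_esup => k; exact: (measurableT_comp (@oppe_measurable R setT)).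
  apply: filterS cvh => x cx Dx; apply/esym.
  apply: (cvg_limn_einf_sup _).1; apply: cvg_EFin; first exact: nearW.
  exact: cx.
apply: le_trans F _; rewrite limn_einf_lim; apply: lime_le; first exact: is_cvg_einfs.
by apply: nearW => k; apply: le_trans (hM k); apply: ereal_inf_lbound; exists k => /=.
Qed.

End integration.

Section edot_theory.
Context {R : realType} {n : nat}.
Implicit Types (x y z : 'rV[R]_n) (t : R).

Lemma edotDr x y z : edot x (y + z) = edot x y + edot x z.
Proof. by rewrite /edot -big_split; apply: eq_bigr => i _; rewrite mxE mulrDr. Qed.

Lemma edotNr x y : edot x (- y) = - edot x y.
Proof. by rewrite /edot -sumrN; apply: eq_bigr => i _; rewrite mxE mulrN. Qed.

Lemma edot_young x y t : 0 < t ->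
  `|edot x y| <= t * edot x x + t^-1 * edot y y.
Proof.
move=> t0; apply: le_trans (ler_norm_sum _ _ _) _.
rewrite /edot !mulr_sumr -big_split /=; apply: ler_sum => i _.
set u := x _ _; set v := y _ _.
rewrite -[leRHS](_ : (t * (t * u ^+ 2) + v ^+ 2) / t = _); last by field; rewrite gt_eqF.
rewrite ler_pdivlMr// normrM.
have := sqr_ge0 (t * `|u| - `|v|); rewrite sqrrB.
rewrite exprMn !real_normK ?num_real// => H.
have := sqr_ge0 (t * u); have := sqr_ge0 v; rewrite exprMn.
by move: H; rewrite -subr_ge0; set p := `|u|; set r := `|v|; lra.
Qed.

Lemma edot_sub_le x y : edot (x - y) (x - y) <= 2 * edot x x + 2 * edot y y.
Proof.
rewrite /edot !mulr_sumr -big_split /=; apply: ler_sum => i _; rewrite !mxE.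
by have := sqr_ge0 (x ord0 i + y ord0 i); rewrite sqrrD; lra.
Qed.

Lemma edot_measurable (D : set 'rV[R]_n) (F G : 'rV[R]_n -> 'rV[R]_n) :
  measurable_fun D F -> measurable_fun D G ->
  measurable_fun D (fun x => edot (F x) (G x)).
Proof.
move=> mF mG; apply: measurable_sum => i.
by apply: measurable_funM; apply: (measurableT_comp (@measurable_coord R n i)).
Qed.

End edot_theory.

Section smooth_abs.
Context {R : realType}.
Variable eps : R.
Hypothesis eps0 : 0 < eps.
Implicit Types y : R.

(** A C^1 substitute for |y| that vanishes at 0, so that supports are kept, is at least |y| - eps,
    and has slope at most 1, so that the energy does not increase. *)
Definition smooth_abs y := Num.sqrt (y ^+ 2 + eps ^+ 2) - eps.
Definition smooth_sgn y := y / Num.sqrt (y ^+ 2 + eps ^+ 2).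

Let q0 y : 0 < y ^+ 2 + eps ^+ 2.
Proof. by rewrite ltr_wpDl ?sqr_ge0// exprn_gt0. Qed.

Let r0 y : 0 < Num.sqrt (y ^+ 2 + eps ^+ 2).
Proof. by rewrite sqrtr_gt0. Qed.

Lemma smooth_abs0 : smooth_abs 0 = 0.
Proof. by rewrite /smooth_abs expr0n add0r sqrtr_sqr gtr0_norm// subrr. Qed.

Lemma smooth_abs_ge y : `|y| - eps <= smooth_abs y.
Proof. by rewrite lerD2r -sqrtr_sqr ler_wsqrtr// lerDl sqr_ge0. Qed.

Lemma smooth_sgn_le1 y : smooth_sgn y ^+ 2 <= 1.
Proof.
rewrite /smooth_sgn expr_div_n sqr_sqrtr ?(ltW (q0 y))// ler_pdivrMr// mul1r.
by rewrite lerDl sqr_ge0.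
Qed.

Lemma is_derive_smooth_abs y : is_derive y 1 smooth_abs (smooth_sgn y).
Proof.
rewrite /smooth_abs; eapply is_derive_eq.
  eapply derD; last exact: der_cst.
  eapply (der_comp (f := Num.sqrt) (g := fun y : R => y ^+ 2 + eps ^+ 2)); first exact: is_derive1_sqrt.
  by der.
by rewrite /= /smooth_sgn; field; rewrite gt_eqF.
Qed.

Lemma smooth_sgn_continuous : continuous smooth_sgn.
Proof.
move=> y; apply: cvgM; first exact: cvg_id.
apply: cvgV; first by rewrite gt_eqF.
apply: (@continuous_comp _ _ _ (fun y => y ^+ 2 + eps ^+ 2) Num.sqrt).
  by apply: cvgD; [apply: exprn_continuous|exact: cvg_cst].
exact: sqrt_continuous.
Qed.

End smooth_abs.

Section weak_form.
Context {R : realType} {n : nat}.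
Variables (a C e eta : R) (D m f : R -> R).
Hypotheses (n0 : (0 < n)%N) (C0 : 0 <= C) (ea : - (n%:R / 2) < 2 * e - 1 - a) (eta0 : 0 < eta).
Hypothesis cD : forall s : R, 0 < s <= 1 -> {for s, continuous D}.
Hypothesis bD : forall s : R, 0 < s <= 1 -> `|D s| <= C * s `^ (e - 1).
Hypothesis mE : forall s : R, 0 < s < 1 -> m s = - 2 * s `^ (n%:R / 2 - a) * D s.
Hypothesis dm : forall s : R, 0 < s < 1 -> is_derive s 1 m (2^-1 * s `^ (n%:R / 2 - 1) * f s).
Hypothesis fc : forall s : R, 0 < s < 1 -> {for s, continuous f}.
Hypothesis m_bound : forall s : R, 0 < s < 1 -> 0 < m s <= C * s `^ eta.
Hypothesis f_bound : forall s : R, 0 < s < 1 -> `|f s| <= C * s `^ (eta - n%:R / 2).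
Hypothesis f_ge0 : forall s : R, 0 <= s < 1 -> 0 <= f s.

Let mu := @lebesgue_rV R n.
Let B := @unit_ball R n.
Let mB : measurable B := @unit_ball_measurable R n.
Let w (x : 'rV[R]_n) : R := enorm x `^ (- (2 * a)).
Let G := @radial_grad R n D.
Let fs (x : 'rV[R]_n) : R := f (sq x).
Local Notation itg h := (mu.-integrable B (EFin \o h)).
Local Notation I h := (\int[mu]_(x in B) (h x))%R.

Let w0 x : 0 <= w x. Proof. exact: powR_ge0. Qed.

Let w_measurable : measurable_fun B w.
Proof.
rewrite (_ : w = fun x => sq x `^ (- (2 * a) / 2)); first exact: measurable_sq_powR.
by apply/funext => x; rewrite /w enorm_powR.
Qed.

Let itgD h1 h2 : itg h1 -> itg h2 -> itg (fun x => h1 x + h2 x).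
Proof. by move=> i1 i2; have := integrableD mB i1 i2. Qed.

Let itgZ t h : itg h -> itg (fun x => t * h x).
Proof. by move=> i1; have := integrableZl mB t i1. Qed.

Let itgB h1 h2 : itg h1 -> itg h2 -> itg (fun x => h1 x - h2 x).
Proof. by move=> i1 i2; have := integrableB mB i1 i2. Qed.

Let itg_abs h : itg h -> itg (fun x => `|h x|).
Proof. by move=> i1; have := integrable_norm i1. Qed.

Let itg_le (h g : 'rV[R]_n -> R) : measurable_fun B h -> itg g ->
  (forall x, B x -> `|h x| <= g x) -> itg h.
Proof. by move=> mh ig hg; apply: ae_dominated_integrable mB mh ig _; apply: aeW. Qed.

Let I_comb s t h1 h2 : itg h1 -> itg h2 ->
  itg (fun x => s * h1 x + t * h2 x) /\
  I (fun x => s * h1 x + t * h2 x) = s * I h1 + t * I h2.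
Proof.
move=> i1 i2; have j1 := itgZ s i1; have j2 := itgZ t i2.
split; first exact: itgD.
by rewrite RintegralD// !RintegralZl.
Qed.

Let f_measurable : measurable_fun B fs.
Proof. by apply: (@sq_comp_measurable _ _ f). Qed.

Let fs0 x : B x -> 0 <= fs x.
Proof. by rewrite /B unit_ballE /= => x1; apply: f_ge0; rewrite sq_ge0. Qed.

Let fs_itg : itg fs.
Proof.
apply: (@ae_dominated_integrable _ _ _ mu B fs (fun x => C * sq x `^ (eta - n%:R / 2))) => //.
  by apply: itgZ; apply: powR_integrable => //; have := eta0; lra.
apply: filterS (@origin_negligible R n n0) => x x0; rewrite /B unit_ballE /= => x1.
by apply: f_bound; rewrite x0.
Qed.

Let G_measurable : measurable_fun B G.
Proof. exact: (@radial_grad_measurable _ _ D cD). Qed.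

Let wGG_itg : itg (fun x => w x * edot (G x) (G x)).
Proof.
apply: (@ae_dominated_integrable _ _ _ mu B _
  (fun x => 4 * C ^+ 2 * sq x `^ (2 * e - 1 - a))) => //.
- by apply: measurable_funM => //; exact: edot_measurable.
- by apply: itgZ; exact: powR_integrable.
apply: filterS (@origin_negligible R n n0) => x x0; rewrite /B unit_ballE /= => x1.
rewrite ger0_norm ?mulr_ge0 ?edot_ge0// /G /radial_grad edotZ /w enorm_powR -/(sq x).
have -> : - (2 * a) / 2 = - a by field.
have sE : sq x `^ (2 * e - 1 - a) = sq x `^ (- a) * ((sq x `^ (e - 1)) ^+ 2 * sq x).
  rewrite -[X in _ * (_ * X)](powRr1 (ltW x0)) expr2 -!gt0_powRD//.
  by congr (_ `^ _); ring.
rewrite sE (_ : 4 * C ^+ 2 * _ =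
  sq x `^ (- a) * (4 * (C * sq x `^ (e - 1)) ^+ 2 * sq x)); last by ring.
rewrite ler_wpM2l ?powR_ge0// ler_wpM2r ?(ltW x0)//.
rewrite (_ : 2 * D (sq x) * (2 * D (sq x)) = 4 * D (sq x) ^+ 2); last by ring.
have b : `|D (sq x)| <= C * sq x `^ (e - 1) by apply: bD; rewrite x0 ltW.
rewrite ler_wpM2l// -real_normK ?num_real// lerXn2r ?nnegrE//.
exact: le_trans (normr_ge0 _) b.
Qed.

Let PG := I (fun x => w x * edot (G x) (G x)).

Let PG0 : 0 <= PG.
Proof. by apply: Rintegral_ge0 => x _; rewrite mulr_ge0 ?edot_ge0. Qed.

Let sq0_eq0 (x : 'rV[R]_n) : sq x = 0 -> x = 0.
Proof.
move=> x0; apply/rowP => i; rewrite mxE; apply/eqP.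
by rewrite -sqrf_eq0 eq_le sqr_ge0 andbT -x0 sqr_coord_le.
Qed.

Definition gradient_row (dz : 'I_n -> 'rV[R]_n -> R) x : 'rV[R]_n := \row_i dz i x.

(** By [mE] the field w G is - m(|x|^2) |x|^-n x, so this is [flux_identity]; at x = 0 both fields
    vanish, being multiples of x. *)
Lemma C1_weak_identity z dz : C1_ball z dz ->
  [/\ itg (fun x => fs x * z x), itg (fun x => w x * edot (G x) (gradient_row dz x)) &
    I (fun x => w x * edot (G x) (gradient_row dz x)) = I (fun x => fs x * z x)].
Proof.
move=> z1; have [ifz im imE] := @flux_identity R n m f C eta n0 C0 eta0 dm fc m_bound f_bound z dz z1.
pose h x := m (sq x) * sq x `^ (- (n%:R / 2)) * \sum_(i < n) x ord0 i * dz i x.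
have hE x : B x -> w x * edot (G x) (gradient_row dz x) = - 1 * h x.
  rewrite /B unit_ballE /= => x1; have := sq_ge0 x; rewrite le_eqVlt => /orP[/eqP x0|x0].
    have -> : x = 0 by apply: sq0_eq0.
    rewrite /G /radial_grad /h scaler0 /edot big1 => [|i _]; last by rewrite mxE mul0r.
    by rewrite big1 => [|i _]; rewrite ?mxE ?mul0r//; ring.
  rewrite /h mE ?x0// /w enorm_powR (_ : - (2 * a) / 2 = - a); last by field.
  have -> : edot (G x) (gradient_row dz x) = 2 * D (sq x) * \sum_(i < n) x ord0 i * dz i x.
    by rewrite /edot mulr_sumr; apply: eq_bigr => i _; rewrite !mxE mulrA.
  have -> : sq x `^ (- a) = sq x `^ (n%:R / 2 - a) * sq x `^ (- (n%:R / 2)).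
    by rewrite -gt0_powRD//; congr (_ `^ _); ring.
  by ring.
have ih : itg (fun x => - 1 * h x) by apply: itgZ.
split=> //.
  by apply: eq_integrable ih => // x; rewrite inE => Bx /=; rewrite hE.
rewrite (@eq_Rintegral _ _ _ _ _ (fun x => - 1 * h x)); last first.
  by move=> x; rewrite inE => Bx; exact: hE.
by rewrite RintegralZl// /Rintegral imE fineN mulN1r opprK.
Qed.

Let gradient_row_measurable z dz : C1_ball z dz -> measurable_fun B (gradient_row dz).
Proof.
move=> [_ cdz _ _]; apply: measurable_fun_rV => // i.
rewrite (_ : (fun _ => _) = dz i); last by apply/funext => x; rewrite mxE.
by apply: measurable_funTS; exact: continuous_rV_measurable.
Qed.

(* The identity is tested with smooth approximations of |z|.  This bounds the
   integral of f |z| by the energy of z without any Hardy inequality. *)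
Lemma C1_abs_bound z dz t : 0 < t -> C1_ball z dz ->
  itg (fun x => w x * edot (gradient_row dz x) (gradient_row dz x)) ->
  itg (fun x => fs x * `|z x|) /\
  I (fun x => fs x * `|z x|) <=
    t * PG + t^-1 * I (fun x => w x * edot (gradient_row dz x) (gradient_row dz x)).
Proof.
move=> t0 z1 iQ; have [ifz _ _] := C1_weak_identity z1.
have ifz' : itg (fun x => fs x * `|z x|).
  apply: eq_integrable (itg_abs ifz) => // x; rewrite inE => Bx /=.
  by rewrite normrM (ger0_norm (fs0 Bx)).
split=> //; apply/ler_addgt0Pr => d d0.
have F0 : 0 <= I fs by apply: Rintegral_ge0; exact: fs0.
(* The smoothing error is at most eps times the integral of f, hence at most d. *)
pose eps := d / (I fs + 1).
have eps0 : 0 < eps by rewrite divr_gt0// ltr_wpDl.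
pose zeta x := smooth_abs eps (z x).
pose dzeta i x := smooth_sgn eps (z x) * dz i x.
have zeta1 : C1_ball zeta dzeta.
  case: z1 => cz cdz dz1 [r r1 zr]; split=> [x|i x|i x|].
  - apply: (@continuous_comp _ _ _ z (smooth_abs eps)); first exact: cz.
    exact: is_derive_continuous (is_derive_smooth_abs eps0 _).
  - have FF : Filter (nbhs x) by exact: nbhs_filter.
    apply: cvgM; last exact: cdz.
    apply: (@continuous_comp _ _ _ z (smooth_sgn eps)); first exact: cz.
    exact: smooth_sgn_continuous.
  - by apply: is_derive_comp1; exact: is_derive_smooth_abs.
  - by exists r => // x rx; rewrite /zeta zr// smooth_abs0.
have [ifzeta iGz GzE] := C1_weak_identity zeta1.
have le1 : I (fun x => fs x * `|z x|) <= I (fun x => fs x * zeta x + eps * fs x).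
  apply: le_Rintegral => //; first by apply: itgD => //; exact: itgZ.
  move=> x Bx; rewrite [X in _ <= _ + X]mulrC -mulrDr ler_wpM2l ?fs0//.
  by have := smooth_abs_ge eps (z x); rewrite lerBlDr.
apply: le_trans le1 _; rewrite RintegralD//; last exact: itgZ.
rewrite RintegralZl// -GzE; apply: lerD; last first.
  rewrite /eps mulrAC ler_pdivrMr ?ltr_wpDl//.
  by rewrite ler_wpM2l ?(ltW d0)// lerDl.
rewrite -!RintegralZl// -RintegralD//; [|exact: itgZ|exact: itgZ].
apply: le_Rintegral => //; first by apply: itgD; exact: itgZ.
move=> x Bx; rewrite mulrCA [X in _ + X]mulrCA -mulrDr ler_wpM2l//.
apply: le_trans (ler_norm _) _; apply: le_trans (edot_young _ _ t0) _.
rewrite lerD2l ler_wpM2l ?invr_ge0 ?(ltW t0)//.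
rewrite (_ : gradient_row dzeta x = smooth_sgn eps (z x) *: gradient_row dz x).
  rewrite edotZ -expr2; apply: ler_piMl; first exact: edot_ge0.
  exact: smooth_sgn_le1.
by apply/rowP => i; rewrite !mxE.
Qed.

Section test_approximation.
Variables (phi : 'rV[R]_n -> R) (H : 'rV[R]_n -> 'rV[R]_n).
Hypothesis phiH : D12_grad a B phi H.

Let E (p : 'rV[R]_n -> R) x := grad p x - H x.

(** Convergence in the completion says nothing directly about the integral of f |p - phi|.
    [C1_abs_bound] controls it for [p N] - [p k], and Fatou's lemma lets k tend to infinity. *)
Lemma test_approximation t : 0 < t -> exists p : 'rV[R]_n -> R,
  [/\ test_function B p, itg (fun x => w x * edot (E p x) (E p x)),
    itg (fun x => w x * edot (G x) (E p x)),
    `|I (fun x => w x * edot (G x) (E p x))| <= t &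
    itg (fun x => fs x * `|p x - phi x|) /\ I (fun x => fs x * `|p x - phi x|) <= t].
Proof.
case: phiH => mphi mH [p [tp Ep0 pphi]] t0.
have mp k : measurable_fun B (p k).
  apply: measurable_funTS; apply: continuous_rV_measurable.
  by have [sp _ _] := tp k; have [] := sp [::].
have mg k : measurable_fun B (grad (p k)).
  by have := gradient_row_measurable (test_function_C1 (tp k)).
have mEp k : measurable_fun B (E (p k)).
  apply: measurable_fun_rV => // i.
  rewrite (_ : (fun _ => _) = fun x => grad (p k) x ord0 i - H x ord0 i); last first.
    by apply/funext => x; rewrite !mxE.
  by apply: measurable_funB; apply: (measurableT_comp (@measurable_coord R n i)).
(* Young's parameter s makes the part with the energy of G at most t / 2. The number tau below is
   such that 4 tau, the bound for the energy of [p N] - [p k], contributes the other half after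
   division by s. *)
pose s := t / (2 * (PG + 1)).
have s0 : 0 < s by rewrite divr_gt0// mulr_gt0// ltr_wpDl.
have sPG : s * PG <= t / 2.
  rewrite /s mulrAC ler_pdivrMr ?mulr_gt0 ?ltr_wpDl//.
  by rewrite (_ : t / 2 * _ = t * (PG + 1)); [rewrite ler_wpM2l ?(ltW t0)// lerDl|field].
pose tau := s * (t / 8).
have tau0 : 0 < tau by rewrite mulr_gt0// divr_gt0.
have [N _ EN] : \forall k \near \oo, (pairing a B (E (p k)) (E (p k)) < tau%:E)%E.
  have nb : nbhs (0%E : \bar R) [set y | (y < tau%:E)%E].
    by apply: open_nbhs_nbhs; split; [exact: open_ereal_lt_ereal|rewrite /= lte_fin].
  exact: (Ep0 _ nb).
have Eitg k : (N <= k)%N -> itg (fun x => w x * edot (E (p k) x) (E (p k) x)) /\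
    I (fun x => w x * edot (E (p k) x) (E (p k) x)) <= tau.
  move=> Nk; have Ek := EN k Nk.
  have ik : itg (fun x => w x * edot (E (p k) x) (E (p k) x)).
    apply: ge0_lty_integrable => //.
    - by apply: measurable_funM => //; exact: edot_measurable.
    - by move=> x _; rewrite mulr_ge0 ?edot_ge0.
    - exact: lt_trans Ek (ltry _).
  split=> //; rewrite -lee_fin fineK; first exact: ltW.
  exact: integrable_fin_num.
have sV : 0 <= s^-1 by rewrite invr_ge0 ltW.
have stau : s^-1 * tau = t / 8 by rewrite /tau mulKf// gt_eqF.
have diff k : (N <= k)%N -> itg (fun x => fs x * `|p N x - p k x|) /\
    I (fun x => fs x * `|p N x - p k x|) <= t.
  move=> Nk; pose dz i x := partial i (p N) x - partial i (p k) x.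
  have dzE x : gradient_row dz x = E (p N) x - E (p k) x.
    by apply/rowP => i; rewrite /E !mxE /dz; ring.
  have z1 : C1_ball (fun x => p N x - p k x) dz.
    have [cN cdN dN [rN rN1 zN]] := test_function_C1 (tp N).
    have [ck cdk dk [rk rk1 zk]] := test_function_C1 (tp k).
    split=> [x|i x|i x|].
    - have FF : Filter (nbhs x) by exact: nbhs_filter.
      by apply: cvgB; [exact: cN|exact: ck].
    - have FF : Filter (nbhs x) by exact: nbhs_filter.
      by apply: cvgB; [exact: cdN|exact: cdk].
    - exact: is_deriveB.
    - exists (Num.max rN rk); first by rewrite gt_max rN1.
      by move=> x; rewrite ge_max => /andP[/zN -> /zk ->]; rewrite subrr.
  have [iN IN] := Eitg N (leqnn N); have [ik Ik] := Eitg k Nk.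
  have [i2 I2] := I_comb 2 2 iN ik.
  have dle x : w x * edot (gradient_row dz x) (gradient_row dz x) <=
      2 * (w x * edot (E (p N) x) (E (p N) x)) +
      2 * (w x * edot (E (p k) x) (E (p k) x)).
    have := ler_wpM2l (w0 x) (edot_sub_le (E (p N) x) (E (p k) x)); rewrite -dzE.
    by move: (edot (E (p N) x) _) (edot (E (p k) x) _) => u v; rewrite mulrDr !(mulrCA _ 2).
  have id : itg (fun x => w x * edot (gradient_row dz x) (gradient_row dz x)).
    apply: (itg_le _ i2) => [|x _]; last by rewrite ger0_norm ?mulr_ge0 ?edot_ge0.
    apply: measurable_funM => //; apply: edot_measurable;
      exact: gradient_row_measurable z1.
  have [ifd Ifd] := C1_abs_bound s0 z1 id; split=> //.
  apply: le_trans Ifd _.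
  have : I (fun x => w x * edot (gradient_row dz x) (gradient_row dz x)) <= 4 * tau.
    apply: le_trans (le_Rintegral mB id i2 (fun x _ => dle x)) _.
    rewrite I2; apply: le_trans (lerD (ler_wpM2l _ IN) (ler_wpM2l _ Ik)) _ => //.
    by rewrite (_ : 2 * tau + 2 * tau = 4 * tau)//; ring.
  move=> /(ler_wpM2l sV); rewrite mulrCA stau => H4.
  by apply: le_trans (lerD sPG H4) _; rewrite (_ : t / 2 + 4 * (t / 8) = t)//; field.
have [iN IN] := Eitg N (leqnn N).
have mfd : measurable_fun B (fun x => fs x * `|p N x - phi x|).
  by apply: measurable_funM => //; apply: measurableT_comp => //; exact: measurable_funB.
have fd0 x : B x -> 0 <= fs x * `|p N x - phi x| by move=> Bx; rewrite mulr_ge0 ?fs0.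
have bound : (\int[mu]_(x in B) (fs x * `|p N x - phi x|)%:E <= t%:E)%E.
  apply: (@fatou_le _ _ _ mu B mB (fun k x => fs x * `|p N x - p (N + k)%N x|)) => //.
  - move=> k; apply: measurable_funM => //; apply: measurableT_comp => //.
    exact: measurable_funB.
  - by move=> k x Bx; rewrite mulr_ge0 ?fs0.
  - apply: filterS pphi => x cx Bx; apply: cvgMr; apply: cvg_norm.
    apply: cvgB; first exact: cvg_cst.
    have := cx Bx; rewrite -(@cvg_shiftn N) => cv.
    by rewrite (_ : (fun k => _) = (fun k => p (k + N)%N x))//; apply/funext => k; rewrite addnC.
  - move=> k; have [ik Ik] := diff (N + k)%N (leq_addr _ _).
    by rewrite -[leLHS]fineK ?lee_fin//; exact: integrable_fin_num.
have ifd : itg (fun x => fs x * `|p N x - phi x|).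
  by apply: ge0_lty_integrable => //; exact: le_lt_trans bound (ltry _).
have yE x : `|w x * edot (G x) (E (p N) x)| <=
    s * (w x * edot (G x) (G x)) + s^-1 * (w x * edot (E (p N) x) (E (p N) x)).
  rewrite normrM ger0_norm//.
  have := ler_wpM2l (w0 x) (edot_young (G x) (E (p N) x) s0).
  move: (edot (G x) (G x)) (edot (E (p N) x) (E (p N) x)) => u v.
  by rewrite mulrDr (mulrCA _ s) (mulrCA _ s^-1).
have [i2 I2] := I_comb s s^-1 wGG_itg iN.
have iGE : itg (fun x => w x * edot (G x) (E (p N) x)).
  apply: (itg_le _ i2) => //.
  by apply: measurable_funM => //; exact: edot_measurable.
exists (p N); split=> //; last first.
  split=> //; rewrite -lee_fin fineK//; exact: integrable_fin_num.
apply: le_trans (le_normr_Rintegral mB iGE) _.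
apply: le_trans (le_Rintegral mB (itg_abs iGE) i2 (fun x _ => yE x)) _.
rewrite I2 -/PG; apply: le_trans (lerD sPG (ler_wpM2l sV IN)) _.
rewrite stau -subr_ge0 (_ : _ - _ = 3 / 8 * t); last by field.
by rewrite mulr_ge0 ?(ltW t0)// divr_ge0.
Qed.

(** Replacing phi by the approximating test function, for which the identity is exact, changes each
    side by at most t, and t is arbitrary. *)
Lemma radial_weak_form :
  itg (fun x => fs x * phi x) /\
  (pairing a B G H = \int[mu]_(x in B) (fs x * phi x)%:E)%E.
Proof.
have [mphi mH _] := phiH.
have split1 (t : R) : 0 < t -> [/\ itg (fun x => fs x * phi x), itg (fun x => w x * edot (G x) (H x)) &
    `|I (fun x => w x * edot (G x) (H x)) - I (fun x => fs x * phi x)| <= t + t].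
  move=> t0; have [p [tp iE iGE IGE [ifd Ifd]]] := test_approximation t0.
  have [ifp iGp GpE] := C1_weak_identity (test_function_C1 tp).
  have mp : measurable_fun B p.
    apply: measurable_funTS; apply: continuous_rV_measurable.
    by have [sp _ _] := tp; have [] := sp [::].
  have ifd' : itg (fun x => fs x * (p x - phi x)).
    apply: (itg_le _ ifd) => [|x Bx]; last by rewrite normrM (ger0_norm (fs0 Bx)).
    by apply: measurable_funM => //; exact: measurable_funB.
  have fphiE : (fun x => fs x * phi x) = (fun x => fs x * p x - fs x * (p x - phi x)).
    by apply/funext => x; ring.
  have wGHE : (fun x => w x * edot (G x) (H x)) =
      (fun x => w x * edot (G x) (grad p x) - w x * edot (G x) (E p x)).
    by apply/funext => x; rewrite /E edotDr edotNr; ring.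
  rewrite fphiE wGHE; split; [exact: itgB|exact: itgB|].
  rewrite !RintegralB// (_ : I (fun x => w x * edot (G x) (grad p x)) =
    I (fun x => fs x * p x)); last exact: GpE.
  rewrite opprB addrC addrA addrNK.
  apply: le_trans (ler_normB _ _) _; rewrite lerD//.
  apply: le_trans (le_normr_Rintegral mB ifd') _; apply: le_trans Ifd.
  apply: le_Rintegral => //; first exact: itg_abs.
  by move=> x Bx; rewrite normrM (ger0_norm (fs0 Bx)).
have [ifphi iGH _] := split1 1 ltr01; split=> //.
have eqI : I (fun x => w x * edot (G x) (H x)) = I (fun x => fs x * phi x).
  apply/eqP; rewrite -subr_eq0 -normr_le0; apply/ler_addgt0Pr => t t0.
  rewrite add0r (splitr t).
  by have [|_ _] := split1 (t / 2); rewrite ?divr_gt0.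
rewrite -[RHS]fineK; last exact: integrable_fin_num.
by rewrite -[LHS]fineK; [congr EFin|exact: integrable_fin_num].
Qed.

End test_approximation.

End weak_form.

(** * The radial solution *)

Section emden_fowler_profile.
Context {R : realType}.
Variables (kap gam lam : R).
Hypotheses (kap0 : 0 < kap) (gam0 : 0 < gam) (lam0 : 0 < lam).

(** Near -oo the solution is close to 1, so the linear source is strictly positive there and makes
    e^s V positive; afterwards e^s V does not decrease. *)
Lemma ef_flux_gt0 k eps (Z V : R -> R) b : 0 < k -> 0 <= eps -> b <= 0 ->
  ef_solution k kap gam lam eps Z V ->
  (forall s, s <= b -> 0 <= Z s) -> 0 < V b.
Proof.
move=> k0 eps0 b0 sol Z0; have [_ _ _ Z1] := sol.
have [T [_ HT]] : \forall s \near -oo, 0 < Z s.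
  have := Z1; move=> /cvgrPdist_lt /(_ _ ltr01); apply: filterS => s.
  by rewrite ltr_distlC => /andP[]; rewrite subrr.
pose S := Num.min (T - 1) b.
have ST : S < T by rewrite gt_min; apply/orP; left; lra.
have Sb : S <= b by rewrite ge_min lexx orbT.
pose dw s := expR s *
    (k * (eps * expR (kap * s) * clip_pow (2 * kap + 1) (Z s)
             + lam * expR (gam * s) * Z s)).
have dW (s : R) : s <= b -> is_derive s 1 (fun t => expR t * V t) (dw s).
  by move=> sb; apply: is_derive_expV sol _; exact: le_trans b0.
have dW0 s : s <= b -> 0 <= dw s.
  by move=> sb; rewrite mulr_ge0 ?expR_ge0//; apply: ef_source_ge0 => //; exact: Z0.
have cW x y : y <= b -> {within `[x, y], continuous (fun t : R => expR t * V t)}.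
  move=> yb; apply: continuous_itvW => z /andP[_ zy].
  by apply: is_derive_continuous (dW z _); exact: le_trans yb.
have SS : S - 1 < S by lra.
have [|c] := @MVT _ (fun t => expR t * V t) dw (S - 1) S SS _ (cW _ _ Sb).
  by move=> x; rewrite in_itv/= => /andP[_ xS]; apply: dW; rewrite ltW// (lt_le_trans xS).
rewrite in_itv/= => /andP[_ cS] E.
have S1 : 0 <= V (S - 1).
  apply: (@ef_flux_ge0 _ k kap gam lam k0 lam0 eps Z V (S - 1) eps0 _ sol).
    by rewrite (le_trans _ b0)// (le_trans _ Sb)// ltW.
  by move=> s sS; apply: Z0; rewrite (le_trans sS)// (le_trans (ltW SS)).
have VS : 0 < expR S * V S.
  have -> : expR S * V S = expR (S - 1) * V (S - 1) + (expR S * V S - expR (S - 1) * V (S - 1)).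
    by ring.
  rewrite E ltr_wpDl ?mulr_ge0 ?expR_ge0// mulr_gt0 ?subr_gt0//.
  rewrite mulr_gt0 ?expR_gt0// mulr_gt0// ltr_wpDl//.
    by rewrite !mulr_ge0 ?expR_ge0// clip_pow_ge0.
  by rewrite !mulr_gt0 ?expR_gt0//; apply: HT; rewrite (lt_trans cS).
have : expR S * V S <= expR b * V b.
  apply: (@ge0_deriv_le _ (fun t => expR t * V t) dw S b Sb) => [x /andP[_ xb]|x /andP[_ xb]|].
  - by apply: dW; exact: ltW.
  - by apply: dW0; exact: ltW.
  - exact: cW.
by move=> /(lt_le_trans VS); rewrite pmulr_rgt0 ?expR_gt0.
Qed.

End emden_fowler_profile.

Section radial_solution.
Context {R : realType} {n : nat}.
Variables (a kap gam lam eps A sig : R) (Z V : R -> R).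
Let N2 := n%:R / 2 : R.
Let beta := N2 - 1 - a.
Let k := (4 * beta ^+ 2)^-1.
Hypotheses (n0 : (0 < n)%N) (beta0 : 0 < beta) (kap0 : 0 < kap) (gam0 : 0 < gam)
  (lam0 : 0 < lam) (eps0 : 0 <= eps) (A0 : 0 < A) (sig0 : sig <= 0).
Hypothesis sol : ef_solution k kap gam lam eps Z V.
Hypothesis Zge0 : forall s, s <= sig -> 0 <= Z s.
Hypothesis Zsig : Z sig = 0.

(** The shift sig moves a zero of Z to the sphere: 0 for the nonlinear solution, the first zero in
    the linear problem. *)
Let L (s : R) := sig + beta * ln s.

(* Since ln 0 = 0, the value of the profile at the origin is A * Z sig = 0. *)
Definition profile s := A * Z (sig + beta * ln s).
Definition profile_source s := A * s `^ (- a - 1) *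
  (eps * expR (kap * (sig + beta * ln s)) * clip_pow (2 * kap + 1) (Z (sig + beta * ln s))
   + lam * expR (gam * (sig + beta * ln s)) * Z (sig + beta * ln s)).

Let D s := - (A * beta) * V (L s) / s.
Let m s := 2 * A * beta * s `^ beta * V (L s).
Let src s := eps * expR (kap * s) * clip_pow (2 * kap + 1) (Z s) + lam * expR (gam * s) * Z s.
Let f s := A * s `^ (- a - 1) * src (L s).

Let L_le s : s <= 1 -> L s <= sig.
Proof.
by move=> s1; rewrite /L gerDl; apply: mulr_ge0_le0; [exact: ltW|exact: ln_le0].
Qed.

Let k0 : 0 < k. Proof. by rewrite invr_gt0 mulr_gt0// exprn_gt0. Qed.

Let dL (s : R) : 0 < s -> is_derive s 1 L (beta / s).
Proof.
move=> s0; apply: is_derive_eq (derD (der_cst sig s) (derM (der_cst beta s) (der_ln s0 (der_id s)))) _.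
by rewrite /=; field; rewrite gt_eqF.
Qed.

Let dZ (s : R) : 0 < s <= 1 -> is_derive s 1 (fun t => Z (L t)) (- V (L s) * (beta / s)).
Proof.
move=> /andP[s0 s1]; have [dZ _ _ _] := sol.
by apply: der_comp; [apply: dZ; exact: le_trans (L_le s1) _|exact: dL].
Qed.

Let dV (s : R) : 0 < s <= 1 ->
  is_derive s 1 (fun t => V (L t)) ((- V (L s) + k * src (L s)) * (beta / s)).
Proof.
move=> /andP[s0 s1]; have [_ dV _ _] := sol.
by apply: der_comp; [apply: dV; exact: le_trans (L_le s1) _|exact: dL].
Qed.

Let dU (s : R) : 0 < s <= 1 -> is_derive s 1 profile (D s).
Proof.
move=> s01; apply: is_derive_eq (derM (der_cst A s) (dZ s01)) _.
by rewrite /D /=; have /andP[s0 _] := s01; field; rewrite gt_eqF.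
Qed.

Let cD (s : R) : 0 < s <= 1 -> {for s, continuous D}.
Proof.
move=> s01; have /andP[s0 _] := s01.
apply: (is_derive_continuous (derM (derM (der_cst (- (A * beta)) s) (dV s01)) (derV _ (der_id s)))).
by rewrite gt_eqF.
Qed.

Let dm (s : R) : 0 < s < 1 -> is_derive s 1 m (2^-1 * s `^ (N2 - 1) * f s).
Proof.
move=> /andP[s0 s1]; have s01 : 0 < s <= 1 by rewrite s0 ltW.
apply: is_derive_eq (derM (derM (der_cst (2 * A * beta) s) (der_powR beta s0 (der_id s))) (dV s01)) _.
have E1 : s `^ (N2 - 1) * s `^ (- a - 1) = s `^ (beta - 1).
  by rewrite -gt0_powRD//; congr (_ `^ _); rewrite /beta; ring.
have E2 : s `^ beta = s `^ (beta - 1) * s.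
  by rewrite -[X in _ * X](powRr1 (ltW s0)) -gt0_powRD//; congr (_ `^ _); ring.
rewrite /f [RHS](_ : _ = 2^-1 * A * (s `^ (N2 - 1) * s `^ (- a - 1)) * src (L s)); last by ring.
by rewrite E1 E2 /k; field; rewrite !gt_eqF.
Qed.

Let Zbound s : s <= sig -> 0 <= Z s <= 1.
Proof.
move=> ss; rewrite Zge0//=; apply: (@ef_le1 _ k kap gam lam k0 lam0 eps Z V s eps0 _ sol).
  exact: le_trans sig0.
by move=> t ts; apply: Zge0; exact: le_trans ss.
Qed.

Let bounds : exists C e, [/\ 0 <= C, 0 < e <= 1,
  forall s, 0 < s <= 1 -> `|V (L s)| <= C * s `^ e &
  forall s, 0 < s <= 1 -> `|src (L s)| <= (eps + lam) * s `^ e].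
Proof.
have [_ _ [C [mu [C0 mu0 VC]]] _] := sol.
(* nu is below every exponential rate in play, and below 1 / beta so that the exponent beta nu is at
   most 1. *)
pose nu := Num.min (Num.min mu beta^-1) (Num.min kap gam).
have nu0 : 0 < nu by rewrite !lt_min mu0 invr_gt0 beta0 kap0 gam0.
have [numu nub nuk nug] : [/\ nu <= mu, nu <= beta^-1, nu <= kap & nu <= gam].
  by rewrite /nu !ge_min !lexx !orbT.
have expL p s : nu <= p -> 0 < s <= 1 -> expR (p * L s) <= s `^ (beta * nu).
  move=> nup /andP[s0 s1]; have Ls : L s <= beta * ln s by rewrite /L gerDr.
  rewrite /powR gt_eqF// ler_expR.
  have l0 : beta * ln s <= 0 by apply: mulr_ge0_le0; [exact: ltW|exact: ln_le0].
  have p0 : 0 <= p by exact: le_trans (ltW nu0) nup.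
  apply: le_trans (ler_wpM2l p0 Ls) _.
  by rewrite (mulrC beta nu) -mulrA ler_wnM2r.
exists C, (beta * nu); split=> //.
- rewrite mulr_gt0//=; have := ler_wpM2l (ltW beta0) nub.
  by rewrite divff// gt_eqF.
- move=> s s01; have /andP[s0 s1] := s01.
  apply: le_trans (VC _ (le_trans (L_le s1) sig0)) _.
  by rewrite ler_wpM2l// expL.
- move=> s s01; have /andP[s0 s1] := s01; have /andP[z0 z1] := Zbound (L_le s1).
  have c0 := clip_pow_ge0 (2 * kap + 1) (Z (L s)).
  have c1 : clip_pow (2 * kap + 1) (Z (L s)) <= 1.
    by apply: clip_pow_le1; rewrite addr_ge0// mulr_ge0// ltW.
  rewrite ger0_norm; last by rewrite addr_ge0// !mulr_ge0 ?expR_ge0// ltW.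
  rewrite mulrDl lerD// -mulrA ler_wpM2l ?(ltW lam0)//.
    by rewrite -[leRHS]mulr1 ler_pM ?expR_ge0 ?expL.
  by rewrite -[leRHS]mulr1 ler_pM ?expR_ge0 ?expL.
Qed.

Let f_ge0 s : 0 <= s < 1 -> 0 <= f s.
Proof.
move=> /andP[s0 s1]; have /andP[z0 z1] := Zbound (L_le (ltW s1)).
rewrite /f !mulr_ge0 ?powR_ge0 ?(ltW A0)//.
by rewrite addr_ge0// !mulr_ge0 ?expR_ge0 ?clip_pow_ge0// ltW.
Qed.

Let fc (s : R) : 0 < s < 1 -> {for s, continuous f}.
Proof.
move=> /andP[s0 s1]; have s01 : 0 < s <= 1 by rewrite s0 ltW.
have cZ := is_derive_continuous (dZ s01).
have cexp p : {for s, continuous (fun t => expR (p * L t))}.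
  by apply: (is_derive_continuous (der_exp (derM (der_cst p s) (dL s0)))).
apply: cvgM.
  apply: cvgM; first exact: cvg_cst.
  exact: (is_derive_continuous (der_powR (- a - 1) s0 (der_id s))).
apply: cvgD; (apply: cvgM; first by apply: cvgM; [exact: cvg_cst|exact: cexp]) => //.
apply: (@continuous_comp _ _ _ (fun t => Z (L t)) (clip_pow (2 * kap + 1))); first exact: cZ.
by apply: clip_pow_continuous; rewrite addr_gt0// mulr_gt0.
Qed.

Let m_gt0 s : 0 < s < 1 -> 0 < m s.
Proof.
move=> /andP[s0 s1]; rewrite /m !mulr_gt0 ?powR_gt0//.
apply: (ef_flux_gt0 lam0 k0 eps0 _ sol).
  by rewrite (le_trans _ sig0)// L_le// ltW.
by move=> t ts; apply: Zge0; rewrite (le_trans ts)// L_le// ltW.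
Qed.

(** V and the source are O(s^e) in s = |x|^2, which gives the exponents e - 1 for D, beta + e for m
    and beta + e - n / 2 for f. General eps and sig let one lemma serve both the linear and the
    nonlinear problem. *)
Lemma ef_profile : exists G, D12_grad a (@unit_ball R n) (fun x => profile (sq x)) G /\
  forall phi H, D12_grad a (@unit_ball R n) phi H ->
    (lebesgue_rV n).-integrable unit_ball
      (EFin \o (fun x : 'rV[R]_n => profile_source (sq x) * phi x)) /\
    (pairing a unit_ball G H =
     \int[lebesgue_rV n]_(x in unit_ball) (profile_source (sq x) * phi x)%:E)%E.
Proof.
have [C [e [C0 /andP[e0 e1] bV bS]]] := bounds.
have lt01 (s : R) : 0 < s < 1 -> 0 < s <= 1 by move=> /andP[-> /ltW ->].
pose K := 2 * A * beta * C + A * (eps + lam).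
have K1 : 0 <= 2 * A * beta * C by rewrite !mulr_ge0 ?(ltW A0) ?(ltW beta0).
have K2 : 0 <= A * (eps + lam) by rewrite mulr_ge0 ?(ltW A0)// addr_ge0// ltW.
have K0 : 0 <= K by exact: addr_ge0.
have ea : - N2 < 2 * e - 1 - a by move: beta0; rewrite /beta; lra.
have bD s : 0 < s <= 1 -> `|D s| <= K * s `^ (e - 1).
  move=> s01; have /andP[s0 s1] := s01.
  have sE : s `^ e = s `^ (e - 1) * s.
    by rewrite -[X in _ * X](powRr1 (ltW s0)) -gt0_powRD//; congr (_ `^ _); ring.
  rewrite /D !(normrM, normrN) normfV (gtr0_norm s0) ler_pdivrMr//.
  rewrite (gtr0_norm A0) (gtr0_norm beta0) -(mulrA K) -sE.
  apply: le_trans (ler_wpM2l (ltW (mulr_gt0 A0 beta0)) (bV s s01)) _.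
  rewrite mulrA ler_wpM2r ?powR_ge0// /K.
  apply: (@le_trans _ _ (2 * A * beta * C)); last by rewrite lerDl.
  have : 0 <= A * beta * C by rewrite !mulr_ge0 ?(ltW A0) ?(ltW beta0).
  by rewrite (_ : 2 * A * beta * C = 2 * (A * beta * C)); [lra|ring].
have mE s : 0 < s < 1 -> m s = - 2 * s `^ (N2 - a) * D s.
  move=> /andP[s0 _]; rewrite /m /D.
  have -> : s `^ (N2 - a) = s `^ beta * s.
    rewrite -[X in _ * X](powRr1 (ltW s0)) -gt0_powRD//; congr (_ `^ _).
    by rewrite /beta; ring.
  by field; rewrite gt_eqF.
have mb s : 0 < s < 1 -> 0 < m s <= K * s `^ (beta + e).
  move=> s01; rewrite m_gt0//=; have /andP[s0 _] := s01.
  have A2 : 0 <= 2 * A * beta by rewrite !mulr_ge0 ?(ltW A0) ?(ltW beta0).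
  rewrite gt0_powRD// (_ : m s = s `^ beta * (2 * A * beta * V (L s))); last first.
    by rewrite /m; ring.
  rewrite (mulrCA K) ler_wpM2l ?powR_ge0//.
  apply: le_trans (ler_wpM2l A2 (le_trans (ler_norm _) (bV s (lt01 s s01)))) _.
  by rewrite mulrA ler_wpM2r ?powR_ge0// /K lerDl.
have fb s : 0 < s < 1 -> `|f s| <= K * s `^ (beta + e - N2).
  move=> s01; have /andP[s0 _] := s01.
  rewrite /f !normrM (gtr0_norm A0) (ger0_norm (powR_ge0 _ _)).
  have -> : s `^ (beta + e - N2) = s `^ (- a - 1) * s `^ e.
    by rewrite -gt0_powRD//; congr (_ `^ _); rewrite /beta; ring.
  have H : A * s `^ (- a - 1) * `|src (L s)| <= A * s `^ (- a - 1) * ((eps + lam) * s `^ e).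
    by rewrite ler_wpM2l ?mulr_ge0 ?powR_ge0 ?(ltW A0)//; apply: bS; exact: lt01.
  apply: le_trans H _.
  rewrite (_ : A * _ * _ = A * (eps + lam) * (s `^ (- a - 1) * s `^ e)); last by ring.
  by rewrite ler_wpM2r ?mulr_ge0 ?powR_ge0// /K lerDr.
exists (radial_grad D); split.
  apply: (@radial_profile_D12_grad R n a K e profile D) => //.
  by rewrite /profile ln1 mulr0 addr0 Zsig mulr0.
move=> phi H phiH.
apply: (@radial_weak_form R n a K e (beta + e) D m f) => //.
exact: addr_gt0.
Qed.

End radial_solution.

(** A cube of half side l = r / (n + 1) has positive measure and lies in |x|^2 < r, because n l^2 <=
    n l < r. *)
Lemma ae_near_origin (R : realType) n (P : 'rV[R]_n -> Prop) (r : R) :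
  (0 < n)%N -> 0 < r <= 1 ->
  {ae lebesgue_rV n, forall x, unit_ball x -> P x} ->
  exists x, [/\ 0 < sq x, sq x < r & P x].
Proof.
move=> n0 /andP[r0 r1] aeP; apply: contrapT => nP.
have : {ae lebesgue_rV n, forall x : 'rV[R]_n, ~ (sq x < r)}.
  apply: filterS2 aeP (@origin_negligible R n n0) => x Px x0 xr; apply: nP.
  by exists x; split=> //; apply: Px; rewrite unit_ballE /=; exact: lt_le_trans r1.
pose l := r / (n.+1)%:R.
have n1 : 0 < (n.+1)%:R :> R by rewrite ltr0n.
have l0 : 0 < l by rewrite divr_gt0.
have l1 : l <= 1 by rewrite ler_pdivrMr// mul1r (le_trans r1)// ler1n.
set K := [set v : 'rV[R]_n | forall i, `[- l, l]%classic (v ord0 i)].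
have Kr x : K x -> sq x < r.
  move=> Kx; apply: (@le_lt_trans _ _ (\sum_(i < n) l)).
    apply: ler_sum => i _; rewrite -expr2.
    have := Kx i; rewrite /= in_itv/= -ler_norml => xl.
    rewrite -real_normK ?num_real// expr2.
    apply: le_trans (ler_pM _ _ xl (le_trans xl l1)) _ => //.
    by rewrite mulr1.
  rewrite sumr_const card_ord -mulr_natr /l mulrAC ltr_pdivrMr//.
  by rewrite ltr_pM2l// ltr_nat.
move=> [N [mN N0 sub]].
have : (lebesgue_rV n K <= lebesgue_rV n N)%E.
  apply: le_measure; rewrite ?inE//; first exact: box_measurable.
  by move=> x Kx; apply: sub => /=; apply: contrapT => /contrapT; apply; exact: Kr.
by rewrite N0 (box_measure n (ltW l0)) lee_fin leNgt exprn_gt0// mulr_gt0.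
Qed.

(** The infimum of the points where Z <= 0 is finite by positivity near -oo, and continuity forces
    the value 0 there. *)
Lemma first_zero (R : realType) (Z : R -> R) (T s : R) :
  (forall t, t < T -> 0 < Z t) -> (forall t, t <= s -> {for t, continuous Z}) ->
  Z s <= 0 -> exists2 sig, sig <= s & Z sig = 0 /\ forall t, t <= sig -> 0 <= Z t.
Proof.
move=> ZT cZ Zs; pose S := [set t | t <= s /\ Z t <= 0].
have Ss : S s by [].
have lbS : lbound S T by move=> t [_ Zt]; rewrite leNgt; apply/negP => /ZT; rewrite ltNge Zt.
have infS : has_inf S by split; [exists s|exists T].
pose sig := inf S.
have lbe x : S x -> sig <= x by apply: ge_inf; exists T.
have ss : sig <= s by exact: lbe.
have Zlt t : t < sig -> 0 < Z t.
  move=> ts; rewrite ltNge; apply/negP => Zt.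
  by have := lbe t (conj (ltW (lt_le_trans ts ss)) Zt); rewrite leNgt ts.
have Z0 : Z sig = 0.
  apply/eqP; case: (ltgtP (Z sig) 0) => // Zsig.
  - have [d /= d0 Hd] : \forall t \near sig, Z t < 0.
      by apply: (cvgr_lt _ (cZ sig ss)).
    have : Z (sig - d / 2) < 0.
      apply: Hd; rewrite /ball /= opprB addrC subrK ger0_norm ?divr_ge0 ?(ltW d0)//.
      by rewrite ltr_pdivrMr// ltr_pMr// ltr1n.
    by rewrite ltNge ltW// Zlt// gtrBl divr_gt0.
  - have [d /= d0 Hd] : \forall t \near sig, 0 < Z t.
      by apply: (cvgr_gt _ (cZ sig ss)).
    have [x Sx xd] := inf_adherent d0 infS.
    have : 0 < Z x.
      apply: Hd; rewrite /ball /= distrC ger0_norm ?subr_ge0 ?lbe//.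
      by rewrite ltrBlDl.
    by rewrite ltNge; case: Sx => _ ->.
exists sig => //; split=> // t; rewrite le_eqVlt => /predU1P[->|/Zlt/ltW//].
by rewrite Z0.
Qed.

Lemma ef_profile_pos (R : realType) k kap gam lam eps A sig beta (Z V : R -> R) :
  0 < beta -> 0 < A -> ef_solution k kap gam lam eps Z V ->
  exists2 r, 0 < r <= 1 & forall s, 0 < s -> s < r -> 0 < A * Z (sig + beta * ln s).
Proof.
move=> beta0 A0 [_ _ _ Z1].
have [T [_ ZT]] : \forall s \near -oo, 0 < Z s by exact: (cvgr_gt _ Z1).
exists (Num.min 1 (expR ((T - sig) / beta))).
  by rewrite lt_min ltr01 expR_gt0 ge_min lexx.
move=> s s0; rewrite lt_min => /andP[_ sr]; rewrite mulr_gt0//; apply: ZT.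
rewrite -ltrBrDl mulrC -ltr_pdivlMr// -[ltRHS]expRK ltr_ln// posrE//.
exact: expR_gt0.
Qed.

(** * The linear problem and the first eigenvalue *)

Section linear_problem.
Context {R : realType} {n : nat}.
Variables (a c lam kap : R).
Let beta := n%:R / 2 - 1 - a : R.
Let k := (4 * beta ^+ 2)^-1.
Let gam := c / (2 * beta).
Hypotheses (n0 : (0 < n)%N) (beta0 : 0 < beta) (kap0 : 0 < kap) (c0 : 0 < c)
  (lam0 : 0 < lam) (lam1 : (lam%:E < lambda1 a (@unit_ball R n) c)%E).

Let weightE (x : 'rV[R]_n) : enorm x `^ (- (2 * (a + 1)) + c) = sq x `^ (- (a + 1) + c / 2).
Proof. by rewrite enorm_powR; congr (_ `^ _); field. Qed.

(** Since gam beta = c / 2 the exponential is a power of |x|, and the shift only multiplies lam by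
    e^(gam sig). At s = 0 both sides vanish because ln 0 = 0 and Z sig = 0. *)
Lemma ef_linear_source sig A (Z : R -> R) (s : R) : 0 <= s -> Z sig = 0 ->
  A * s `^ (- a - 1) * (lam * expR (gam * (sig + beta * ln s)) * Z (sig + beta * ln s)) =
  lam * expR (gam * sig) * (s `^ (- (a + 1) + c / 2) * (A * Z (sig + beta * ln s))).
Proof.
rewrite le_eqVlt => /predU1P[<- Zs|s0 _]; first by rewrite ln0// mulr0 addr0 Zs !mulr0.
have -> : expR (gam * (sig + beta * ln s)) = expR (gam * sig) * s `^ (c / 2).
  rewrite mulrDr expRD /powR gt_eqF//; congr (_ * expR _).
  by rewrite /gam; field; rewrite gt_eqF.
have -> : s `^ (- (a + 1) + c / 2) = s `^ (- a - 1) * s `^ (c / 2).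
  by rewrite -gt0_powRD//; congr (_ `^ _); ring.
by ring.
Qed.

(** Testing the equation of the shifted profile with the profile itself gives the Rayleigh quotient
    lam e^(gam sig), at most lam because sig <= 0. *)
Lemma ef_linear_pos (Z V : R -> R) : ef_solution k kap gam lam 0 Z V ->
  forall s, s <= 0 -> 0 < Z s.
Proof.
move=> sol s s0; rewrite ltNge; apply/negP => Zs.
have gam0 : 0 < gam by rewrite divr_gt0// mulr_gt0.
have [dZ _ _ Z1] := sol.
have [T [_ ZT]] : \forall s \near -oo, 0 < Z s by exact: (cvgr_gt _ Z1).
have [sig ss [Zsig Zge0]] : exists2 sig, sig <= s & Z sig = 0 /\ forall t, t <= sig -> 0 <= Z t.
  apply: (@first_zero R Z T s) => // t ts.
  by apply: is_derive_continuous (dZ t _); exact: le_trans s0.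
have sig0 := le_trans ss s0.
pose lam' := lam * expR (gam * sig).
have lam'0 : 0 < lam' by rewrite mulr_gt0// expR_gt0.
have lam'le : lam' <= lam.
  rewrite ler_piMr ?(ltW lam0)// -expR0 ler_expR.
  by apply: mulr_ge0_le0 => //; exact: ltW.
pose W (x : 'rV[R]_n) := enorm x `^ (- (2 * (a + 1)) + c) * Z (sig + beta * ln (sq x)) ^+ 2.
have W0 x : 0 <= W x by rewrite mulr_ge0 ?powR_ge0 ?sqr_ge0.
have main A : 0 < A -> exists G,
    [/\ D12_grad a (@unit_ball R n) (fun x => A * Z (sig + beta * ln (sq x))) G,
    (lebesgue_rV n).-integrable unit_ball (EFin \o (fun x => lam' * A ^+ 2 * W x)) &
    (pairing a unit_ball G G =
      \int[lebesgue_rV n]_(x in unit_ball) (lam' * A ^+ 2 * W x)%:E)%E].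
  move=> A0; have [G [uG weak]] := @ef_profile R n a kap gam lam 0 A sig Z V
    n0 beta0 kap0 gam0 lam0 (lexx 0) A0 sig0 sol Zge0 Zsig.
  have [iG GE] := weak _ _ uG.
  have E (x : 'rV[R]_n) : @profile_source R n a kap gam lam 0 A sig Z (sq x) *
      @profile R n a A sig Z (sq x) =
      lam' * A ^+ 2 * W x.
    rewrite /profile_source /profile !mul0r add0r -/beta ef_linear_source ?sq_ge0//.
    by rewrite /W weightE /lam'; ring.
  exists G; split=> //.
    by move: iG; under eq_fun do rewrite E.
  by rewrite GE; apply: eq_integral => x _; rewrite E.
have mB := @unit_ball_measurable R n.
have iW : (lebesgue_rV n).-integrable unit_ball (EFin \o W).
  have [_ [_ i1 _]] := main 1 ltr01.
  have := integrableZl mB lam'^-1 i1; apply: eq_integrable => // x _ /=.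
  by rewrite -EFinM expr1n mulr1 mulKf// gt_eqF.
pose N1 := \int[lebesgue_rV n]_(x in unit_ball) W x.
have N1E : (\int[lebesgue_rV n]_(x in unit_ball) (W x)%:E = N1%:E)%E.
  by rewrite /N1 /Rintegral fineK; [|exact: (integrable_fin_num mB iW)].
(* Otherwise the profile would vanish almost everywhere, but it is positive near the origin apart
   from the origin itself. *)
have N10 : 0 < N1.
  rewrite lt_neqAle Rintegral_ge0// andbT; apply/eqP => N0.
  have : ae_eq (lebesgue_rV n) unit_ball (EFin \o W) (cst 0%E).
    apply/ae_eq_integral_abs; [exact: unit_ball_measurable| |].
      by have /integrableP[] := iW.
    rewrite (eq_integral (fun x => (W x)%:E)) ?N1E -?N0// => x _ /=.
    by rewrite ger0_norm.
  have [r r01 Zr] := ef_profile_pos sig beta0 ltr01 sol.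
  move=> /(ae_near_origin n0 r01)[x [x0 xr]] /= [].
  apply/eqP; rewrite gt_eqF// mulr_gt0 ?exprn_gt0//.
    by apply: powR_gt0; rewrite sqrtr_gt0.
  by have := Zr _ x0 xr; rewrite mul1r.
pose A := (Num.sqrt N1)^-1.
have A0 : 0 < A by rewrite invr_gt0 sqrtr_gt0.
have A2 : A ^+ 2 * N1 = 1 by rewrite /A exprVn sqr_sqrtr ?(ltW N10)// mulVf// gt_eqF.
have [G [uG iG GE]] := main A A0.
have : (lambda1 a (@unit_ball R n) c <= lam'%:E)%E.
  apply: ereal_inf_lbound; exists ((fun x => A * Z (sig + beta * ln (sq x))), G) => /=.
    split=> //; rewrite (eq_integral (fun x => (A ^+ 2)%:E * (W x)%:E)%E).
      by rewrite integralZl// N1E -EFinM A2.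
    move=> x _; rewrite -EFinM real_normK ?num_real//; congr EFin.
    by rewrite /W; ring.
  rewrite GE (eq_integral (fun x => (lam' * A ^+ 2)%:E * (W x)%:E)%E).
    by rewrite integralZl// N1E -EFinM -mulrA A2 mulr1.
  by move=> x _; rewrite EFinM.
by move=> /(lt_le_trans lam1); rewrite lte_fin ltNge lam'le.
Qed.

End linear_problem.

Theorem theorem5p3 (R : realType) (n : nat) (a b c d q lam : R) :
  (2 < n)%N ->
  a < (n%:R - 2) / 2 ->
  a <= b -> b <= a + 1 ->
  d = 1 + a - b -> 0 < d -> d <= 1 ->
  q = 2 * n%:R / (n%:R - 2 * d) ->
  0 < c -> c <= n%:R - 2 - 2 * a ->
  0 < lam -> (lam%:E < lambda1 a (@unit_ball R n) c)%E ->
  exists u : 'rV[R]_n -> R,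
    [/\ D12_radial a unit_ball u,
        weak_solution a unit_ball b c q lam u &
        nontrivial unit_ball u].
Proof.
move=> n2 an ab ba dE d0 d1 qE c0 cn lam0 lam1.
have n0 : (0 < n)%N by rewrite (ltn_trans _ n2).
have n2R : 2 < n%:R :> R by rewrite (ltr_nat _ 2).
pose beta := n%:R / 2 - 1 - a : R.
have beta0 : 0 < beta by rewrite /beta; move: an; lra.
pose kap := 2 * d / (n%:R - 2 * d).
have nd : 0 < n%:R - 2 * d by move: n2R d1; lra.
have kap0 : 0 < kap by rewrite divr_gt0// mulr_gt0.
pose gam := c / (2 * beta).
have gam0 : 0 < gam by rewrite divr_gt0// mulr_gt0.
(* The hypothesis on c says c <= 2 beta. *)
have gam1 : gam <= 1 by rewrite ler_pdivrMr ?mulr_gt0// mul1r /beta; move: cn; lra.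
pose k := (4 * beta ^+ 2)^-1.
have k0 : 0 < k by rewrite invr_gt0 mulr_gt0// exprn_gt0.
have [eps [Z [V [eps0 sol Zge0 Z0]]]] := shooting k0 kap0 gam0 lam0 gam1
  (@ef_linear_pos R n a c lam kap n0 beta0 kap0 c0 lam0 lam1).
pose A := eps `^ (2 * kap)^-1.
have A0 : 0 < A by exact: powR_gt0.
have kap2 : 0 < 2 * kap by rewrite mulr_gt0.
have AE : A `^ (2 * kap) = eps.
  by rewrite /A -powRrM mulVf ?gt_eqF// powRr1// ltW.
have [G [uG weak]] := @ef_profile R n a kap gam lam eps A 0 Z V
    n0 beta0 kap0 gam0 lam0 (ltW eps0) A0 (lexx 0) sol Zge0 Z0.
set u := fun x : 'rV[R]_n => _ in uG.
have uE x : u x = A * Z (beta * ln (sq x)) by rewrite /u /profile add0r.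
have L0 (x : 'rV[R]_n) : unit_ball x -> beta * ln (sq x) <= 0.
  rewrite unit_ballE /= => /ltW x1.
  by apply: mulr_ge0_le0; [exact: ltW|exact: ln_le0].
have Z01 s : s <= 0 -> 0 <= Z s <= 1.
  move=> s0; rewrite Zge0//=; apply: (@ef_le1 _ k kap gam lam k0 lam0 eps Z V s (ltW eps0) s0 sol).
  by move=> t ts; apply: Zge0; exact: le_trans s0.
have u0 x : unit_ball x -> 0 <= u x.
  by move=> /L0/Z01/andP[z0 _]; rewrite uE mulr_ge0// ltW.
have q2 : q - 2 = 2 * kap by rewrite qE /kap; field; rewrite gt_eqF.
(* With b = 1 + a - d and the critical q, the product |x|^(- 2 a - 2) e^(kap s) is the weight |x|^(-
   b q). *)
have expE : - (b * q) / 2 = - a - 1 + kap * beta.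
  have -> : b = 1 + a - d by rewrite dE; ring.
  by rewrite qE /kap /beta; field; rewrite gt_eqF.
exists u; split.
- split; first by exists G.
  exists (fun r => A * Z (beta * ln (r ^+ 2))); apply: aeW => x _.
  by rewrite uE /enorm sqr_sqrtr// edot_ge0.
- exists G => // phi H phiH; have [ifphi ->] := weak _ _ phiH.
  set f1 := fun x : 'rV[R]_n => enorm x `^ (- (b * q)) * `|u x| `^ (q - 2) * u x * phi x.
  set f2 := fun x : 'rV[R]_n => enorm x `^ (- (2 * (a + 1)) + c) * u x * phi x.
  have srcE x : unit_ball x ->
      @profile_source R n a kap gam lam eps A 0 Z (sq x) * phi x = f1 x + lam * f2 x.
    move=> Bx; have /andP[z0 z1] := Z01 _ (L0 x Bx).
    rewrite /f1 /f2 mulrA -mulrDl; congr (_ * _); rewrite /profile_source mulrDr -/beta.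
    have := @ef_linear_source R n a c lam beta0 0 A Z (sq x) (sq_ge0 x) Z0.
    rewrite -/beta -/gam => ->; rewrite mulr0 expR0 mulr1.
    rewrite [enorm x `^ (- (2 * (a + 1)) + c)]enorm_powR.
    rewrite (_ : (- (2 * (a + 1)) + c) / 2 = - (a + 1) + c / 2); last by field.
    rewrite add0r -uE; congr (_ + _).
    (* At the origin, and where Z = 0, both sides vanish through the factor u, whatever the default
       values of the powers. *)
    have := sq_ge0 x; rewrite le_eqVlt => /predU1P[x0|x0].
      by rewrite uE -x0 ln0// mulr0 Z0 clip_pow_le0 ?gt_eqF ?addr_gt0// !mulr0.
    rewrite ger0_norm ?u0// uE.
    move: (Z _) z0 z1 => z; rewrite le_eqVlt => /predU1P[<- _|z0 z1].
      by rewrite clip_pow_le0 ?gt_eqF ?addr_gt0// !mulr0.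
    rewrite clip_pow_id ?z1 ?(ltW z0)// (gt0_powRD (2 * kap) 1 z0) (powRr1 (ltW z0)) q2.
    rewrite powRM ?ltW// AE enorm_powR.
    have -> : expR (kap * (beta * ln (sq x))) = sq x `^ (kap * beta).
      by rewrite /powR gt_eqF// mulrA.
    have -> : sq x `^ (- (b * q) / 2) = sq x `^ (- a - 1) * sq x `^ (kap * beta).
      by rewrite -gt0_powRD//; congr (_ `^ _); exact: expE.
    by ring.
  have f1ge x : unit_ball x -> 0 <= enorm x `^ (- (b * q)) * `|u x| `^ (q - 2) * u x.
    by move=> Bx; apply: mulr_ge0; [rewrite mulr_ge0 ?powR_ge0|exact: u0].
  have f2ge x : unit_ball x -> 0 <= enorm x `^ (- (2 * (a + 1)) + c) * u x.
    by move=> Bx; apply: mulr_ge0; [exact: powR_ge0|exact: u0].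
  have mB := @unit_ball_measurable R n.
  have [mu_ _ _] := uG; have [mphi _ _] := phiH.
  have mf2 : measurable_fun unit_ball f2.
    apply: measurable_funM => //; apply: measurable_funM => //.
    rewrite (_ : (fun _ => _) = fun x : 'rV[R]_n => sq x `^ ((- (2 * (a + 1)) + c) / 2)).
      exact: measurable_sq_powR.
    by apply/funext => x; rewrite enorm_powR.
  (* On the ball both source terms are nonnegative, so each of them times |phi| is dominated by the
     whole source times |phi|; this allows the integral of the sum to be split. *)
  have if2 : (lebesgue_rV n).-integrable unit_ball (EFin \o (fun x => lam * f2 x)).
    apply: (ae_dominated_integrable mB _ (integrable_norm ifphi)).
      exact: measurable_funM.
    apply: aeW => x Bx /=; rewrite srcE// /f1 /f2.
    move: (f1ge x Bx) (f2ge x Bx) => p0 r0; rewrite [X in _ <= `|_ + X|]mulrA -mulrDl.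
    rewrite mulrA !(normrM _ (phi x)) ler_wpM2r//.
    have lr0 := mulr_ge0 (ltW lam0) r0.
    by rewrite (ger0_norm lr0) (ger0_norm (addr_ge0 p0 lr0)) lerDr.
  have if1 : (lebesgue_rV n).-integrable unit_ball (EFin \o f1).
    have := integrableB mB ifphi if2; apply: eq_integrable => // x; rewrite inE => Bx /=.
    by rewrite srcE// -EFinB addrK.
  rewrite (eq_integral (fun x => (f1 x)%:E + (lam * f2 x)%:E)%E); last first.
    by move=> x; rewrite inE => Bx; rewrite srcE.
  rewrite integralD//; congr (_ + _)%E.
  have if2' : (lebesgue_rV n).-integrable unit_ball (EFin \o f2).
    have := integrableZl mB lam^-1 if2; apply: eq_integrable => // x _ /=.
    by rewrite -EFinM mulKf// gt_eqF.
  by under eq_integral do rewrite EFinM; rewrite integralZl.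
- have [r r01 Zr] := ef_profile_pos 0 beta0 A0 sol.
  move=> /(ae_near_origin n0 r01)[x [x0 xr]] /eqP.
  by rewrite gt_eqF// uE; have := Zr _ x0 xr; rewrite add0r.
Qed.
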